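(* In the setting described in the context, suppose that all of the following hold. (1) $\{Y_t\}$ is strictly stationary and ergodic. (2) $E\|\eta_t\|^4<\infty$. (3) For all $i,j\in\{1,\dots,q\}$: (i) $E\big(\sup_{\theta\in\Theta}\|\nabla_{\theta_i}g_t(\theta)\|\big)^2<\infty$; (ii) $E\big(\sup_{\theta\in\Theta}\|\nabla_{\theta_i,\theta_j}g_t(\theta)\|\big)^2<\infty$. (4) $\sqrt n(\widehat\theta_n-\theta_0)=O_p(1)$. (5) $\sum_{t=1}^\infty E\big(\sup_{\theta\in\Theta}\|\widehat R_t(\theta)\|^4\big)<\infty$. (6) (i) $p$ and $p_0$ are continuous and $\|p\,\delta_{p_0,p}\|_2^2<\infty$; (ii) there is a constant $K>0$ such that $\|f(x_1)-f(x_2)\|\le K\|x_1-x_2\|$ for all $x_1,x_2$, whenever $f(x)$ is one of $s_{p_0}(x)$, $\nabla_{x_i}s_{p_0}(x)$, $\nabla_{x_i,x_j}s_{p_0}(x)$, $i,j\in\{1,\dots,d\}$. (7) (i) $k(x,x')$ is in the Stein class of $p$; (ii) $k(x,x')$ and its partial derivatives up to fourth order are all uniformly bounded. Then, under $H_1: p\ne p_0$, for any fixed constant $c>0$, $$\lim_{n\to\infty}P(n_0\widehat{\mathbb S}>c)=1.$$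
   Context: Model. $\{Y_t\}$ is an $\mathbb R^d$-valued stationary time series with $Y_t=M(I_{t-1};\theta_0)+C^{1/2}(I_{t-1};\theta_0)\eta_t$, where $I_t=\{Y_t,Y_{t-1},\dots\}$ is the information set up to time $t$; $\{\eta_t\}$ is an i.i.d. sequence in $\mathbb R^d$ with mean zero and identity covariance matrix; $M(\cdot;\theta)\in\mathbb R^d$ is a known measurable function, and $C(\cdot;\theta)\in\mathbb R^{d\times d}$ is a known measurable symmetric positive definite matrix function. Conditional on $\mathcal F_{t-1}=\sigma(I_{t-1})$, $M(I_{t-1};\theta_0)$ and $C(I_{t-1};\theta_0)$ are the conditional mean and conditional covariance matrix of $Y_t$. The parameter space $\Theta\subset\mathbb R^q$ is compact and $\theta_0$ is an interior point of $\Theta$. The true probability density of $\eta_t$ is $p$, with support $\aleph\subseteq\mathbb R^d$; $p_0$ is a given continuous hypothesized density. Residuals. Let $g(Y_t,I_{t-1};\theta)=C^{-1/2}(I_{t-1};\theta)(Y_t-M(I_{t-1};\theta))$ and $g_t(\theta)=g(Y_t,I_{t-1};\theta)$ (so $g_t(\theta_0)=\eta_t$), where $g_t$ has the partial derivatives $\nabla_{\theta_i}g_t$ and $\nabla_{\theta_i,\theta_j}g_t$ appearing in the hypotheses. Let $\widehat I_t$ be the truncated information set at time $t$, in which the values before the sample starts are replaced by given initial values. Put $\widehat g_t(\theta)=g(Y_t,\widehat I_{t-1};\theta)$ and $\widehat R_t(\theta)=\widehat g_t(\theta)-g_t(\theta)$. Given an estimator $\widehat\theta_n$ of $\theta_0$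 computed from a sample of size $n$, the residuals are $\widehat\eta_t=\widehat g_t(\widehat\theta_n)$, $t=1,\dots,n$. Score and Stein class. The score of a density $p$ is $s_p(x)=\nabla_x\log p(x)$, and $\delta_{p_0,p}(x)=s_{p_0}(x)-s_p(x)$; $\|p\,\delta_{p_0,p}\|_2^2=\int\|p(x)\delta_{p_0,p}(x)\|^2dx$. A function $f:\aleph\to\mathbb R$ is in the Stein class of $p$ if it is continuously differentiable and $\int_{\aleph}\nabla_x(f(x)p(x))\,dx=0$. The kernel $k(x,x')$ is integrally strictly positive definite, i.e. $\int_{\aleph}\int_{\aleph}g(x)k(x,x')g(x')\,dx\,dx'>0$ for every function $g$ with $0<\|g\|_2^2<\infty$. The kernel $k$ is said to be in the Stein class of $p$ if it has continuous second order partial derivatives and both $k(x,\cdot)$ and $k(\cdot,x)$ are in the Stein class of $p$ for every fixed $x$. Test statistic. Define $$u(x,x')=s_{p_0}(x)^\top k(x,x')s_{p_0}(x')+s_{p_0}(x)^\top\nabla_{x'}k(x,x')+\nabla_xk(x,x')^\top s_{p_0}(x')+\mathrm{trace}(\nabla_{x,x'}k(x,x')),$$ $n_0=[K_0n^{1-\varepsilon}]$ (integer part) for fixed constants $K_0>0$ and $0<\varepsilon<1$, and $$\widehat{\mathbb S}=\frac{2}{n_0(n_0-1)}\sum_{n-n_0+1\le i<j\le n}u(\widehat\eta_i,\widehat\eta_j).$$ *)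

(* Defs.v *)
From HB Require Import structures.
From mathcomp Require Import all_boot all_order all_algebra.
From mathcomp Require Import all_classical all_reals all_analysis.
From mathcomp Require Import measurable_realfun.

Set Implicit Arguments.
Unset Strict Implicit.
Unset Printing Implicit Defensive.

Import Order.TTheory GRing.Theory Num.Theory.
Import numFieldNormedType.Exports.

Local Open Scope classical_set_scope.
Local Open Scope ring_scope.

Section MatrixBorel.
Variables (R : realType) (m n : nat).

Definition mx_cylinders : set (set 'M[R]_(m, n)) :=
  [set A | exists i j, exists2 B : set R,
     measurable B & A = [set M : 'M[R]_(m, n) | B (M i j)]].

(* The sigma-algebra generated by the entries; on a finite-dimensional space it
   is the Borel one. *)
HB.instance Definition _ := @isMeasurable.Build (sigma_display mx_cylinders)
  'M[R]_(m, n) <<s mx_cylinders >> (@sigma_algebra0 _ setT mx_cylinders)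
  (@sigma_algebraC _ mx_cylinders) (@sigma_algebra_bigcup _ setT mx_cylinders).

Lemma measurable_mx_entry i j :
  measurable_fun [set: 'M[R]_(m, n)] (fun M => M i j).
Proof.
move=> _ B mB; rewrite setTI; apply: sub_sigma_algebra.
by exists i, j, B.
Qed.

Lemma measurable_mxP d (T : measurableType d) (f : T -> 'M[R]_(m, n)) :
  measurable_fun setT f <-> forall i j, measurable_fun setT (fun x => f x i j).
Proof.
split=> [mf i j|mf].
  exact: (measurableT_comp (measurable_mx_entry i j) mf).
move=> _ A mA.
have H : <<s mx_cylinders >> `<=` [set A | measurable (f @^-1` A)].
  apply: smallest_sub.
    split => /=.
    - by rewrite preimage_set0.
    - by move=> B mB; rewrite setTD preimage_setC; exact: measurableC.
    - by move=> F mF; rewrite preimage_bigcup; apply: bigcup_measurable => k _;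
        exact: mF.
  move=> _ [i [j [B mB ->]]] /=.
  by have := mf i j measurableT B mB; rewrite setTI.
by rewrite setTI; exact: H.
Qed.

End MatrixBorel.

Section LebesgueSucc.
Variables (R : realType) (n : nat).
Variable mu : {sigma_finite_measure set 'cV[R]_n -> \bar R}.

Definition cV_cons (z : R * 'cV[R]_n) : 'cV[R]_n.+1 :=
  col_mx (const_mx z.1 : 'cV[R]_1) z.2.

Lemma measurable_cV_cons : measurable_fun setT cV_cons.
Proof.
apply/measurable_mxP => i j.
case: (split_ordP (i : 'I_(1 + n))) => k ->.
  apply: (eq_measurable_fun (fun z : R * 'cV[R]_n => z.1)) => [z _|].
    by rewrite /= /cV_cons (@col_mxEu _ 1 n) mxE.
  exact: measurable_fst.
apply: (eq_measurable_fun (fun z : R * 'cV[R]_n => z.2 k j)) => [z _|].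
  by rewrite /= /cV_cons (@col_mxEd _ 1 n).
exact: (measurableT_comp (measurable_mx_entry k j) measurable_snd).
Qed.

Definition leb_succ : set 'cV[R]_n.+1 -> \bar R :=
  pushforward (lebesgue_measure \x mu)%E cV_cons.

HB.instance Definition _ := Measure.copy leb_succ
  (measure_function_pushforward__canonical__measure_function_Measure
     (lebesgue_measure \x mu)%E measurable_cV_cons).

Lemma sigma_finite_leb_succ : sigma_finite setT leb_succ.
Proof.
have [F FT Ffin] : sigma_finite setT (lebesgue_measure \x mu)%E.
  have /sigma_finiteP[F [TF ndF Foo]] := sigma_finiteT (@lebesgue_measure R).
  have /sigma_finiteP[G [TG ndG Goo]] := sigma_finiteT mu.
  exists (fun k => F k `*` G k).
    rewrite -setXTT TF TG predeqE => -[x y]; split.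
      move=> [/= [i _ Fix] [j _ Gjy]]; exists (maxn i j) => //; split.
      - by move: x Fix; exact/subsetPset/ndF/leq_maxl.
      - by move: y Gjy; exact/subsetPset/ndG/leq_maxr.
    by move=> [i _ [/= ? ?]]; split; exists i.
  move=> k; have [mF Fk] := Foo k; have [mG Gk] := Goo k.
  split; first exact: measurableX.
  by rewrite product_measure1E// lte_mul_pinfty// ge0_fin_numE.
pose h (x : 'cV[R]_n.+1) : R * 'cV[R]_n :=
  ((x : 'cV_(1 + n)) (lshift n ord0) ord0, dsubmx (x : 'cV_(1 + n))).
have hK : cancel cV_cons h.
  move=> [a v]; rewrite /h /cV_cons col_mxEu mxE.
  by rewrite col_mxKd.
have mh : measurable_fun setT h.
  apply/measurable_fun_pairP; split => /=.
    exact: (@measurable_mx_entry R n.+1 1).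
  apply/measurable_mxP => i j.
  apply: (eq_measurable_fun (fun x : 'cV[R]_n.+1 => x (rshift 1 i) j)) => [x _|].
    by rewrite /= mxE.
  exact: (@measurable_mx_entry R n.+1 1).
exists (fun k => h @^-1` F k).
  by rewrite -preimage_bigcup -FT.
move=> k; have [mF Fk] := Ffin k; split.
  by rewrite -[X in measurable X]setTI; exact: mh.
rewrite /leb_succ /pushforward -comp_preimage.
by rewrite (_ : h \o cV_cons = id) ?preimage_id//; apply/funext => z; exact: hK.
Qed.

HB.instance Definition _ := Measure_isSigmaFinite.Build _ _ _
  leb_succ sigma_finite_leb_succ.

End LebesgueSucc.

(* Lebesgue measure on the column vectors R^d, as the d-fold product of the
   one-dimensional one. *)
Fixpoint lebesgue_cV (R : realType) (d : nat) :
    {sigma_finite_measure set 'cV[R]_d -> \bar R} :=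
  if d is d'.+1 then leb_succ (lebesgue_cV R d') else \d_(0 : 'cV[R]_0).

Lemma lebesgue_cV_box (R : realType) (d : nat) (a b : 'cV[R]_d) :
  (forall i, a i 0 <= b i 0) ->
  lebesgue_cV R d [set x | forall i, a i 0 <= x i 0 <= b i 0] =
  (\prod_i (b i 0 - a i 0))%:E.
Proof.
elim: d a b => [|d IH] a b ab.
  rewrite /= big_ord0 diracE mem_set//=.
  by move=> [].
pose tl (x : 'cV[R]_d.+1) : 'cV[R]_d := \col_i x (lift ord0 i) 0.
pose A : set R := [set` `[a 0 0, b 0 0]].
pose B : set 'cV[R]_d := [set x | forall i, tl a i 0 <= x i 0 <= tl b i 0].
have mB : measurable B.
  rewrite (_ : B = \bigcap_i
      (fun x : 'cV[R]_d => x i 0) @^-1` [set` `[tl a i 0, tl b i 0]]).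
    apply: fin_bigcap_measurable => // i _.
    rewrite -[X in measurable X]setTI.
    exact: measurable_mx_entry.
  apply/seteqP; split => x /= H i; [move=> _|]; have := H i; rewrite /= in_itv//=.
  exact.
rewrite /= /leb_succ /pushforward big_ord_recl EFinM.
have -> : cV_cons (n:=d) @^-1` [set x | forall i, a i 0 <= x i 0 <= b i 0] =
    A `*` B.
  have E0 (z : R * 'cV[R]_d) : cV_cons z 0 0 = z.1.
    have -> : 0 = lshift d ord0 :> 'I_(1 + d) by apply: val_inj.
    by rewrite /cV_cons (@col_mxEu _ 1 d) mxE.
  have E1 (z : R * 'cV[R]_d) i : cV_cons z (lift ord0 i) 0 = z.2 i 0.
    have -> : lift ord0 i = rshift 1 i :> 'I_(1 + d) by apply: val_inj.
    by rewrite /cV_cons (@col_mxEd _ 1 d).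
  apply/seteqP; split => z /=.
    move=> H; split; first by have := H 0; rewrite E0 /A /= in_itv.
    by move=> i; have := H (lift ord0 i); rewrite E1 !mxE.
  move=> [zA zB] i; case: (unliftP ord0 i) => [j|] ->.
    by rewrite E1; have := zB j; rewrite !mxE.
  by rewrite E0; have := zA; rewrite /A /= in_itv.
rewrite product_measure1E//; last exact: measurable_itv.
have mA : lebesgue_measure A = (b 0 0 - a 0 0)%:E.
  rewrite /A lebesgue_measure_itv/= lte_fin; case: ltP => // ba.
  by congr EFin; apply/esym/eqP; rewrite subr_eq0 eq_le ba ab.
rewrite IH; last by move=> i; rewrite !mxE.
congr (_ * _%:E)%E; first exact: mA.
by apply: eq_bigr => i _; rewrite !mxE.
Qed.

Section Calculus.
Variable R : realType.

(* The norm that the library puts on matrices is the sup norm. *)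
Definition enorm d (v : 'cV[R]_d) : R := Num.sqrt (\sum_i v i 0 ^+ 2).

Definition evec d (i : 'I_d) : 'cV[R]_d := delta_mx i 0.

Definition dotp d (v w : 'cV[R]_d) : R := (v^T *m w) 0 0.

Definition posdef d (A : 'M[R]_d) : Prop :=
  A^T = A /\ forall v : 'cV[R]_d, v != 0 -> 0 < dotp v (A *m v).

(* [is_sqrtmx A B] says B = A^{1/2}: a positive definite matrix has exactly one
   positive definite square root. *)
Definition is_sqrtmx d (A B : 'M[R]_d) : Prop := posdef B /\ B *m B = A.

(* Iterated directional derivatives; the head of the list is the direction of
   the outermost derivative. *)
Fixpoint pderiv (V W : normedModType R) (vs : seq V) (f : V -> W) : V -> W :=
  if vs is v :: vs' then 'D_v (pderiv vs' f) else f.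

Fixpoint pderivable (V W : normedModType R) (vs : seq V) (f : V -> W) : Prop :=
  if vs is v :: vs' then
    pderivable vs' f /\ forall x, derivable (pderiv vs' f) x v
  else True.

Definition grad d (f : 'cV[R]_d -> R) (x : 'cV[R]_d) : 'cV[R]_d :=
  \col_i 'D_(evec i) f x.

End Calculus.

Section Paths.
Variables (I : Type) (disp : measure_display) (T : measurableType disp).

Definition path_cylinders : set (set (I -> T)) :=
  [set A | exists i, exists2 B : set T,
     measurable B & A = [set f : I -> T | B (f i)]].

(* I -> T with the product sigma-algebra. *)
Definition paths := g_sigma_algebraType path_cylinders.

End Paths.

Section Probability.
Variables (R : realType) (dO : measure_display) (Omega : measurableType dO).
Variable P : probability Omega R.

Definition strictly_stationary disp (T : measurableType disp)
    (Y : int -> Omega -> T) : Prop :=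
  forall A : set (paths int T), measurable A ->
    P [set w | A (fun t => Y (t + 1) w)] = P [set w | A (fun t => Y t w)].

Definition ergodic disp (T : measurableType disp) (Y : int -> Omega -> T) :
    Prop :=
  forall A : set (paths int T), measurable A ->
    (forall y : int -> T, A (fun t => y (t + 1)) <-> A y) ->
    P [set w | A (fun t => Y t w)] = 0%E \/ P [set w | A (fun t => Y t w)] = 1%E.

Definition mutually_independent (I : eqType) disp (T : measurableType disp)
    (X : I -> Omega -> T) : Prop :=
  forall (s : seq I) (B : I -> set T), uniq s -> (forall i, measurable (B i)) ->
    P [set w | forall i, i \in s -> B i (X i w)] =
    (\prod_(i <- s) P (X i @^-1` B i))%E.

Definition identically_distributed (I : Type) disp (T : measurableType disp)
    (X : I -> Omega -> T) : Prop :=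
  forall (i j : I) (B : set T), measurable B ->
    P (X i @^-1` B) = P (X j @^-1` B).

(* Z is a version of E[X | G].  X is tested on the events of G on which it is
   integrable: for integrable X these are all of G and this is the usual
   definition, and otherwise the conditional expectation is understood in the
   extended (sigma-integrable) sense. *)
Definition is_cond_exp (G : set (set Omega)) (X Z : Omega -> R) : Prop :=
  (forall B : set R, measurable B -> G (Z @^-1` B)) /\
  forall A, G A -> P.-integrable A (EFin \o X) ->
    P.-integrable A (EFin \o Z) /\
    (\int[P]_(w in A) (Z w)%:E = \int[P]_(w in A) (X w)%:E)%E.

(* X_n = O_p(1), for nonnegative X_n. *)
Definition Op1 (X : nat -> Omega -> R) : Prop :=
  forall e : R, 0 < e -> exists B : R,
    \forall n \near \oo, (P [set w | (B < X n w)%R] <= e%:E)%E.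

End Probability.

Section Stein.
Variables (R : realType) (d : nat).
Implicit Types (p f : 'cV[R]_d -> R) (k : 'cV[R]_d -> 'cV[R]_d -> R).

Let leb := lebesgue_cV R d.

Definition is_density p : Prop :=
  [/\ forall x, 0 <= p x, measurable_fun setT p &
      (\int[leb]_x (p x)%:E = 1)%E].

Definition supp p : set 'cV[R]_d := [set x | 0 < p x].

(* [has_score_on A p]: the score of p is defined at every point of A. *)
Definition has_score_on (A : set 'cV[R]_d) p : Prop :=
  forall x, A x -> 0 < p x /\ forall i, derivable (fun y => ln (p y)) x (evec R i).

Definition score p : 'cV[R]_d -> 'cV[R]_d := grad (fun y => ln (p y)).

Definition score_diff p0 p (x : 'cV[R]_d) : 'cV[R]_d := score p0 x - score p x.

(* In \bar R, +oo - oo = -oo, so an integral equal to 0 has finite positive and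
   negative parts. *)
Definition stein_class p f : Prop :=
  (forall x i, supp p x ->
     derivable f x (evec R i) /\ {for x, continuous ('D_(evec R i) f)}) /\
  forall i, (\int[leb]_(x in supp p)
               ('D_(evec R i) (fun y => (f y * p y)%R : R) x)%:E = 0)%E.

Definition kernel_dir (s : 'I_d + 'I_d) : 'cV[R]_d * 'cV[R]_d :=
  match s with inl i => (evec R i, 0) | inr j => (0, evec R j) end.

(* The partial derivative of k(x,x') in the coordinates a, where inl i stands
   for x_i and inr j for x'_j. *)
Definition kernel_pderiv k (a : seq ('I_d + 'I_d)) :
    'cV[R]_d * 'cV[R]_d -> R :=
  pderiv (map kernel_dir a) (fun z => k z.1 z.2 : R).

Definition kernel_pderivable k (a : seq ('I_d + 'I_d)) : Prop :=
  pderivable (map kernel_dir a) (fun z => k z.1 z.2 : R).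

Definition stein_kernel p k : Prop :=
  (forall a, size a = 2%N ->
     kernel_pderivable k a /\ continuous (kernel_pderiv k a)) /\
  forall x, supp p x -> stein_class p (k x) /\ stein_class p (k ^~ x).

Definition kernel_bounded4 k : Prop :=
  exists B : R, forall a, (size a <= 4)%N ->
    kernel_pderivable k a /\ forall z, `|kernel_pderiv k a z| <= B.

(* The double integral is positive only if its negative part is finite. *)
Definition integrally_strictly_posdef (A : set 'cV[R]_d) k : Prop :=
  forall g : 'cV[R]_d -> R, measurable_fun A g ->
    (0 < \int[leb]_(x in A) (g x ^+ 2)%:E < +oo)%E ->
    (0 < \int[leb \x leb]_(z in A `*` A) (g z.1 * k z.1 z.2 * g z.2)%:E)%E.

Definition lipschitz_score p0 : Prop :=
  exists2 K : R, 0 < K & forall a : seq 'I_d, (size a <= 2)%N ->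
    let f := pderiv (map (@evec R d) a) (score p0) in
    pderivable (map (@evec R d) a) (score p0) /\
    forall x1 x2, enorm (f x1 - f x2) <= K * enorm (x1 - x2).

Definition stein_u p0 k (x x' : 'cV[R]_d) : R :=
  dotp (score p0 x) (k x x' *: score p0 x')
  + dotp (score p0 x) (grad (k x) x')
  + dotp (grad (k ^~ x') x) (score p0 x')
  + \tr (\matrix_(i, j) 'D_(evec R i) (fun y => 'D_(evec R j) (k y) x' : R) x).

End Stein.

Section Model.
Variables (R : realType) (d q : nat).

(* An information set (Y_t, Y_{t-1}, ...); entry s is the value at lag s. *)
Definition infoset := paths nat [the measurableType _ of 'cV[R]_d].

Definition info (Omega : Type) (Y : int -> Omega -> 'cV[R]_d) (t : int)
    (w : Omega) : infoset := fun s : nat => Y (t - s%:Z) w.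

(* The sample starts at time 1; y0 gives the initial values at times <= 0. *)
Definition info_trunc (Omega : Type) (y0 : int -> 'cV[R]_d)
    (Y : int -> Omega -> 'cV[R]_d) (t : int) (w : Omega) : infoset :=
  fun s : nat => if 1 <= t - s%:Z then Y (t - s%:Z) w else y0 (t - s%:Z).

Definition sigma_info (Omega : Type) (Y : int -> Omega -> 'cV[R]_d) (t : int) :
    set (set Omega) :=
  preimage_set_system setT (info Y t) (@measurable _ infoset).

Variables (M : infoset -> 'cV[R]_q -> 'cV[R]_d).
Variables (Chalf : infoset -> 'cV[R]_q -> 'M[R]_d).

Definition gfun (y : 'cV[R]_d) (I : infoset) (theta : 'cV[R]_q) : 'cV[R]_d :=
  invmx (Chalf I theta) *m (y - M I theta).

Definition sup_enorm (Theta : set 'cV[R]_q) (f : 'cV[R]_q -> 'cV[R]_d) :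
    \bar R := ereal_sup [set (enorm (f theta))%:E | theta in Theta].

Variables (Omega : Type) (Y : int -> Omega -> 'cV[R]_d) (y0 : int -> 'cV[R]_d).

Definition g_t (t : int) (w : Omega) : 'cV[R]_q -> 'cV[R]_d :=
  gfun (Y t w) (info Y (t - 1) w).

Definition ghat_t (t : int) (w : Omega) : 'cV[R]_q -> 'cV[R]_d :=
  gfun (Y t w) (info_trunc y0 Y (t - 1) w).

Definition Rhat_t (t : int) (w : Omega) (theta : 'cV[R]_q) : 'cV[R]_d :=
  ghat_t t w theta - g_t t w theta.

Variable est : forall n, n.-tuple 'cV[R]_d -> 'cV[R]_q.

Definition thetahat (n : nat) (w : Omega) : 'cV[R]_q :=
  est [tuple Y (t.+1)%:Z w | t < n].

Definition etahat (n t : nat) (w : Omega) : 'cV[R]_d :=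
  ghat_t t%:Z w (thetahat n w).

Variables (K0 eps : R) (p0 : 'cV[R]_d -> R) (k : 'cV[R]_d -> 'cV[R]_d -> R).

Definition n0 (n : nat) : nat := Num.truncn (K0 * n%:R `^ (1 - eps)).

Definition Shat (n : nat) (w : Omega) : R :=
  2 / ((n0 n)%:R * ((n0 n)%:R - 1)) *
  \sum_(n - n0 n + 1 <= i < n.+1) \sum_(i.+1 <= j < n.+1)
     stein_u p0 k (etahat n i w) (etahat n j w).

End Model.

(* Main.v *)
Require Import Defs.
From HB Require Import structures.
From mathcomp Require Import all_boot all_order all_algebra.
From mathcomp Require Import all_classical all_reals all_analysis.
From mathcomp Require Import measurable_realfun.
From mathcomp Require Import ring lra zify.

Set Implicit Arguments.
Unset Strict Implicit.
Unset Printing Implicit Defensive.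

Import Order.TTheory GRing.Theory Num.Theory.
Import numFieldNormedType.Exports.

Local Open Scope classical_set_scope.
Local Open Scope ring_scope.

(** Let S be the integral of u(x,x') p(x) p(x') and h = p (s_{p0} - s_p).
    Integrating by parts in both arguments gives S = \int\int h k h.  Since p
    need not be bounded away from 0 nor h integrable, this is done with weights
    a_e(p) vanishing where p <= e, and then e tends to 0; as k is strictly
    positive definite, S > 0 unless h = 0 almost everywhere.  In that case p/p0
    has vanishing derivatives along the axes wherever it is positive, hence it is
    constant and p = p0, so S > 0 under H_1.

    The statistic computed from the true innovations is a U-statistic with mean
    S, and Chebyshev's inequality makes it close to S.  As the score is
    Lipschitz and the derivatives of k up to order 4 are bounded, u has linear
    growth and is Lipschitz up to such a factor, so replacing the innovations by
    the residuals costs O(tau) as soon as |eta^_t - eta_t|^2 has mean at most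
    tau^2 over the window.  On the event sqrt n |theta^_n - theta_0| <= B, this
    square is at most a constant times
    sup |R^_t|^2 + (1/n) \sum_i sup |d_i g_t|^2, whose expectation has an
    average over the window tending to 0, by the summability of
    E sup |R^_t|^4 and by stationarity.  Hence S^ > S/2 with probability tending
    to 1, while n_0 tends to infinity. *)

(** * The fundamental theorem of calculus for everywhere differentiable functions *)

Section FTC.
Variable R : realType.
Notation mu := (@lebesgue_measure R).
Implicit Types (v f : R -> R) (g : R -> \bar R).

(** The partial derivatives of [p] are not assumed continuous, so integration by parts rests on a
    fundamental theorem of calculus for functions derivable everywhere with integrable derivative.
    Boundary terms disappear through translation invariance instead of decay at infinity. The weight
    a_e(s) = 1 - (e/s)^2 for s > e is the derivative of A_e(s) = (s - e)^2 / s. Both vanish for s <=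
    e: this discards the points where the score of [p] is undefined, and it gives |a_e(p) h| <= p/e
    + h^2, which is integrable although h is only known to be square integrable. The limit in e is
    delicate because h k h need not be absolutely integrable: strict positive definiteness only
    makes its negative part finite. The positive part passes to the limit by monotone convergence
    while the negative part is merely bounded; the resulting inequality, \int\int h k h <= S for
    each coordinate, is enough for S > 0. The residuals are controlled through suprema over [Theta],
    which are random variables with values in [\bar R]; the bounds on them are therefore stated in
    [\bar R], infinite values included. *)

Lemma cvg_harmonic_dnbhs : @harmonic R @ \oo --> (0 : R)^'.
Proof.
move=> A [e /= e0 eA].
have /cvgrPdist_lt/(_ e e0) := @cvg_harmonic R.
by apply: filterS => n /= Hn; apply: eA => //=; rewrite invr_neq0.
Qed.

(** Sampling the difference quotient along a sequence presents a derivative as a countable limit;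
    this is how derivatives are shown to be measurable. *)
Lemma cvg_diff_quotient (V W : normedModType R) (f : V -> W) x u :
  derivable f x u ->
  n.+1%:R *: (f (x + n.+1%:R^-1 *: u) - f x) @[n --> \oo] --> 'D_u f x.
Proof.
move=> df.
have := cvg_comp _ _ cvg_harmonic_dnbhs df.
move=> H; apply: cvg_trans H; apply: near_eq_cvg.
by apply: nearW => n; rewrite /= /harmonic/= invrK [_ *: u + x]addrC.
Qed.

Lemma derivable_lt_right v x c : derivable v x 1 -> 'D_1 v x < c ->
  exists2 e, 0 < e & forall y, x <= y -> y < x + e -> v y - v x <= c * (y - x).
Proof.
move=> /[dup] dv /derivableP/is_derive1_caratheodory[q [qE qc qx]] vc.
have : \forall y \near x, q y < c.
  have := qc; rewrite /prop_for /continuous_at qx => /(_ _ (lt_nbhsl vc)).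
  exact.
move=> /nbhs_ballP[e /= e0 xe]; exists e => // y xy yx.
rewrite qE ler_wpM2r ?subr_ge0//; apply/ltW/xe => /=.
by rewrite /ball /= distrC ger0_norm ?subr_ge0// ltrBlDl.
Qed.

Lemma derivable1_continuous v : (forall x, derivable v x 1) -> continuous v.
Proof. by move=> dv x; exact/differentiable_continuous/derivable1_diffP. Qed.

Lemma derivable_measurable_D1 v : (forall x, derivable v x 1) ->
  measurable_fun setT ('D_1 v).
Proof.
move=> dv.
have mv : measurable_fun setT v.
  by apply: continuous_measurable_fun; exact: derivable1_continuous.
apply: (@measurable_fun_cvg _ (measurableTypeR R) R setT
  (fun n x => n.+1%:R * (v (x + n.+1%:R^-1) - v x))).
  move=> m; apply: measurable_funM => //; apply: measurable_funB => //.
  by apply: measurableT_comp => //; exact: measurable_funD.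
move=> x _; have := cvg_diff_quotient (dv x).
by under eq_fun do rewrite /= [_ *: 1]mulr1.
Qed.

(* A supremum argument: the set of [x] up to which the inequality holds is
   closed, and by the local hypothesis it cannot stop before [b]. *)
Lemma increment_le_integral v g a b : a <= b ->
  (forall x, derivable v x 1) -> measurable_fun setT g ->
  (forall x, (0 <= g x)%E) ->
  (forall x, a <= x <= b -> exists2 c, 'D_1 v x < c & 0 <= c /\
    \forall y \near x, (c%:E <= g y)%E) ->
  ((v b - v a)%:E <= \int[mu]_(x in `[a, b]) g x)%E.
Proof.
move=> ab dv mg g0 loc.
have cv := derivable1_continuous dv.
pose Ig x := (\int[mu]_(t in `[a, x]) g t)%E.
have mgD D : measurable_fun D g by exact: measurable_funTS.
have Ig_le x y : x <= y -> (Ig x <= Ig y)%E.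
  move=> xy; apply: ge0_subset_integral => //.
    exact: mgD.
  by apply: subset_itvl; rewrite bnd_simp.
have Ig0 t : (0 <= Ig t)%E by exact: integral_ge0.
pose S := [set x | a <= x <= b /\
  forall y, a <= y <= x -> ((v y - v a)%:E <= Ig y)%E].
have Sa : S a.
  split; first by rewrite lexx ab.
  by move=> y; rewrite -eq_le => /eqP <-; rewrite subrr.
have ubS : ubound S b by move=> x [/andP[]].
have supS : has_sup S by split; [exists a|exists b].
pose s := sup S.
have as_ : a <= s by apply: ub_le_sup => //; exists b.
have sb : s <= b by apply: ge_sup => //; exists a.
have below y : a <= y -> y < s -> ((v y - v a)%:E <= Ig y)%E.
  move=> ay ys; have [x [_ Sx] yx] := sup_gt (ex_intro _ a Sa) ys.
  by apply: Sx; rewrite ay ltW.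
(* [v] is continuous and [Ig] is monotone, so a strict failure at [s] would persist at some [y < s],
   against [below]. *)
have Ss : ((v s - v a)%:E <= Ig s)%E.
  rewrite leNgt; apply/negP => lt.
  move: as_; rewrite le_eqVlt => /orP[/eqP sa|as_].
    by move: lt; rewrite -sa subrr ltNge Ig0.
  have fin : Ig s \is a fin_num by rewrite ge0_fin_numE// (lt_trans lt) ?ltry.
  move: lt; rewrite -(fineK fin) lte_fin => lt.
  have [y /= [ay ys vy]] : exists y, [/\ a <= y, y < s & fine (Ig s) < v y - v a].
    have : \forall y \near s^'-, fine (Ig s) < v y - v a.
      have c1 : v y - v a @[y --> s^'-] --> v s - v a.
        by apply: cvgB; [exact/cvg_at_left_filter/cv|exact: cvg_cst].
      exact: (c1 _ (lt_nbhsr lt)).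
    move=> H; have : \forall y \near s^'-, [/\ a <= y, y < s & fine (Ig s) < v y - v a].
      near=> y; split; last by near: y.
        by near: y; exact: nbhs_left_ge.
      by near: y; exact: nbhs_left_lt.
    by move=> /filter_ex.
  have := below y ay ys; rewrite leNgt => /negP; apply.
  rewrite (@le_lt_trans _ _ (fine (Ig s))%:E)// ?lte_fin//.
  by rewrite fineK// Ig_le// ltW.
have SS : S s.
  split; first by rewrite as_.
  move=> y /andP[ay]; rewrite le_eqVlt => /orP[/eqP ->//|ys].
  exact: below.
move: sb; rewrite le_eqVlt => /orP[/eqP <-//|sb].
have [|c vc [c0 gc]] := loc s; first by rewrite as_ ltW.
have [e1 e10 H1] := derivable_lt_right (dv s) vc.
have /nbhs_ballP[e2 /= e20 H2] := gc.
exfalso.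
(* Between [s] and [s + e] the increment of [v] is at most [c * (y - s)], [g] is at least [c], and
   [b] is not passed. Hence [s + e / 2] is in [S], above its supremum. *)
pose e := Num.min (Num.min e1 e2) (b - s).
have e0 : 0 < e by rewrite !lt_min e10 e20 subr_gt0.
have : S (s + e / 2).
  split.
    have he2 : e / 2 <= e by rewrite ler_pdivrMr// ler_peMr ?ltW// ltr1n.
    have ebs : e <= b - s by rewrite /e ge_min lexx orbT.
    by apply/andP; split; lra.
  move=> y /andP[ay ye].
  have [|sy] := leP y s; first by move=> ys; apply: SS.2; rewrite ay.
  have ye' : y < s + e.
    by rewrite (le_lt_trans ye)// ltrD2l ltr_pdivrMr// ltr_pMr ?ltr1n.
  have -> : Ig y = (Ig s + \int[mu]_(t in `]s, y]) g t)%E.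
    rewrite /Ig (@itv_bndbnd_setU _ _ _ (BRight s)) ?bnd_simp ?(ltW sy)//.
    rewrite ge0_integral_setU//; first exact: mgD.
    apply/disj_setPS => z [] /=; rewrite !in_itv/= => /andP[_ zs] /andP[+ _].
    by rewrite ltNge zs.
  rewrite (_ : v y - v a = (v s - v a) + (v y - v s)); last by ring.
  rewrite EFinD leeD//.
  apply: (@le_trans _ _ (c * (y - s))%:E).
    rewrite lee_fin; apply: H1; first exact: ltW.
    by rewrite (lt_le_trans ye')// lerD2l !ge_min lexx.
  apply: (@le_trans _ _ (\int[mu]_(t in `]s, y]) (c%:E))%E).
    rewrite integral_cst//= lebesgue_measure_itv/= lte_fin sy -EFinB -EFinM//.
  apply: ge0_le_integral => //; first exact: mgD.
  move=> t /=; rewrite in_itv/= => /andP[st ty]; apply: H2 => /=.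
  rewrite /ball /= distrC ger0_norm ?subr_ge0 ?(ltW st)// ltrBlDl.
  by rewrite (le_lt_trans ty)// (lt_le_trans ye')// lerD2l !ge_min lexx orbT.
move=> /(ub_le_sup (ex_intro _ b ubS)); rewrite -/s.
by rewrite gerDl leNgt divr_gt0.
Unshelve. all: by end_near. Qed.

End FTC.
Section FTC2.
Variable R : realType.
Notation mu := (@lebesgue_measure R).
Implicit Types (v f : R -> R) (g : R -> \bar R).

(* [g] below is a lower semicontinuous majorant of [max v' 0], obtained by
   covering the level sets [E m] of [max v' 0] by slightly larger open sets. *)
Lemma increment_le_integral_pos v a b : a <= b ->
  (forall x, derivable v x 1) ->
  ((v b - v a)%:E <= \int[mu]_(x in `[a, b]) (Num.max ('D_1 v x) 0)%:E)%E.
Proof.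
move=> ab dv.
pose h x : R := Num.max ('D_1 v x) 0.
have mh : measurable_fun setT h.
  apply: measurable_maxr; last exact: measurable_cst.
  exact: derivable_measurable_D1.
have h0 x : 0 <= h x by rewrite /h le_max lexx orbT.
apply/lee_addgt0Pr => e0 e00.
(* Rounding [h] up to a multiple of [e] costs [e * (b - a)] and the open covers cost [e]: in total
   [e0]. *)
pose e := e0 / (b - a + 1).
have ba1 : 0 < b - a + 1 by rewrite ltr_wpDl// subr_ge0.
have e_gt0 : 0 < e by rewrite divr_gt0.
pose E m := `[a, b]%classic `&` [set x | m%:R * e <= h x < m.+1%:R * e].
have mE m : measurable (E m).
  apply: measurableI => //.
  rewrite (_ : [set x | _] = h @^-1` `[m%:R * e, m.+1%:R * e[%classic).
    by rewrite -[X in measurable X]setTI; exact: mh.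
  by apply/seteqP; split=> x /=; rewrite in_itv.
have Efin m : (mu (E m) < +oo)%E.
  apply: (@le_lt_trans _ _ (mu (`[a, b]%classic : set R))).
    by apply: le_measure; rewrite ?inE; [exact: mE|exact: measurable_itv|exact: subIsetl].
  by rewrite lebesgue_measure_itv/=; case: ifPn => _; rewrite -?EFinD ltry.
(* The excess measure allowed to [G m], weighted by the height [m.+1%:R * e], is [e / 2 ^ m.+1];
   these sum to [e]. *)
pose tau m := e / (2 ^ m.+1)%:R / (m.+1%:R * e).
have tau0 m : 0 < tau m by rewrite !divr_gt0// mulr_gt0.
have /choice[G GP] m := lebesgue_regularity_outer (mE m) (Efin m) (tau0 m).
have mG m : measurable (G m) by have [oG _ _] := GP m; exact: open_measurable.
pose gm m x := ((m.+1%:R * e)%:E * (\1_(G m) x)%:E)%E.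
pose g x := (\sum_(0 <= m <oo) gm m x)%E.
have gm0 m x : (0 <= gm m x)%E.
  by rewrite mule_ge0// lee_fin mulr_ge0// ltW.
have mgm m : measurable_fun setT (gm m).
  by apply: measurable_funeM; apply/measurable_EFinP; exact: measurable_indic.
have mg : measurable_fun setT g.
  by apply: ge0_emeasurable_sum => // m x _ _; exact: gm0.
have g0 x : (0 <= g x)%E by apply: nneseries_ge0 => m _ _; exact: gm0.
have gm_le m x : (gm m x <= g x)%E.
  rewrite /g (nneseries_split _ m.+1) => [|i _]; last exact: gm0.
  rewrite add0n big_nat_recr//= [X in (X + _)%E]addeC -addeA leeDl// adde_ge0//.
    by apply: sume_ge0 => i _; exact: gm0.
  by apply: nneseries_ge0 => i _ _; exact: gm0.
have key : ((v b - v a)%:E <= \int[mu]_(x in `[a, b]) g x)%E.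
  apply: increment_le_integral => // x axb.
  pose m := Num.truncn (h x / e).
  have /andP[m1 m2] := truncn_itv (divr_ge0 (h0 x) (ltW e_gt0)).
  rewrite -/m in m1 m2; move: m1 m2.
  rewrite ler_pdivlMr// ltr_pdivrMr// => m1 m2.
  exists (m.+1%:R * e).
    by rewrite (le_lt_trans _ m2)// /h le_max lexx.
  split; first by rewrite mulr_ge0// ltW.
  have [oG EG _] := GP m.
  have Gx : G m x by apply: EG; split => /=; rewrite ?in_itv//= m1 m2.
  have : nbhs x (G m) by exact: open_nbhs_nbhs.
  apply: filterS => y Gy; apply: le_trans (gm_le m y).
  by rewrite /gm indicE mem_set// mule1.
apply: (le_trans key).
have -> : (\int[mu]_(x in `[a, b]) g x =
    \sum_(0 <= m <oo) \int[mu]_(x in `[a, b]) gm m x)%E.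
  apply: integral_nneseries => //.
  by move=> m; exact: measurable_funTS (mgm m).
apply: (@le_trans _ _ (\sum_(0 <= m <oo)
   ((\int[mu]_(x in E m) (h x + e)%:E) + (e / (2 ^ m.+1)%:R)%:E))%E).
  apply: lee_nneseries => [m _ _|m _].
    by apply: integral_ge0 => x _; exact: gm0.
  rewrite ge0_integralZl_EFin//; last 2 first.
    apply/measurable_EFinP; exact: (@measurable_indic _ _ _ _ _ (mG m)).
    by rewrite mulr_ge0// ltW.
  rewrite integral_indic//; last exact: mG.
  have [oG EG Gt] := GP m.
  apply: (@le_trans _ _ ((m.+1%:R * e)%:E * (mu (E m) + (tau m)%:E))%E).
    rewrite lee_pmul2l ?lte_fin ?(mulr_gt0 _ e_gt0)//.
    apply: (@le_trans _ _ (mu (G m))).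
      apply: le_measure; rewrite ?inE; last exact: subIsetl.
        by apply: measurableI => //; exact: mG.
      exact: mG.
    rewrite -[X in (mu X <= _)%E](setDUK EG) measureU; last 3 first.
      exact: mE.
      by apply: measurableD; [exact: mG|exact: mE].
      by apply/seteqP; split=> x // [? []].
    by rewrite leeD2l// ltW.
  rewrite ge0_muleDr// ?lee_fin ?(ltW (tau0 m))//; apply: leeD; last first.
    by rewrite -EFinM lee_fin /tau mulrC divfK// mulf_neq0// gt_eqF.
  rewrite -integral_cst; last exact: mE.
  apply: ge0_le_integral => //; first exact: mE.
    by move=> x _; rewrite lee_fin mulr_ge0// ltW.
    apply/measurable_EFinP; apply: measurable_funD => //.
    exact: (measurable_funTS mh).
  move=> x [_ /=/andP[mx _]].
  by rewrite lee_fin -addn1 natrD mulrDl mul1r lerD2r.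
apply: (@le_trans _ _ ((\sum_(0 <= m <oo)
   (\int[mu]_(x in E m) (h x + e)%:E)) + e%:E)%E).
  apply: epsilon_trick; last exact: ltW.
  move=> m; apply: integral_ge0 => x _.
  by rewrite lee_fin addr_ge0// ltW.
have he0 x : 0 <= h x + e by rewrite addr_ge0// ltW.
have mhe D : measurable_fun D (fun x => (h x + e)%:E).
  apply/measurable_EFinP; apply: measurable_funD => //.
  exact: (measurable_funTS mh).
rewrite -ge0_integral_bigcup//; last 3 first.
  exact: mhe.
  by move=> x _; rewrite lee_fin.
  apply/trivIsetP => i j _ _ ij; rewrite -subset0 => x [[_ /= /andP[i1 i2]] [_ /= /andP[j1 j2]]].
  have := le_lt_trans i1 j2; have := le_lt_trans j1 i2.
  rewrite !ltr_pM2r// !ltr_nat !ltnS => ji ij'.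
  by move: ij; rewrite eqn_leq ji ij'.
apply: (@le_trans _ _ ((\int[mu]_(x in `[a, b]) (h x + e)%:E) + e%:E)%E).
  rewrite leeD2r//; apply: ge0_subset_integral => //.
    exact: bigcupT_measurable.
    exact: mhe.
    by move=> x _; rewrite lee_fin.
  by move=> x [m _ []].
under eq_integral do rewrite EFinD.
rewrite ge0_integralD//; last 3 first.
  by move=> x _; rewrite lee_fin.
  by apply/measurable_EFinP; exact: (measurable_funTS mh).
  by move=> x _; rewrite lee_fin ltW.
rewrite integral_cst//= lebesgue_measure_itv/= -addeA leeD2l//.
apply: (@le_trans _ _ ((e * (b - a))%:E + e%:E)%E).
  rewrite leeD2r//; case: ifPn => _; rewrite -?EFinD -?EFinM ?lee_fin//.
  by rewrite mulr0 mulr_ge0 ?subr_ge0// ltW.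
by rewrite -EFinD lee_fin /e -{2}[e0 / _]mulr1 -mulrDr divfK// gt_eqF.
Qed.

(** The previous bound sees only the positive part of the derivative. For [f] plus [n] times the
    identity this part is [max (f' + n) 0 = max f' (- n) + n]; the two terms [n * (b - a)] cancel,
    and dominated convergence lets [n] grow. *)
Lemma ftc_le f (f' : R -> R) a b : a <= b ->
  (forall x : R, is_derive x 1 f (f' x)) ->
  mu.-integrable `[a, b] (EFin \o f') ->
  ((f b - f a)%:E <= \int[mu]_(x in `[a, b]) (f' x)%:E)%E.
Proof.
move=> ab dfx intf.
have df x : derivable f x 1 by case: (dfx x).
have mD : measurable_fun setT f'.
  have E : f' = 'D_1 f by apply/funext => x; rewrite derive_val.
  by rewrite E; exact: derivable_measurable_D1.
pose h (n : nat) x : R := Num.max (f' x) (- n%:R).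
have mh n : measurable_fun setT (h n).
  by apply: measurable_maxr => //; exact: measurable_cst.
have h_abs n x : `|h n x| <= `|f' x|.
  rewrite /h; have [H|//] := leP (f' x) (- n%:R).
  have n0 : 0 <= n%:R :> R by [].
  have D0 : f' x <= 0 by apply: le_trans H _; rewrite oppr_le0.
  by rewrite normrN ger0_norm// ler0_norm// lerNr.
have inth n : mu.-integrable `[a, b] (EFin \o h n).
  apply: le_integrable intf => //.
    by apply/measurable_EFinP; exact: (measurable_funTS (mh n)).
  by move=> x _; rewrite /= lee_fin.
have step n : ((f b - f a)%:E <= \int[mu]_(x in `[a, b]) (h n x)%:E)%E.
  pose v x : R := f x + n%:R * x.
  have dvx (x : R) : is_derive x 1 v (f' x + n%:R).
    rewrite /v; apply: is_derive_eq.
    by rewrite /GRing.scale/=; ring.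
  have dv x : derivable v x 1 by case: (dvx x).
  have := increment_le_integral_pos ab dv.
  have E x : (Num.max ('D_1 v x) 0)%:E = ((h n x)%:E + n%:R%:E)%E.
    rewrite derive_val -EFinD /h; congr (_%:E).
    case: leP => H1; case: leP => H2; lra.
  under eq_integral do rewrite E.
  rewrite integralD//; last 2 first.
    exact: inth.
    apply/integrableP; split => //.
    rewrite integral_cst//= lebesgue_measure_itv/=.
    by case: ifPn => _; rewrite -?EFinD ?mule0 -?EFinM ltry.
  rewrite integral_cst//= lebesgue_measure_itv/= lte_fin.
  have fin : (\int[mu]_(x in `[a, b]) (h n x)%:E)%E \is a fin_num.
    by apply: integrable_fin_num => //; exact: inth.
  move: ab; rewrite le_eqVlt => /orP[/eqP ba|ab].
    by rewrite -ba ltxx !subrr set_itv1 integral_set1.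
  rewrite ab -(fineK fin) -[(b%:E + _)%E]EFinB -EFinM -EFinD !lee_fin /v.
  lra.
have cvg : (\int[mu]_(x in `[a, b]) (h n x)%:E)%E @[n --> \oo] -->
    (\int[mu]_(x in `[a, b]) (f' x)%:E)%E.
  have [|||||_ _ //] := @dominated_convergence _ _ _ mu `[a, b]%classic
    (measurable_itv _) (fun n => EFin \o h n) (EFin \o f')
    (fun x => (`|f' x|)%:E).
  - by move=> n; apply/measurable_EFinP; exact: (measurable_funTS (mh n)).
  - by apply/measurable_EFinP; exact: (measurable_funTS mD).
  - apply: aeW => x _; apply: cvg_near_cst; near=> n; rewrite /= /h.
    congr EFin; apply: max_l; rewrite lerNl.
    by near: n; exact: nbhs_infty_ger.
  - exact: (integrable_norm intf).
  - by apply: aeW => x n _; rewrite /= lee_fin.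
have <- := cvg_lim (@ereal_hausdorff R) cvg.
by apply: lime_ge; [apply/cvg_ex; eexists; exact: cvg|exact: nearW].
Unshelve. all: by end_near. Qed.

Lemma ftc f (f' : R -> R) a b : a <= b ->
  (forall x : R, is_derive x 1 f (f' x)) ->
  mu.-integrable `[a, b] (EFin \o f') ->
  (\int[mu]_(x in `[a, b]) (f' x)%:E)%E = (f b - f a)%:E.
Proof.
move=> ab df intf; apply/eqP; rewrite eq_le (ftc_le ab df)// andbT.
have dN (x : R) : is_derive x 1 (\- f) ((\- f') x) by exact: is_deriveN.
have int2 : mu.-integrable `[a, b] (EFin \o (\- f')).
  by apply: integrableN intf.
have := ftc_le ab dN int2.
under eq_integral do rewrite /= EFinN.
rewrite integralN; last first.
  apply: fin_num_adde_defr; apply: integrable_fin_num => //.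
  exact: integrable_funepos.
by rewrite leeNr -EFinN opprB opprK addrC.
Qed.

End FTC2.

(** * Measurability, translations and integration by parts on column vectors *)

Section MeasurableCV.
Variable R : realType.

(** A preimage is a countable union of fibres of [z], whatever [h] is. This serves for functions of
    a discretised argument. *)
Lemma measurable_fun_countable_comp d (T : measurableType d) (C : countType)
    (z : T -> C) (h : C -> R) :
  (forall c, measurable (z @^-1` [set c])) -> measurable_fun setT (h \o z).
Proof.
move=> mz _ B mB; rewrite setTI.
pose F k := if unpickle k is Some c
  then if pselect (B (h c)) then z @^-1` [set c] else set0 else set0.
rewrite (_ : _ @^-1` B = \bigcup_k F k).
  apply: bigcupT_measurable => k; rewrite /F.
  by case: unpickle => // c; case: pselect => Bc //=; exact: mz.
apply/seteqP; split=> [x Bx|x [k _]].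
  by exists (pickle (z x)) => //; rewrite /F pickleK; case: pselect.
by rewrite /F; case: unpickle => // c; case: pselect => // Bc /= zc; rewrite zc.
Qed.

Definition mx_floor m n (N : nat) (M : 'M[R]_(m, n)) : 'M[int]_(m, n) :=
  map_mx (fun x => Num.floor (x * N.+1%:R)) M.

Definition mx_unfloor m n (N : nat) (Z : 'M[int]_(m, n)) : 'M[R]_(m, n) :=
  map_mx (fun z => z%:~R / N.+1%:R) Z.

Lemma measurable_mx_floor m n N (Z : 'M[int]_(m, n)) :
  measurable (@mx_floor m n N @^-1` [set Z]).
Proof.
rewrite (_ : _ @^-1` _ = \bigcap_(ij : 'I_m * 'I_n)
  [set M : 'M[R]_(m, n) | Num.floor (M ij.1 ij.2 * N.+1%:R) == Z ij.1 ij.2]).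
  apply: fin_bigcap_measurable => // -[i j] _ /=.
  rewrite (_ : [set M | _] = (fun M : 'M[R]_(m, n) => M i j) @^-1`
     `[(Z i j)%:~R / N.+1%:R, (Z i j + 1)%:~R / N.+1%:R[%classic).
    rewrite -[X in measurable X]setTI.
    exact: (@measurable_mx_entry R m n i j).
  apply/seteqP; split=> M /=; rewrite in_itv/= ler_pdivrMr// ltr_pdivlMr//.
    by move=> /eqP <-; exact: floor_itv.
  by move=> H; apply/eqP/floor_def.
apply/seteqP; split=> M /=.
  by move=> <- [i j] _ /=; rewrite mxE.
by move=> H; apply/matrixP => i j; rewrite mxE; apply/eqP; exact: (H (i, j)).
Qed.

Lemma mx_floorK m n (M : 'M[R]_(m, n)) :
  mx_unfloor N (mx_floor N M) @[N --> \oo] --> M.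
Proof.
apply/cvg_ballP => e e0; near=> N; split=> // i j; rewrite !mxE /ball/=.
set a := M i j * N.+1%:R.
have N0 : 0 < N.+1%:R :> R by [].
have -> : M i j - (Num.floor a)%:~R / N.+1%:R = (a - (Num.floor a)%:~R) / N.+1%:R.
  by rewrite /a mulrBl mulfK ?gt_eqF.
rewrite normrM [X in _ * X]ger0_norm ?invr_ge0// ltr_pdivrMr//.
rewrite ger0_norm ?subr_ge0 ?floor_le_tmp//.
rewrite (@lt_trans _ _ 1)//.
  by have /andP[_] := floor_itv a; rewrite intrD ltrBlDl.
rewrite -ltr_pdivrMl// mulr1.
apply: lt_trans (_ : N%:R < _); last by rewrite ltr_nat.
by near: N; exact: nbhs_infty_gtr.
Unshelve. all: by end_near. Qed.

Lemma mx_floorK2 m n (M : 'M[R]_(m, n) * 'M[R]_(m, n)) :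
  (mx_unfloor N (mx_floor N M.1), mx_unfloor N (mx_floor N M.2)) @[N --> \oo]
  --> M.
Proof.
case: M => M1 M2 A [[B C] /= [nB nC] BC].
have HB : \forall N \near \oo, B (mx_unfloor N (mx_floor N M1)) := mx_floorK nB.
have HC : \forall N \near \oo, C (mx_unfloor N (mx_floor N M2)) := mx_floorK nC.
by apply: filterS2 HB HC => N HB HC; apply: BC; split.
Qed.

(** The sigma-algebra on matrices is generated by the entries and not by the open sets. Rounding the
    entries down to the grid of step [1 / N.+1] makes [f] factor through a countable type, and
    continuity gives pointwise convergence as [N] grows. *)
Lemma continuous_measurable_mx m n (f : 'M[R]_(m, n) -> R) :
  continuous f -> measurable_fun setT f.
Proof.
move=> cf; apply: (@measurable_fun_cvg _ _ R setT
  (fun N => (f \o mx_unfloor N) \o mx_floor N)).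
  move=> N; apply: measurable_fun_countable_comp => Z.
  exact: measurable_mx_floor.
move=> M _; apply: continuous_cvg; first exact: cf.
exact: mx_floorK.
Qed.

Lemma continuous_measurable_mx2 m n (f : 'M[R]_(m, n) * 'M[R]_(m, n) -> R) :
  continuous f -> measurable_fun setT f.
Proof.
move=> cf; apply: (@measurable_fun_cvg _ _ R setT
  (fun N => (fun Z : 'M[int]_(m, n) * 'M[int]_(m, n) =>
     f (mx_unfloor N Z.1, mx_unfloor N Z.2)) \o
   (fun M => (mx_floor N M.1, mx_floor N M.2)))).
  move=> N; apply: measurable_fun_countable_comp => -[Z1 Z2].
  rewrite (_ : _ @^-1` _ = (@mx_floor m n N @^-1` [set Z1]) `*`
     (@mx_floor m n N @^-1` [set Z2])).
    by apply: measurableX; exact: measurable_mx_floor.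
  by apply/seteqP; split=> -[M1 M2] /= [<- <-].
move=> M _; apply: continuous_cvg; first exact: cf.
exact: mx_floorK2.
Qed.

End MeasurableCV.

Section Translation.
Variable R : realType.
Notation lam := (@lebesgue_measure R).

Lemma ge0_integral_lebesgue_shift (t : R) (f : R -> \bar R) :
  measurable_fun setT f -> (forall x, 0 <= f x)%E ->
  (\int[lam]_x f (x + t)%R = \int[lam]_x f x)%E.
Proof.
move=> mf f0.
have mt : measurable_fun setT
    ((fun x => x + t) : measurableTypeR R -> measurableTypeR R).
  exact: measurable_funD.
pose m' : {measure set (measurableTypeR R) -> \bar R} :=
  measure_function_pushforward__canonical__measure_function_Measure lam mt.
have mE (A : set R) : measurable A -> lam A = m' A.
  apply: lebesgue_measure_unique => X /ocitvP[->|[[a b] /= ab ->]].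
    by rewrite !measure0.
  rewrite /= /pushforward.
  rewrite (_ : _ @^-1` _ = `]a - t, b - t]%classic); last first.
    by apply/seteqP; split=> x /=; rewrite !in_itv/= ltrBlDr lerBrDr.
  rewrite !lebesgue_measure_itv/= !lte_fin ltrD2r; case: ifPn => // _.
  by rewrite -!EFinD; congr EFin; ring.
transitivity (\int[m']_x f x)%E; last first.
  by apply/esym/eq_measure_integral => A mA _; exact: mE.
by rewrite /m' ge0_integral_pushforward.
Qed.

Lemma ge0_integral_leb_cons d (f : 'cV[R]_d.+1 -> \bar R) :
  measurable_fun setT f -> (forall x, 0 <= f x)%E ->
  (\int[lebesgue_cV R d.+1]_x f x =
   \int[lam \x lebesgue_cV R d]_z f (cV_cons z))%E.
Proof.
move=> mf f0.
rewrite [LHS]/= /leb_succ ge0_integral_pushforward//.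
exact: measurable_cV_cons.
Qed.

Lemma measurable_shift_cV d (v : 'cV[R]_d) :
  measurable_fun setT (fun x : 'cV[R]_d => x + v).
Proof.
apply/measurable_mxP => i j; under eq_fun do rewrite mxE.
by apply: measurable_funD => //; exact: measurable_mx_entry.
Qed.

Lemma measurable_shift_line d (v : 'cV[R]_d) :
  measurable_fun setT (fun z : 'cV[R]_d * measurableTypeR R => z.1 + z.2 *: v).
Proof.
apply/measurable_mxP => i j; under eq_fun do rewrite !mxE.
apply: measurable_funD.
  exact: (measurableT_comp (measurable_mx_entry i j) measurable_fst).
by apply: measurable_funM => //; exact: measurable_snd.
Qed.

Lemma cV_cons_shift0 d (t : R) (z : R * 'cV[R]_d) :
  cV_cons z + t *: evec R ord0 = cV_cons (z.1 + t, z.2).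
Proof.
apply/matrixP => i j; rewrite !mxE ord1 eqxx andbT.
rewrite /cV_cons; case: (split_ordP (i : 'I_(1 + d))) => k ->.
  have -> : (lshift d k == ord0 :> 'I_(1 + d)) = true by rewrite (ord1 k).
  by rewrite !mxE mulr1.
by rewrite (_ : rshift 1 k == ord0 = false)// mulr0 addr0.
Qed.

Lemma cV_cons_shiftS d (t : R) (z : R * 'cV[R]_d) (i : 'I_d) :
  cV_cons z + t *: evec R (lift ord0 i) = cV_cons (z.1, z.2 + t *: evec R i).
Proof.
apply/matrixP => l j; rewrite !mxE ord1 eqxx andbT.
rewrite /cV_cons; case: (split_ordP (l : 'I_(1 + d))) => k ->.
  have -> : (lshift d k == lift ord0 i :> 'I_(1 + d)) = false by rewrite (ord1 k).
  by rewrite !mxE mulr0 addr0.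
by rewrite !mxE eqxx andbT.
Qed.

(** Induction on the dimension: by Tonelli, the factor that is shifted (first coordinate or tail)
    can be integrated innermost. *)
Lemma ge0_integral_cV_shift d (i : 'I_d) (t : R) (f : 'cV[R]_d -> \bar R) :
  measurable_fun setT f -> (forall x, 0 <= f x)%E ->
  (\int[lebesgue_cV R d]_x f (x + t *: evec R i)%R =
   \int[lebesgue_cV R d]_x f x)%E.
Proof.
elim: d i f => [[]//|d IH] i f mf f0.
have mfc : measurable_fun setT
    (fun z : measurableTypeR R * 'cV[R]_d => f (cV_cons z)).
  by apply: measurableT_comp => //; exact: measurable_cV_cons.
have mft : measurable_fun setT (fun x : 'cV[R]_d.+1 => f (x + t *: evec R i)).
  by apply: measurableT_comp => //; exact: measurable_shift_cV.
have mftc : measurable_fun setT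
    (fun z : measurableTypeR R * 'cV[R]_d => f (cV_cons z + t *: evec R i)).
  by apply: (measurableT_comp mft); exact: measurable_cV_cons.
rewrite !ge0_integral_leb_cons//.
case: (unliftP ord0 i) mft mftc => [j|] -> mft mftc.
  apply: etrans (fubini_tonelli1 _ mftc (fun z => f0 _)) _.
  apply: etrans _ (esym (fubini_tonelli1 _ mfc (fun z => f0 _))).
  apply: eq_integral => s _; rewrite /fubini_F.
  under eq_integral do rewrite cV_cons_shiftS/=.
  apply: (IH j (fun v => f (cV_cons (s, v)))) => //.
  exact: (measurable_fun_pair2 s mfc).
apply: etrans (fubini_tonelli2 _ mftc (fun z => f0 _)) _.
apply: etrans _ (esym (fubini_tonelli2 _ mfc (fun z => f0 _))).
apply: eq_integral => v _; rewrite /fubini_G.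
under eq_integral do rewrite cV_cons_shift0/=.
apply: (ge0_integral_lebesgue_shift t (f := fun s => f (cV_cons (s, v)))) => //.
exact: (measurable_fun_pair1 v mfc).
Qed.

Lemma integral_cV_shift d (i : 'I_d) (t : R) (f : 'cV[R]_d -> \bar R) :
  measurable_fun setT f ->
  (\int[lebesgue_cV R d]_x f (x + t *: evec R i)%R =
   \int[lebesgue_cV R d]_x f x)%E.
Proof.
move=> mf; rewrite integralE [RHS]integralE; congr (_ - _)%E.
  rewrite -(ge0_integral_cV_shift i t (f := f^\+%E))//; last first.
    exact: measurable_funepos.
  by apply: eq_integral => x _; rewrite !funeposE.
rewrite -(ge0_integral_cV_shift i t (f := f^\-%E))//; last first.
  exact: measurable_funeneg.
by apply: eq_integral => x _; rewrite !funenegE.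
Qed.

End Translation.

(** * Integrals of directional derivatives over the whole space *)

Section PartialIntegration.
Variables (R : realType) (d : nat) (i : 'I_d).
Notation lam := (@lebesgue_measure R).
Notation leb := (lebesgue_cV R d).
Notation e := (evec R i).

Lemma measurable_derive_cV (W : 'cV[R]_d -> R) (v : 'cV[R]_d) :
  measurable_fun setT W -> (forall x, derivable W x v) ->
  measurable_fun setT ('D_v W).
Proof.
move=> mW dW.
apply: (@measurable_fun_cvg _ _ R setT
  (fun n (x : 'cV[R]_d) => n.+1%:R * (W (x + n.+1%:R^-1 *: v) - W x))).
  move=> m; apply: measurable_funM => //; apply: measurable_funB => //.
  by apply: (measurableT_comp mW); exact: measurable_shift_cV.
move=> x _; exact: cvg_diff_quotient (dW x).
Qed.

Lemma is_derive_line (V : normedModType R) (W : V -> R) (x v : V) (s : R) :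
  derivable W (x + s *: v) v ->
  is_derive s 1 (fun t => W (x + t *: v)) ('D_v W (x + s *: v)).
Proof.
have E (h : R) : h^-1 *: (((fun t => W (x + t *: v)) \o shift s) (h *: 1) -
     W (x + s *: v)) =
   h^-1 *: ((W \o shift (x + s *: v)) (h *: v) - W (x + s *: v)).
  by rewrite /= [h *: 1]mulr1 scalerDl addrCA addrA.
move=> dW; apply: DeriveDef.
  by rewrite /derivable; under eq_fun do rewrite E.
by rewrite /derive; under eq_fun do rewrite E.
Qed.

Variable W : 'cV[R]_d -> R.
Hypotheses (mW : measurable_fun setT W) (dW : forall x, derivable W x e).
Hypothesis intD : leb.-integrable setT (EFin \o 'D_e W).

Let mD : measurable_fun setT ('D_e W). Proof. exact: measurable_derive_cV. Qed.

(** Integrated over [z.2], [Phi t] gives the increment of [W] along a segment; integrated over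
    [z.1], it gives the integral of ['D_e W] once for each point of [[0, t]]. Fubini compares the
    two. *)
Let Phi (t : R) (z : 'cV[R]_d * measurableTypeR R) : R :=
  \1_(`[0, t]%classic : set R) z.2 * 'D_e W (z.1 + z.2 *: e).

Let mPhi t : measurable_fun setT (Phi t).
Proof.
apply: measurable_funM.
  by apply: (measurableT_comp _ measurable_snd); exact: measurable_indic.
exact: (measurableT_comp mD (measurable_shift_line e)).
Qed.

Let mPhi_abs t : measurable_fun setT (fun z => `|(Phi t z)%:E|%E).
Proof.
apply/measurable_EFinP; apply: measurableT_comp => //; exact: mPhi.
Qed.

(** With [x] integrated first, translation invariance makes the inner integral the same for every
    [s] in [[0, t]]. *)
Let Phi_abs t : 0 <= t -> (\int[leb \x lam]_z `|(Phi t z)%:E| =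
   t%:E * \int[leb]_x `|('D_e W x)%:E|)%E.
Proof.
move=> t0; have mabs := mPhi_abs t.
rewrite (fubini_tonelli2 _ mabs)//.
rewrite /fubini_G.
have E s : (\int[leb]_x `|(Phi t (x, s))%:E| =
   (\1_(`[0, t]%classic : set R) s)%:E * \int[leb]_x `|('D_e W x)%:E|)%E.
  rewrite -(ge0_integral_cV_shift i s (f := fun x => `|('D_e W x)%:E|%E))//; last first.
    by apply: measurableT_comp => //; exact/measurable_EFinP.
  rewrite -ge0_integralZl//; last first.
    apply: measurableT_comp => //; apply/measurable_EFinP.
    by apply: (measurableT_comp mD); exact: measurable_shift_cV.
  apply: eq_integral => x _; rewrite /Phi/= normrM EFinM; congr (_%:E * _)%E.
  by rewrite ger0_norm.
under eq_integral do rewrite E.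
rewrite ge0_integralZr//; last 2 first.
  by apply/measurable_EFinP; exact: measurable_indic.
  by apply: integral_ge0.
congr (_ * _)%E.
rewrite integral_indic//= setIT lebesgue_measure_itv/= lte_fin sube0.
by move: t0; rewrite le_eqVlt => /orP[/eqP <-|->]; rewrite ?ltxx.
Qed.

Let intPhi t : 0 <= t -> (leb \x lam)%E.-integrable setT (EFin \o Phi t).
Proof.
move=> t0; apply/integrableP; split; first exact/measurable_EFinP.
rewrite Phi_abs// lte_mul_pinfty//.
by move/integrableP : intD => [].
Qed.

(** Fubini gives integrability of the derivative on almost every line only; on such a line [ftc]
    applies. *)
Let line_ftc t : 0 <= t -> {ae leb, forall x,
  (\int[lam]_s (Phi t (x, s))%:E = (W (x + t *: e) - W x)%:E)%E}.
Proof.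
move=> t0; have := ae_integrable1 (intPhi t0).
apply: filterS => x ix.
have E : (fun s => (Phi t (x, s))%:E) =
   (fun s => ('D_e W (x + s *: e))%:E) \_ (`[0, t]%classic : set R).
  apply/funext => s; rewrite patchE /Phi/= indicE.
  by case: ifPn => _; rewrite ?mul1r ?mul0r.
rewrite E -integral_mkcond.
have iE : lam.-integrable `[0, t] (EFin \o (fun s => 'D_e W (x + s *: e))).
  by apply/integrable_mkcond => //; rewrite /comp -E.
have := ftc t0 (fun s => is_derive_line (@dW (x + s *: e))) iE.
by rewrite scale0r addr0.
Qed.

(** [Phi 1] is integrated in both orders: one yields the integral of [W (x + e) - W x], zero by
    translation invariance, the other the integral of ['D_e W]. Integrability of [W] thus plays the
    part of a decay condition at infinity. *)
Lemma integral_derive_eq0 : leb.-integrable setT (EFin \o W) ->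
  (\int[leb]_x ('D_e W x)%:E = 0)%E.
Proof.
move=> intW.
have E : (\int[leb]_x \int[lam]_s (Phi 1 (x, s))%:E =
          \int[lam]_s \int[leb]_x (Phi 1 (x, s))%:E)%E.
  exact: (Fubini (intPhi ler01)).
have L : (\int[leb]_x \int[lam]_s (Phi 1 (x, s))%:E = 0)%E.
  transitivity (\int[leb]_x (W (x + 1 *: e) - W x)%:E)%E.
    apply: ae_eq_integral => //.
    - exact: (measurable_fubini_F (intPhi ler01)).
    - apply/measurable_EFinP; apply: measurable_funB => //.
      by apply: (measurableT_comp mW); exact: measurable_shift_cV.
    - by apply: filterS (line_ftc ler01) => x H _.
  have mS : measurable_fun setT (fun x : 'cV[R]_d => (W (x + 1 *: e))%:E).
    apply/measurable_EFinP.
    by apply: (measurableT_comp mW); exact: measurable_shift_cV.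
  have intS : leb.-integrable setT (fun x : 'cV[R]_d => (W (x + 1 *: e))%:E).
    apply/integrableP; split => //.
    rewrite (ge0_integral_cV_shift i 1 (f := fun x => `|(W x)%:E|%E))//.
      by move/integrableP : intW => [].
    by apply: measurableT_comp => //; exact/measurable_EFinP.
  under eq_integral do rewrite EFinB.
  rewrite integralB//.
  rewrite (integral_cV_shift i 1 (f := fun x => (W x)%:E)); last exact/measurable_EFinP.
  by rewrite subee//; apply: integrable_fin_num.
rewrite -L E.
have E2 s : (\int[leb]_x (Phi 1 (x, s))%:E =
   (\1_(`[0, 1]%classic : set R) s)%:E * \int[leb]_x ('D_e W x)%:E)%E.
  rewrite -(integral_cV_shift i s (f := fun x => ('D_e W x)%:E))//; last first.
    exact/measurable_EFinP.
  rewrite -integralZl//.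
  apply/integrableP; split.
    apply/measurable_EFinP.
    by apply: (measurableT_comp mD); exact: measurable_shift_cV.
  rewrite (ge0_integral_cV_shift i s (f := fun x => `|('D_e W x)%:E|%E))//.
    by move/integrableP : intD => [].
  by apply: measurableT_comp => //; exact/measurable_EFinP.
under [RHS]eq_integral do rewrite E2.
have fin : (\int[leb]_x ('D_e W x)%:E)%E \is a fin_num.
  exact: integrable_fin_num.
rewrite -(fineK fin).
have -> : (\int[lam]_s ((\1_(`[0%R, 1%R]%classic : set R) s)%:E *
   (fine (\int[leb]_x ('D_e W x)%:E))%:E) =
   (\int[lam]_s (\1_(`[0%R, 1%R]%classic : set R) s)%:E) *
   (fine (\int[leb]_x ('D_e W x)%:E))%:E)%E.
  rewrite integralZr//; apply/integrableP; split.
    by apply/measurable_EFinP; exact: measurable_indic.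
  under eq_integral do rewrite gee0_abs ?lee_fin//.
  by rewrite integral_indic//= setIT lebesgue_measure_itv/= lte_fin ltr01 ltry.
by rewrite integral_indic//= setIT lebesgue_measure_itv/= lte_fin ltr01 oppr0 adde0 mul1e.
Qed.

(** By [Phi_abs] the derivative has integral 0 in absolute value along almost every line, so the
    increment computed by [line_ftc] is 0 there. *)
Lemma derive_ae0_shift t : 0 <= t -> (\int[leb]_x `|('D_e W x)%:E| = 0)%E ->
  {ae leb, forall x, W (x + t *: e) = W x}.
Proof.
move=> t0 D0; have H0 := Phi_abs t0; rewrite D0 mule0 in H0.
have mabs := mPhi_abs t.
rewrite fubini_tonelli1// in H0.
have : {ae leb, forall x, (\int[lam]_s `|(Phi t (x, s))%:E| = 0)%E}.
  have : ae_eq leb setT (fun x => \int[lam]_s `|(Phi t (x, s))%:E|)%E (cst 0%E).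
    apply/ae_eq_integral_abs => //.
      exact: (measurable_fun_fubini_tonelli_F (m2 := lam) _ mabs).
    rewrite -[RHS]H0; apply: eq_integral => x _.
    by rewrite gee0_abs//; exact: integral_ge0.
  by apply: filterS => x /(_ I).
have L := line_ftc t0.
apply: filterS2 L => x Hx H.
have : (`|W (x + t *: e) - W x|%:E <= 0)%E.
  rewrite -[X in (X <= _)%E]/(`|(W (x + t *: e) - W x)%:E|)%E -Hx -H.
  apply: le_abse_integral => //.
  by apply/measurable_EFinP; apply: (measurableT_comp (mPhi t)); exact: measurable_pair1.
by rewrite lee_fin normr_le0 subr_eq0 => /eqP.
Qed.

End PartialIntegration.

(** * Smooth truncations *)

Section SoftTruncation.
Variable R : realType.
Implicit Types e s : R.

(* A C^1 approximation of the identity on [0, oo) that vanishes on [0, e]. *)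
Definition softtr e s : R := if e < s then (s - e) ^+ 2 / s else 0.
Definition dsofttr e s : R := if e < s then 1 - (e / s) ^+ 2 else 0.

Lemma softtr_bounds e s : 0 < e -> 0 <= s -> 0 <= softtr e s <= s.
Proof.
move=> e0 s0; rewrite /softtr; case: ifPn => [es|_]; last by rewrite lexx.
have s_gt0 : 0 < s by rewrite (lt_trans e0).
rewrite divr_ge0 ?sqr_ge0//= ler_pdivrMr//; nra.
Qed.

Lemma dsofttr_bounds e s : 0 < e -> 0 <= dsofttr e s <= 1.
Proof.
move=> e0; rewrite /dsofttr; case: ifPn => [es|_]; last by rewrite lexx ler01.
have s_gt0 : 0 < s by rewrite (lt_trans e0).
have q0 : 0 <= e / s by rewrite divr_ge0 ?ltW.
have q1 : e / s <= 1 by rewrite ler_pdivrMr// mul1r ltW.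
by apply/andP; split; nra.
Qed.

Lemma dsofttr0 e s : s <= e -> dsofttr e s = 0.
Proof. by move=> se; rewrite /dsofttr ltNge se. Qed.

Lemma dsofttr_le e e' s : 0 < e -> e <= e' -> dsofttr e' s <= dsofttr e s.
Proof.
move=> e0 ee'; rewrite {1}/dsofttr; case: ifPn => [es|_]; last first.
  by have /andP[] := dsofttr_bounds s e0.
have s0 : 0 < s by rewrite (lt_trans _ es)// (lt_le_trans e0).
rewrite /dsofttr (le_lt_trans ee' es) lerD2l lerN2.
have q0 : 0 <= e / s by rewrite divr_ge0 ?ltW.
have q1 : e / s <= e' / s by rewrite ler_wpM2r// invr_ge0 ltW.
by nra.
Qed.

Lemma cvg_dsofttr s : dsofttr n.+1%:R^-1 s @[n --> \oo] --> ((0 < s)%R%:R : R).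
Proof.
have h0 : n.+1%:R^-1 @[n --> \oo] --> (0 : R) by exact: cvg_harmonic.
have [s0|s0] := ltP 0 s; last first.
  apply: cvg_near_cst; apply: nearW => n; apply: dsofttr0.
  by rewrite (le_trans s0).
rewrite /=.
have : 1 - (n.+1%:R^-1 / s) ^+ 2 @[n --> \oo] --> 1 - (0 / s) ^+ 2.
  apply: cvgB; first exact: cvg_cst.
  rewrite expr2; under eq_fun do rewrite expr2.
  by apply: cvgM; apply: cvgM => //; exact: cvg_cst.
rewrite mul0r expr0n subr0; apply: cvg_trans; apply: near_eq_cvg.
have : \forall n \near \oo, n.+1%:R^-1 < s.
  by move/cvgrPdist_lt : h0 => /(_ _ s0); apply: filterS => n; rewrite sub0r normrN ger0_norm.
by apply: filterS => n ns; rewrite /dsofttr ns.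
Qed.

Lemma cvg_softtr s : 0 <= s -> softtr n.+1%:R^-1 s @[n --> \oo] --> s.
Proof.
move=> s_ge0.
have h0 : n.+1%:R^-1 @[n --> \oo] --> (0 : R) by exact: cvg_harmonic.
move: s_ge0; rewrite le_eqVlt => /orP[/eqP <-|s0].
  by apply: cvg_near_cst; apply: nearW => n; rewrite /softtr ltNge ltW.
have : (s - n.+1%:R^-1) ^+ 2 / s @[n --> \oo] --> (s - 0) ^+ 2 / s.
  rewrite expr2; under eq_fun do rewrite expr2.
  apply: cvgM; last exact: cvg_cst.
  by apply: cvgM; apply: cvgB => //; exact: cvg_cst.
rewrite subr0 expr2 mulfK ?gt_eqF//; apply: cvg_trans; apply: near_eq_cvg.
have : \forall n \near \oo, n.+1%:R^-1 < s.
  by move/cvgrPdist_lt : h0 => /(_ _ s0); apply: filterS => n; rewrite sub0r normrN ger0_norm.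
by apply: filterS => n ns; rewrite /softtr ns.
Qed.

Lemma is_derive_softtr e s : 0 < e -> is_derive s 1 (softtr e) (dsofttr e s).
Proof.
move=> e0.
have [se|es|es] := ltgtP s e.
- rewrite dsofttr0 ?ltW//.
  apply: (@near_eq_is_derive _ _ _ (cst 0)).
  have : \forall t \near s, t < e by exact: lt_nbhsl.
  by apply: filterS => t te; rewrite /softtr ltNge ltW.
- have s0 : 0 < s by rewrite (lt_trans e0).
  rewrite /dsofttr es.
  have s_neq0 : s != 0 by rewrite gt_eqF.
  pose g (t : R) : R := t - e.
  have dg : is_derive s 1 g 1 by apply: is_derive_eq; rewrite subr0.
  have dI := is_deriveV s_neq0 (is_derive_id s 1).
  have dM := is_deriveM (is_deriveM dg dg) dI.
  apply: (near_eq_is_derive (f := (g * g) * (fun t => t^-1))).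
    have : \forall t \near s, e < t by exact: lt_nbhsr.
    by apply: filterS => t te; rewrite /softtr te.
  apply: (is_derive_eq dM).
  rewrite /GRing.scale/= /g.
  rewrite -[(_ * _ : R -> R) s]/((s - e) * (s - e)).
  by field.
(* At the junction of the two formulas the slope function is explicit, [max (t - s) 0 / t]; it is
   continuous at [s] with value 0. *)
- rewrite -es dsofttr0//; apply/is_derive1_caratheodory.
  exists (fun t => Num.max (t - s) 0 / t); split.
  + move=> t; rewrite /softtr ltxx subr0; case: ifPn => st.
      by rewrite max_l ?subr_ge0 ?ltW// expr2 mulrAC.
    by rewrite max_r ?mul0r// subr_le0 leNgt.
  + rewrite /prop_for /continuous_at; apply: cvgM.
      rewrite subrr maxxx; apply/cvgrPdist_lt => r r0; apply/nbhs_ballP.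
      exists r => // t; rewrite /ball/= sub0r normrN => H.
      have [ts|ts] := leP (t - s) 0; first by rewrite normr0.
      by rewrite distrC.
    by apply: cvgV; [rewrite es gt_eqF|exact: cvg_id].
  + by rewrite subrr maxxx mul0r.
Qed.

Lemma measurable_softtr e : 0 < e -> measurable_fun setT (softtr e).
Proof.
move=> e0; apply: continuous_measurable_fun; apply: derivable1_continuous => s.
by case: (is_derive_softtr s e0).
Qed.

Lemma measurable_dsofttr e : 0 < e -> measurable_fun setT (dsofttr e).
Proof.
move=> e0; have ds s := is_derive_softtr s e0.
rewrite (_ : dsofttr e = 'D_1 (softtr e) :> (R -> R)); last first.
  by apply/funext => s; rewrite derive_val.
by apply: derivable_measurable_D1 => s; case: (ds s).
Qed.

End SoftTruncation.

Section DirectionalChain.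
Variables (R : realType) (V : normedModType R).
Implicit Types (f G : V -> R) (x v : V).

Lemma is_derive_lineP G x v D :
  is_derive (0 : R) 1 (fun t => G (x + t *: v)) D <-> is_derive x v G D.
Proof.
have E (h : R) : h^-1 *: (((fun t => G (x + t *: v)) \o shift (0 : R)) (h *: 1) -
     G (x + 0 *: v)) = h^-1 *: ((G \o shift x) (h *: v) - G x).
  by rewrite /= [h *: 1]mulr1 scale0r !addr0 [x + h *: v]addrC.
split=> -[dG DG]; apply: DeriveDef.
- by move: dG; rewrite /derivable; under eq_fun do rewrite E.
- by rewrite -DG /derive; under [in RHS]eq_fun do rewrite E.
- by rewrite /derivable; under eq_fun do rewrite E.
- by rewrite -DG /derive; under eq_fun do rewrite E.
Qed.

(** [G] has a derivative in the single direction [v]; restriction to the line through [x] reduces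
    the claim to the one-variable chain rule. *)
Lemma is_derive_dir_comp (F : R -> R) G x v D D' :
  is_derive (G x) 1 F D -> is_derive x v G D' ->
  is_derive x v (F \o G) (D * D').
Proof.
move=> dF /is_derive_lineP dG; apply/is_derive_lineP.
apply: (@is_derive1_comp _ F (fun t => G (x + t *: v))) => //.
by rewrite scale0r addr0.
Qed.

(* Where [rho] vanishes it need not be derivable, but the truncation of [rho]
   is locally zero there. *)
Lemma is_derive_softtr_exp e (rho g : V -> R) (dg : V -> R) v : 0 < e ->
  continuous rho -> (forall x, 0 <= rho x) ->
  (forall x, 0 < rho x -> rho x = expR (g x)) ->
  (forall x, 0 < rho x -> is_derive x v g (dg x)) ->
  forall x, is_derive x v (softtr e \o rho) (dsofttr e (rho x) * (rho x * dg x)).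
Proof.
move=> e0 crho rho0 rhoE dgE x.
move: (rho0 x); rewrite le_eqVlt => /orP[/eqP r0|r0].
  rewrite -r0 mul0r mulr0.
  apply: (@near_eq_is_derive _ _ _ (cst 0)).
  have re : rho x < e by rewrite -r0.
  have : \forall y \near x, rho y < e by exact: (crho x _ (lt_nbhsl re)).
  by apply: filterS => t te; rewrite /= /softtr ltNge ltW.
have drho : is_derive x v rho (rho x * dg x).
  apply: (@near_eq_is_derive _ _ _ (expR \o g)).
    have : \forall y \near x, 0 < rho y by exact: (crho x _ (lt_nbhsr r0)).
    by apply: filterS => t te; rewrite /= -rhoE.
  by rewrite {1}rhoE//; apply: is_derive_dir_comp; exact: dgE.
by apply: is_derive_dir_comp drho; exact: is_derive_softtr.
Qed.

End DirectionalChain.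

(** * Growth and regularity of the Stein kernel *)

Section Norm1.
Variables (R : realType) (d : nat).
Implicit Types v x y z : 'cV[R]_d.

(** The l^1 norm is additive over coordinates, which suits increments taken one coordinate at a
    time; it differs from [enorm] by a factor of at most [d]. *)
Definition norm1 v : R := \sum_i `|v i 0|.

Lemma norm1_ge0 v : 0 <= norm1 v.
Proof. exact: sumr_ge0. Qed.

Lemma norm1D v x : norm1 (v + x) <= norm1 v + norm1 x.
Proof.
by rewrite /norm1 -big_split/=; apply: ler_sum => i _; rewrite mxE ler_normD.
Qed.

Lemma norm1N v : norm1 (- v) = norm1 v.
Proof. by apply: eq_bigr => i _; rewrite mxE normrN. Qed.

Lemma norm1_distC v x : norm1 (v - x) = norm1 (x - v).
Proof. by rewrite -norm1N opprB. Qed.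

Lemma norm1_entry v i : `|v i 0| <= norm1 v.
Proof. by rewrite /norm1 (bigD1 i)//= lerDl sumr_ge0. Qed.

Lemma enorm_entry v i : `|v i 0| <= enorm v.
Proof.
rewrite -sqrtr_sqr ler_sqrt ?sumr_ge0// => [|j _]; last exact: sqr_ge0.
by rewrite (bigD1 i)//= lerDl sumr_ge0// => j _; exact: sqr_ge0.
Qed.

Lemma enorm_le_norm1 v : enorm v <= norm1 v.
Proof.
rewrite -[leRHS]ger0_norm ?norm1_ge0// -sqrtr_sqr ler_wsqrtr//.
rewrite expr2 {1}/norm1 mulr_suml; apply: ler_sum => i _.
rewrite -real_normK ?num_real// expr2 ler_wpM2l//.
exact: norm1_entry.
Qed.

Lemma norm1_le_enorm v : norm1 v <= d%:R * enorm v.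
Proof.
rewrite (le_trans (ler_sum _ (fun i _ => enorm_entry v i)))//.
by rewrite sumr_const card_ord mulr_natl.
Qed.

Lemma near_norm1 x (e : R) : 0 < e -> \forall y \near x, norm1 (x - y) < e.
Proof.
move=> e0; apply/nbhs_ballP; exists (e / d.+1%:R); first by rewrite /= divr_gt0.
move=> y [_ xy].
apply: (@le_lt_trans _ _ (\sum_(i < d) e / d.+1%:R)).
  apply: ler_sum => i _; have := xy i 0; rewrite /ball/= !mxE.
  exact: ltW.
rewrite sumr_const card_ord -[_ *+ d]mulr_natl mulrCA gtr_pMr//.
by rewrite ltr_pdivrMr// mul1r ltr_nat.
Qed.

Lemma norm1_lipschitz_continuous (f : 'cV[R]_d -> R) (L : R) :
  (forall x y, `|f x - f y| <= L * norm1 (x - y)) -> continuous f.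
Proof.
move=> fL x; apply/(@cvgrPdist_le _ R _ (nbhs x) _) => e e0.
have L0 : 0 < `|L| + 1 by rewrite ltr_wpDl.
have := @near_norm1 x (e / (`|L| + 1)) (divr_gt0 e0 L0).
apply: filterS => y; rewrite ltr_pdivlMr// => /ltW H.
apply: le_trans (fL x y) _; apply: le_trans H.
by rewrite mulrC ler_wpM2l ?norm1_ge0// (le_trans (ler_norm _))// lerDl ler01.
Qed.

Lemma norm1_continuous : continuous norm1.
Proof.
apply: (@norm1_lipschitz_continuous _ 1) => x y; rewrite mul1r ler_norml.
have := norm1D (x - y) y; have := norm1D (y - x) x.
rewrite !subrK (norm1_distC y); lra.
Qed.

Lemma measurable_norm1 : measurable_fun setT norm1.
Proof. by apply: continuous_measurable_mx; exact: norm1_continuous. Qed.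

Lemma norm1_lipschitz_continuous2 (f : 'cV[R]_d * 'cV[R]_d -> R) (L : R) :
  (forall z z' : 'cV[R]_d * 'cV[R]_d, `|f z - f z'| <=
     L * (norm1 (z.1 - z'.1) + norm1 (z.2 - z'.2))) ->
  continuous f.
Proof.
move=> fL z; apply/(@cvgrPdist_le _ R _ (nbhs z) _) => e e0.
have : L * (norm1 (z.1 - y.1) + norm1 (z.2 - y.2)) @[y --> z] -->
    L * (norm1 (z.1 - z.1) + norm1 (z.2 - z.2)).
  apply: cvgMr; apply: cvgD; apply: continuous_cvg; try exact: norm1_continuous.
    by apply: cvgB; [exact: cvg_cst|exact: cvg_fst].
  by apply: cvgB; [exact: cvg_cst|exact: cvg_snd].
rewrite !subrr (_ : norm1 0 = 0) ?addr0 ?mulr0; last first.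
  by apply: big1 => i _; rewrite mxE normr0.
move=> /cvgrPdist_le/(_ _ e0); apply: filterS => y; rewrite sub0r normrN => H.
exact: (le_trans (fL z y) (le_trans (ler_norm _) H)).
Qed.

End Norm1.

Section CoordinatePath.
Variable R : realType.

Lemma segment_mvt (h : R -> R) (L t : R) :
  (forall s : R, `|s| <= `|t| -> derivable h s 1 /\ `|'D_1 h s| <= L) ->
  `|h t - h 0| <= L * `|t|.
Proof.
move=> H.
have der a b : a <= b -> (forall s, a <= s <= b -> `|s| <= `|t|) ->
    `|h b - h a| <= L * (b - a).
  move=> ab Hab.
  have dh (s : R) : s \in `]a, b[ -> is_derive s 1 h ('D_1 h s).
    rewrite in_itv/= => /andP[/ltW sa /ltW sb]; apply: derivableP.
    by apply: (H s _).1; apply: Hab; rewrite sa.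
  have ch : {within `[a, b], continuous h}.
    apply: derivable_within_continuous => s; rewrite in_itv/= => sab.
    by apply: (H s _).1; exact: Hab.
  have [c] := MVT_segment ab dh ch; rewrite in_itv/= => cab ->.
  rewrite normrM [`|b - a|]ger0_norm ?subr_ge0// ler_wpM2r ?subr_ge0//.
  by apply: (H c _).2; exact: Hab.
have [t0|t0] := leP 0 t.
  rewrite -{2}[t]subr0 [`|t - 0|]ger0_norm ?subr0// -[X in L * X]subr0; apply: der => // s /andP[s0 st].
  by rewrite !ger0_norm.
rewrite distrC [`|t|]ltr0_norm// -[- t]add0r; apply: der; first exact: ltW.
by move=> s /andP[ts s0]; rewrite !ler0_norm ?lerN2// ltW.
Qed.

(** The path from [x] to [y] changes one coordinate at a time, and the mean value theorem is applied
    on each axis-parallel segment. The derivative bounds are asked only on a box around [x], so that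
    the lemma also applies near [theta0] inside [Theta]. *)
Lemma coord_lipschitz d (f : 'cV[R]_d -> R) (x y : 'cV[R]_d) (L : 'I_d -> R) :
  (forall i (z : 'cV[R]_d), (forall j, `|z j 0 - x j 0| <= `|y j 0 - x j 0|) ->
     derivable f z (evec R i) /\ `|'D_(evec R i) f z| <= L i) ->
  `|f y - f x| <= \sum_i L i * `|y i 0 - x i 0|.
Proof.
move=> H.
pose z (k : nat) : 'cV[R]_d := \col_i (if (i < k)%N then y i 0 else x i 0).
have z0 : z 0%N = x by apply/colP => i; rewrite mxE.
have zd : z d = y by apply/colP => i; rewrite mxE ltn_ord.
rewrite -{1}zd -{1}z0 -(telescope_sumr (fun k => f (z k)) (leq0n d)) big_mkord.
apply: le_trans (ler_norm_sum _ _ _) _; apply: ler_sum => i _.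
have zS : z i.+1 = z i + (y i 0 - x i 0) *: evec R i.
  apply/colP => j; rewrite !mxE eqxx andbT ltnS leq_eqVlt.
  have [->|/negPf ij] := eqVneq j i; first by rewrite eqxx ltnn mulr1; ring.
  by rewrite (_ : (j == i :> nat) = false)//= mulr0 addr0.
have zi j : z i j 0 = if (j < i)%N then y j 0 else x j 0 by rewrite mxE.
rewrite zS -{2}[z i]addr0 -(scale0r (evec R i)).
apply: (@segment_mvt (fun s => f (z i + s *: evec R i))) => s Hs.
have [|df Df] := H i (z i + s *: evec R i).
  move=> j; rewrite mxE zi !mxE eqxx andbT.
  have [->|ij] := eqVneq j i; first by rewrite ltnn mulr1 addrAC subrr add0r.
  by rewrite mulr0 addr0; case: ifP => // _; rewrite subrr normr0.
have D := is_derive_line df.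
by split; [case: D|rewrite derive_val].
Qed.

End CoordinatePath.

Section KernelDerivatives.
Variables (R : realType) (d : nat).
Notation V := 'cV[R]_d.

Lemma derive_pair_l (F : V * V -> R) (x x' : V) i :
  (derivable F (x, x') (evec R i, 0) ->
   derivable (fun y => F (y, x')) x (evec R i)) /\
  'D_(evec R i, 0) F (x, x') = 'D_(evec R i) (fun y => F (y, x')) x.
Proof.
have E (h : R) : h^-1 *: ((F \o shift (x, x')) (h *: (evec R i, 0)) - F (x, x')) =
  h^-1 *: (((fun y => F (y, x')) \o shift x) (h *: evec R i) - F (x, x')).
  congr (_ *: (F _ - _)).
  change ((h *: evec R i + x, h *: 0 + x') = (h *: evec R i + x, x')).
  by rewrite scaler0 add0r.
split; first by rewrite /derivable; under eq_fun do rewrite E.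
by rewrite /derive; under eq_fun do rewrite E.
Qed.

Lemma derive_pair_r (F : V * V -> R) (x x' : V) i :
  (derivable F (x, x') (0, evec R i) ->
   derivable (fun y => F (x, y)) x' (evec R i)) /\
  'D_(0, evec R i) F (x, x') = 'D_(evec R i) (fun y => F (x, y)) x'.
Proof.
have E (h : R) : h^-1 *: ((F \o shift (x, x')) (h *: (0, evec R i)) - F (x, x')) =
  h^-1 *: (((fun y => F (x, y)) \o shift x') (h *: evec R i) - F (x, x')).
  congr (_ *: (F _ - _)).
  change ((h *: 0 + x, h *: evec R i + x') = (x, h *: evec R i + x')).
  by rewrite scaler0 add0r.
split; first by rewrite /derivable; under eq_fun do rewrite E.
by rewrite /derive; under eq_fun do rewrite E.
Qed.

Variable k : V -> V -> R.
Hypothesis kb : kernel_bounded4 k.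

Lemma kernel_pderiv_bound : exists2 B : R, 0 <= B & forall a, (size a <= 4)%N ->
  forall z, `|kernel_pderiv k a z| <= B.
Proof.
have [B HB] := kb; exists B; last by move=> a /HB[].
by apply: le_trans (normr_ge0 _) ((HB [::] isT).2 (0, 0)).
Qed.

Lemma kernel_pderiv_l a i x y : (size a <= 3)%N ->
  is_derive x (evec R i) (fun x => kernel_pderiv k a (x, y))
    (kernel_pderiv k (inl i :: a) (x, y)).
Proof.
move=> sa; have [B HB] := kb.
have [[_ dk] _] := HB (inl i :: a) sa.
have [d1 d2] := derive_pair_l (kernel_pderiv k a) x y i.
by apply: DeriveDef; [exact/d1/dk|rewrite -d2].
Qed.

Lemma kernel_pderiv_r a i x y : (size a <= 3)%N ->
  is_derive y (evec R i) (fun y => kernel_pderiv k a (x, y))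
    (kernel_pderiv k (inr i :: a) (x, y)).
Proof.
move=> sa; have [B HB] := kb.
have [[_ dk] _] := HB (inr i :: a) sa.
have [d1 d2] := derive_pair_r (kernel_pderiv k a) x y i.
by apply: DeriveDef; [exact/d1/dk|rewrite -d2].
Qed.

(** The derivatives of the next order are bounded, as their order is at most 4. Being Lipschitz in
    the two arguments jointly also provides the joint continuity, hence measurability, of these
    derivatives. *)
Lemma kernel_pderiv_lipschitz : exists2 B : R, 0 <= B & forall a, (size a <= 3)%N ->
  forall z z' : V * V, `|kernel_pderiv k a z - kernel_pderiv k a z'| <=
     B * (norm1 (z.1 - z'.1) + norm1 (z.2 - z'.2)).
Proof.
have [B B0 HB] := kernel_pderiv_bound; exists B => // a sa [x y] [x' y'] /=.
rewrite mulrDr.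
rewrite (_ : _ - _ = (kernel_pderiv k a (x, y) - kernel_pderiv k a (x', y)) +
   (kernel_pderiv k a (x', y) - kernel_pderiv k a (x', y'))); last by ring.
apply: le_trans (ler_normD _ _) _; apply: lerD.
  apply: le_trans (coord_lipschitz (L := fun=> B)
    (f := fun x => kernel_pderiv k a (x, y)) _) _.
    move=> i z _; have D := @kernel_pderiv_l a i z y sa.
    by split; [case: D|rewrite derive_val; exact: HB].
  by rewrite -mulr_sumr ler_wpM2l// ler_sum// => i _; rewrite !mxE.
apply: le_trans (coord_lipschitz (L := fun=> B)
  (f := fun y => kernel_pderiv k a (x', y)) _) _.
  move=> i z _; have D := @kernel_pderiv_r a i x' z sa.
  by split; [case: D|rewrite derive_val; exact: HB].
by rewrite -mulr_sumr ler_wpM2l// ler_sum// => i _; rewrite !mxE.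
Qed.

Lemma kernel_pderiv_continuous a : (size a <= 3)%N ->
  continuous (kernel_pderiv k a).
Proof.
move=> sa; have [B _ HB] := kernel_pderiv_lipschitz.
exact: (norm1_lipschitz_continuous2 (HB a sa)).
Qed.

Lemma measurable_kernel_pderiv a : (size a <= 3)%N ->
  measurable_fun setT (kernel_pderiv k a).
Proof.
by move=> sa; apply: continuous_measurable_mx2; exact: kernel_pderiv_continuous.
Qed.

End KernelDerivatives.

(** * Linear growth and Lipschitz bounds of [u] *)

Section SteinU.
Variables (R : realType) (d : nat).
Notation V := 'cV[R]_d.
Variables (p0 : V -> R) (k : V -> V -> R).
Hypotheses (kb : kernel_bounded4 k) (p0_lip : lipschitz_score p0).

(** The contribution of coordinate [i] to [u]: the scalar products and the trace are sums over
    coordinates, and integration by parts treats one coordinate at a time. *)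
Definition stein_ui (i : 'I_d) (z : V * V) : R :=
  score p0 z.1 i 0 * kernel_pderiv k [::] z * score p0 z.2 i 0
  + score p0 z.1 i 0 * kernel_pderiv k [:: inr i] z
  + kernel_pderiv k [:: inl i] z * score p0 z.2 i 0
  + kernel_pderiv k [:: inl i; inr i] z.

Lemma stein_uE x y : stein_u p0 k x y = \sum_i stein_ui i (x, y).
Proof.
rewrite /stein_u /dotp !mxE /mxtrace -!big_split/=; apply: eq_bigr => i _.
have E1 : kernel_pderiv k [:: inr i] (x, y) = 'D_(evec R i) (k x) y.
  exact: (derive_pair_r (fun z => k z.1 z.2) x y i).2.
have E2 : kernel_pderiv k [:: inl i] (x, y) = 'D_(evec R i) (k ^~ y) x.
  exact: (derive_pair_l (fun z => k z.1 z.2) x y i).2.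
have E3 : kernel_pderiv k [:: inl i; inr i] (x, y) =
    'D_(evec R i) (fun x' => 'D_(evec R i) (k x') y) x.
  transitivity ('D_(evec R i) (fun x' => kernel_pderiv k [:: inr i] (x', y)) x).
    exact: (derive_pair_l (kernel_pderiv k [:: inr i]) x y i).2.
  congr ('D_(evec R i) _ x); apply/funext => x'.
  exact: (derive_pair_r (fun z => k z.1 z.2) x' y i).2.
have E0 : kernel_pderiv k [::] (x, y) = k x y by [].
rewrite /stein_ui E0 E1 E2 E3.
by rewrite /score /grad !mxE /=; ring.
Qed.

(** The growth bound is the Lipschitz bound against the value at 0. With [1 <= L] the constant 1
    obeys the same bound as a score, so the terms of [u] that lack a score factor can be handled as
    products with 1. *)
Lemma score_growth : exists2 L : R, 1 <= L & forall i,
  (forall x y, `|score p0 x i 0 - score p0 y i 0| <= L * norm1 (x - y)) /\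
  (forall x, `|score p0 x i 0| <= L * (1 + norm1 x)).
Proof.
have [K K0 HK] := p0_lip.
have [_ {}HK] := HK [::] isT.
have lip i x y : `|score p0 x i 0 - score p0 y i 0| <= K * norm1 (x - y).
  apply: le_trans (_ : enorm (score p0 x - score p0 y) <= _).
    by apply: le_trans (enorm_entry _ i); rewrite !mxE.
  by apply: le_trans (HK x y) _; rewrite ler_wpM2l ?(ltW K0)// enorm_le_norm1.
pose A : R := norm1 (score p0 0).
have A0 : 0 <= A by exact: norm1_ge0.
exists (1 + K + A); first lra.
move=> i; split=> x.
  move=> y; apply: le_trans (lip i x y) _; rewrite ler_wpM2r ?norm1_ge0//; lra.
have := lip i x 0; rewrite subr0 => H.
have HA : `|score p0 0 i 0| <= A by exact: norm1_entry.
have := ler_normD (score p0 x i 0 - score p0 0 i 0) (score p0 0 i 0).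
rewrite subrK => H2.
have n0 := norm1_ge0 x; nra.
Qed.

Lemma measurable_score i : measurable_fun setT (fun x : V => score p0 x i 0).
Proof.
have [L _ HL] := score_growth.
apply: continuous_measurable_mx.
exact: (norm1_lipschitz_continuous (HL i).1).
Qed.

Lemma measurable_stein_ui i : measurable_fun setT (stein_ui i).
Proof.
have m1 : measurable_fun setT (fun z : V * V => score p0 z.1 i 0).
  exact: (measurableT_comp (measurable_score i) measurable_fst).
have m2 : measurable_fun setT (fun z : V * V => score p0 z.2 i 0).
  exact: (measurableT_comp (measurable_score i) measurable_snd).
have mk a : (size a <= 3)%N -> measurable_fun setT (kernel_pderiv k a).
  exact: measurable_kernel_pderiv.
apply: measurable_funD; last exact: mk.
apply: measurable_funD; last by apply: measurable_funM => //; exact: mk.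
apply: measurable_funD; last by apply: measurable_funM => //; exact: mk.
by apply: measurable_funM => //; apply: measurable_funM => //; exact: mk.
Qed.

Lemma measurable_stein_u : measurable_fun setT (fun z : V * V => stein_u p0 k z.1 z.2).
Proof.
rewrite (_ : (fun z => _) = (fun z => \sum_i stein_ui i z)); last first.
  by apply/funext => -[x y]; rewrite stein_uE.
by apply: measurable_sum => i; exact: measurable_stein_ui.
Qed.

(** The factors are changed one at a time. [a] and [b] are growth weights of the two arguments, [D]
    and [D'] their displacements; [1 <= a] and [1 <= b] absorb the three resulting terms into
    [a * b * (D + D')]. The terms of [u] with fewer factors are obtained by putting 1 for a missing
    score. *)
Lemma lipschitz_triple_product (al al' be be' ka ka' L a b D D' : R) :
  1 <= L -> 1 <= a -> 1 <= b -> 0 <= D -> 0 <= D' ->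
  `|al' | <= L * a -> `|be| <= L * b ->
  `|ka| <= L -> `|ka'| <= L ->
  `|al - al'| <= L * D -> `|be - be'| <= L * D' -> `|ka - ka'| <= L * (D + D') ->
  `|al * ka * be - al' * ka' * be'| <= 2 * L ^+ 3 * (a * b * (D + D')).
Proof.
move=> L1 a1 b1 D0 D'0 Hal Hbe Hka Hka' dal dbe dka.
have L0 : 0 <= L by lra.
rewrite (_ : _ - _ = (al - al') * ka * be + al' * (ka - ka') * be +
  al' * ka' * (be - be')); last by ring.
have H1 : `|(al - al') * ka * be| <= L * D * L * (L * b).
  by rewrite !normrM; apply: ler_pM => //; apply: ler_pM.
have H2 : `|al' * (ka - ka') * be| <= L * a * (L * (D + D')) * (L * b).
  by rewrite !normrM; apply: ler_pM => //; apply: ler_pM.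
have H3 : `|al' * ka' * (be - be')| <= L * a * L * (L * D').
  by rewrite !normrM; apply: ler_pM => //; apply: ler_pM.
have L3 : 0 <= L ^+ 3 by exact: exprn_ge0.
have E1 : L * D * L * (L * b) = L ^+ 3 * (b * D) by ring.
have E2 : L * a * (L * (D + D')) * (L * b) = L ^+ 3 * (a * b * (D + D')) by ring.
have E3 : L * a * L * (L * D') = L ^+ 3 * (a * D') by ring.
have F1 : b * D + a * D' <= a * b * (D + D').
  have : 0 <= (a - 1) * (b * D) by rewrite !mulr_ge0 ?subr_ge0//; lra.
  have : 0 <= (b - 1) * (a * D') by rewrite !mulr_ge0 ?subr_ge0//; lra.
  lra.
have F2 := ler_wpM2l L3 F1.
have := ler_normD ((al - al') * ka * be + al' * (ka - ka') * be) (al' * ka' * (be - be')).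
have := ler_normD ((al - al') * ka * be) (al' * (ka - ka') * be).
rewrite E1 in H1; rewrite E2 in H2; rewrite E3 in H3.
rewrite mulrDr in F2; lra.
Qed.

Lemma dist_sum4_le (A1 A2 A3 A4 B1 B2 B3 B4 m : R) :
  `|A1 - B1| <= m -> `|A2 - B2| <= m -> `|A3 - B3| <= m -> `|A4 - B4| <= m ->
  `|A1 + A2 + A3 + A4 - (B1 + B2 + B3 + B4)| <= 4 * m.
Proof.
move=> H1 H2 H3 H4.
rewrite (_ : _ - _ = (A1 - B1) + (A2 - B2) + (A3 - B3) + (A4 - B4)); last by ring.
have := ler_normD (A1 - B1 + (A2 - B2) + (A3 - B3)) (A4 - B4).
have := ler_normD (A1 - B1 + (A2 - B2)) (A3 - B3).
have := ler_normD (A1 - B1) (A2 - B2).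
lra.
Qed.

Lemma lipschitz_left_product (al al' ka ka' L a b D D' : R) :
  1 <= L -> 1 <= a -> 1 <= b -> 0 <= D -> 0 <= D' ->
  `|al' | <= L * a -> `|ka| <= L -> `|ka'| <= L ->
  `|al - al'| <= L * D -> `|ka - ka'| <= L * (D + D') ->
  `|al * ka - al' * ka'| <= 2 * L ^+ 3 * (a * b * (D + D')).
Proof.
move=> L1 a1 b1 D0 D'0 Hal Hka Hka' dal dka.
have := @lipschitz_triple_product al al' 1 1 ka ka' L a b D D' L1 a1 b1 D0 D'0.
by rewrite !mulr1 subrr normr0 normr1; apply => //; [nra|rewrite mulr_ge0//; lra].
Qed.

Lemma lipschitz_right_product (be be' ka ka' L a b D D' : R) :
  1 <= L -> 1 <= a -> 1 <= b -> 0 <= D -> 0 <= D' ->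
  `|be| <= L * b -> `|ka| <= L -> `|ka'| <= L ->
  `|be - be'| <= L * D' -> `|ka - ka'| <= L * (D + D') ->
  `|ka * be - ka' * be'| <= 2 * L ^+ 3 * (a * b * (D + D')).
Proof.
move=> L1 a1 b1 D0 D'0 Hbe Hka Hka' dbe dka.
have := @lipschitz_triple_product 1 1 be be' ka ka' L a b D D' L1 a1 b1 D0 D'0.
by rewrite !mul1r subrr normr0 normr1; apply => //; [nra|rewrite mulr_ge0//; lra].
Qed.

Lemma lipschitz_no_product (ka ka' L a b D D' : R) :
  1 <= L -> 1 <= a -> 1 <= b -> 0 <= D -> 0 <= D' ->
  `|ka| <= L -> `|ka'| <= L -> `|ka - ka'| <= L * (D + D') ->
  `|ka - ka'| <= 2 * L ^+ 3 * (a * b * (D + D')).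
Proof.
move=> L1 a1 b1 D0 D'0 Hka Hka' dka.
have := @lipschitz_left_product 1 1 ka ka' L a b D D' L1 a1 b1 D0 D'0.
by rewrite !mul1r subrr normr0 normr1; apply => //; [nra|rewrite mulr_ge0//; lra].
Qed.

Lemma stein_ui_growth : exists2 C : R, 0 <= C & forall i,
  (forall z, `|stein_ui i z| <= C * ((1 + norm1 z.1) * (1 + norm1 z.2))) /\
  (forall z z', `|stein_ui i z - stein_ui i z'| <= C *
     ((1 + norm1 z.1 + norm1 z'.1) * (1 + norm1 z.2 + norm1 z'.2) *
      (norm1 (z.1 - z'.1) + norm1 (z.2 - z'.2)))).
Proof.
have [L1 L11 Hs] := score_growth.
have [B1 B10 Hk] := kernel_pderiv_bound kb.
have [B2 B20 Hl] := kernel_pderiv_lipschitz kb.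
pose L := L1 + B1 + B2.
have L_ge1 : 1 <= L by rewrite /L; lra.
have L0 : 0 <= L by lra.
have s1 i (x y : V) : `|score p0 x i 0 - score p0 y i 0| <= L * norm1 (x - y).
  apply: le_trans ((Hs i).1 x y) _; rewrite ler_wpM2r ?norm1_ge0// /L; lra.
have s2 i (x y : V) : `|score p0 x i 0| <= L * (1 + norm1 x + norm1 y).
  apply: le_trans ((Hs i).2 x) _.
  have := norm1_ge0 x; have := norm1_ge0 y => ny nx.
  by apply: ler_pM; rewrite /L; lra.
have s2' i (x y : V) : `|score p0 x i 0| <= L * (1 + norm1 y + norm1 x).
  by rewrite addrAC; exact: s2.
have k1 a : (size a <= 3)%N -> forall z, `|kernel_pderiv k a z| <= L.
  move=> sa z; apply: le_trans (Hk a _ z) _; first exact: leq_trans sa _.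
  by rewrite /L; lra.
have k2 a : (size a <= 3)%N -> forall z z', `|kernel_pderiv k a z - kernel_pderiv k a z'|
    <= L * (norm1 (z.1 - z'.1) + norm1 (z.2 - z'.2)).
  move=> sa z z'; apply: le_trans (Hl a sa z z') _.
  by rewrite ler_wpM2r ?addr_ge0 ?norm1_ge0// /L; lra.
clearbody L.
have L3 : 0 <= L ^+ 3 by exact: exprn_ge0.
(* Four terms, each with the constant [2 * L ^+ 3] of the product lemmas; the growth bound needs
   only half of this. *)
exists (8 * L ^+ 3); first lra.
move=> i; split=> z.
  have n1 := norm1_ge0 z.1; have n2 := norm1_ge0 z.2.
  have t1 (al be ka : R) : `|al| <= L * (1 + norm1 z.1) -> `|be| <= L * (1 + norm1 z.2) ->
     `|ka| <= L -> `|al * ka * be| <= L ^+ 3 * ((1 + norm1 z.1) * (1 + norm1 z.2)).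
    move=> Ha Hb Hc; rewrite !normrM.
    rewrite (_ : L ^+ 3 * _ = L * (1 + norm1 z.1) * L * (L * (1 + norm1 z.2))); last by ring.
    by apply: ler_pM => //; apply: ler_pM.
  have one x : 0 <= x -> `|1 : R| <= L * (1 + x).
    by move=> x0; rewrite normr1; nra.
  have sz1 : `|score p0 z.1 i 0| <= L * (1 + norm1 z.1).
    by have := s2 i z.1 0; rewrite (_ : norm1 0 = 0) ?addr0// /norm1 big1// => j _; rewrite mxE normr0.
  have sz2 : `|score p0 z.2 i 0| <= L * (1 + norm1 z.2).
    by have := s2 i z.2 0; rewrite (_ : norm1 0 = 0) ?addr0// /norm1 big1// => j _; rewrite mxE normr0.
  have T1 := t1 _ _ _ sz1 sz2 (k1 [::] isT z).
  have T2 := t1 _ _ _ sz1 (one _ n2) (k1 [:: inr i] isT z).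
  have T3 := t1 _ _ _ (one _ n1) sz2 (k1 [:: inl i] isT z).
  have T4 := t1 _ _ _ (one _ n1) (one _ n2) (k1 [:: inl i; inr i] isT z).
  rewrite ?mul1r ?mulr1 in T2 T3 T4.
  set Q := (1 + norm1 z.1) * (1 + norm1 z.2) in T1 T2 T3 T4 *.
  have Q0 : 0 <= L ^+ 3 * Q by rewrite mulr_ge0// mulr_ge0; lra.
  rewrite /stein_ui.
  have := ler_normD (score p0 z.1 i 0 * kernel_pderiv k [::] z * score p0 z.2 i 0
    + score p0 z.1 i 0 * kernel_pderiv k [:: inr i] z
    + kernel_pderiv k [:: inl i] z * score p0 z.2 i 0) (kernel_pderiv k [:: inl i; inr i] z).
  have := ler_normD (score p0 z.1 i 0 * kernel_pderiv k [::] z * score p0 z.2 i 0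
    + score p0 z.1 i 0 * kernel_pderiv k [:: inr i] z)
    (kernel_pderiv k [:: inl i] z * score p0 z.2 i 0).
  have := ler_normD (score p0 z.1 i 0 * kernel_pderiv k [::] z * score p0 z.2 i 0)
    (score p0 z.1 i 0 * kernel_pderiv k [:: inr i] z).
  lra.
move=> z'.
set a := 1 + norm1 z.1 + norm1 z'.1; set b := 1 + norm1 z.2 + norm1 z'.2.
set D := norm1 (z.1 - z'.1); set D' := norm1 (z.2 - z'.2).
have a1 : 1 <= a by have := norm1_ge0 z.1; have := norm1_ge0 z'.1; rewrite /a; lra.
have b1 : 1 <= b by have := norm1_ge0 z.2; have := norm1_ge0 z'.2; rewrite /b; lra.
have D0 : 0 <= D by exact: norm1_ge0.
have D'0 : 0 <= D' by exact: norm1_ge0.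

have sa : `|score p0 z'.1 i 0| <= L * a by exact: s2'.
have sb : `|score p0 z.2 i 0| <= L * b by exact: s2.
have T1 := lipschitz_triple_product L_ge1 a1 b1 D0 D'0 sa sb (k1 [::] isT z)
  (k1 [::] isT z') (s1 i z.1 z'.1) (s1 i z.2 z'.2) (k2 [::] isT z z').
have T2 := lipschitz_left_product L_ge1 a1 b1 D0 D'0 sa (k1 [:: inr i] isT z)
  (k1 [:: inr i] isT z') (s1 i z.1 z'.1) (k2 [:: inr i] isT z z').
have T3 := lipschitz_right_product L_ge1 a1 b1 D0 D'0 sb (k1 [:: inl i] isT z)
  (k1 [:: inl i] isT z') (s1 i z.2 z'.2) (k2 [:: inl i] isT z z').
have T4 := lipschitz_no_product L_ge1 a1 b1 D0 D'0
  (k1 [:: inl i; inr i] isT z) (k1 [:: inl i; inr i] isT z')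
  (k2 [:: inl i; inr i] isT z z').
set Q := a * b * (D + D') in T1 T2 T3 T4 *; clearbody Q.
rewrite /stein_ui.
apply: le_trans (dist_sum4_le T1 T2 T3 T4) _.
by rewrite le_eqVlt; apply/orP; left; apply/eqP; ring.
Qed.

Lemma stein_u_growth : exists2 C : R, 0 <= C &
  (forall x y, `|stein_u p0 k x y| <= C * ((1 + norm1 x) * (1 + norm1 y))) /\
  (forall x y x' y', `|stein_u p0 k x y - stein_u p0 k x' y'| <= C *
     ((1 + norm1 x + norm1 x') * (1 + norm1 y + norm1 y') *
      (norm1 (x - x') + norm1 (y - y')))).
Proof.
have [C C0 HC] := stein_ui_growth.
exists (d%:R * C); first exact: mulr_ge0.
split=> x y.
  rewrite stein_uE; apply: le_trans (ler_norm_sum _ _ _) _.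
  apply: le_trans (ler_sum _ (fun i _ => (HC i).1 (x, y))) _.
  by rewrite /= sumr_const card_ord -mulrA mulr_natl.
move=> x' y'; rewrite !stein_uE -sumrB; apply: le_trans (ler_norm_sum _ _ _) _.
apply: le_trans (ler_sum _ (fun i _ => (HC i).2 (x, y) (x', y'))) _.
by rewrite /= sumr_const card_ord -[d%:R * C * _]mulrA mulr_natl.
Qed.

End SteinU.

(** * Positivity of the mean of the Stein kernel *)

Lemma measurable_EFin d (T : measurableType d) (R : realType) (D : set T)
  (f : T -> R) : measurable_fun D f -> measurable_fun D (EFin \o f).
Proof. by move=> mf; apply/measurable_EFinP. Qed.

Lemma integrable_measurable d (T : measurableType d) (R : realType)
    (mu : {measure set T -> \bar R}) (D : set T) (f : T -> R) :
  mu.-integrable D (EFin \o f) -> measurable_fun D f.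
Proof. by move=> /integrableP[mf _]; apply/measurable_EFinP. Qed.

Lemma integrable_prod2 d1 d2 (T1 : measurableType d1) (T2 : measurableType d2)
    (R : realType) (mu : {sigma_finite_measure set T1 -> \bar R})
    (nu : {sigma_finite_measure set T2 -> \bar R}) (phi : T1 -> R) (psi : T2 -> R) :
  mu.-integrable setT (EFin \o phi) -> nu.-integrable setT (EFin \o psi) ->
  (mu \x nu)%E.-integrable setT (fun z : T1 * T2 => (phi z.1 * psi z.2)%:E).
Proof.
move=> iphi ipsi.
have mphi := integrable_measurable iphi.
have mpsi := integrable_measurable ipsi.
apply/integrable12ltyP.
  apply/measurable_EFinP; apply: measurable_funM.
    exact: (measurableT_comp mphi measurable_fst).
  exact: (measurableT_comp mpsi measurable_snd).
have E x : (\int[nu]_y `|(phi x * psi y)%:E| =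
   `|phi x|%:E * \int[nu]_y `|(psi y)%:E|)%E.
  rewrite -ge0_integralZl//; last first.
    by apply: measurableT_comp => //; exact/measurable_EFinP.
  by apply: eq_integral => y _; rewrite /= normrM EFinM.
under eq_integral do rewrite E.
rewrite ge0_integralZr//; last 2 first.
  by apply/measurable_EFinP; exact: measurableT_comp.
  exact: integral_ge0.
have /integrableP[_ fphi] := iphi.
have /integrableP[_ fpsi] := ipsi.
apply: lte_mul_pinfty => //; first exact: integral_ge0.
by rewrite ge0_fin_numE//; exact: integral_ge0.
Qed.

Section ProductIntegrals.
Variables (R : realType) (d : nat).
Notation V := 'cV[R]_d.
Notation leb := (lebesgue_cV R d).
Notation leb2 := (leb \x leb)%E.

Lemma integrable_prod2_bounded (phi psi : V -> R) (ka : V * V -> R) (B : R) :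
  leb.-integrable setT (EFin \o phi) -> leb.-integrable setT (EFin \o psi) ->
  measurable_fun setT ka -> (forall z, `|ka z| <= B) ->
  leb2.-integrable setT (fun z : V * V => (phi z.1 * psi z.2 * ka z)%:E).
Proof.
move=> iphi ipsi mka kaB.
have i2 := integrable_prod2 iphi ipsi.
have := integrableZl measurableT B i2.
apply: le_integrable => //.
  apply/measurable_EFinP; apply: measurable_funM => //.
  exact: (integrable_measurable i2).
move=> z _; rewrite /= lee_fin [leRHS]normrM normrM mulrC ler_wpM2r//.
exact: le_trans (kaB z) (ler_norm B).
Qed.

Lemma integral2_ae_eq0 (F : V * V -> R) :
  leb2.-integrable setT (EFin \o F) ->
  {ae leb, forall x, (\int[leb]_y (F (x, y))%:E = 0)%E} ->
  (\int[leb2]_z (F z)%:E = 0)%E.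
Proof.
move=> iF F0; rewrite -(integral12_prod_meas1 iF) -[RHS](integral0 leb setT).
apply: ae_eq_integral => //.
  exact: (measurable_fubini_F iF).
by apply: filterS F0 => x H _.
Qed.

Lemma integral2_eq0_l (F : V * V -> R) :
  leb2.-integrable setT (EFin \o F) ->
  (forall x, \int[leb]_y (F (x, y))%:E = 0)%E ->
  (\int[leb2]_z (F z)%:E = 0)%E.
Proof. by move=> iF F0; apply: integral2_ae_eq0 => //; exact: aeW. Qed.

Lemma integral2_eq0_r (F : V * V -> R) :
  leb2.-integrable setT (EFin \o F) ->
  (forall y, \int[leb]_x (F (x, y))%:E = 0)%E ->
  (\int[leb2]_z (F z)%:E = 0)%E.
Proof.
move=> iF F0; rewrite -(integral21_prod_meas1 iF) -[RHS](integral0 leb setT).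
by apply: eq_integral => y _; exact: F0.
Qed.

Lemma measurable_box (a b : V) :
  measurable [set x : V | forall i, a i 0 <= x i 0 <= b i 0].
Proof.
rewrite (_ : [set x : V | _] = \bigcap_i
    (fun x : V => x i 0) @^-1` [set` `[a i 0, b i 0]]).
  apply: fin_bigcap_measurable => // i _.
  rewrite -[X in measurable X]setTI.
  exact: measurable_mx_entry.
apply/seteqP; split => x /= H i; [move=> _|]; have := H i; rewrite /= in_itv//=.
exact.
Qed.

(** If [f x != g x], the functions differ on a whole neighbourhood of [x]. A ball of the sup norm
    contains a closed box with nonempty interior, whose Lebesgue measure is positive, while the
    exceptional set is null. *)
Lemma ae_eq_continuous (f g : V -> R) : continuous f -> continuous g ->
  {ae leb, forall x, f x = g x} -> forall x, f x = g x.
Proof.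
move=> cf cg [N [mN N0 fgN]] x; apply/eqP; apply/negPn/negP => fg.
have sep (f1 f2 : V -> R) : continuous f1 -> continuous f2 -> f1 x < f2 x ->
    \forall y \near x, f1 y != f2 y.
  move=> c1 c2 lt12.
  have lt1 : f1 x < (f1 x + f2 x) / 2 by lra.
  have lt2 : (f1 x + f2 x) / 2 < f2 x by lra.
  have N1 : \forall y \near x, f1 y < (f1 x + f2 x) / 2 := c1 x _ (lt_nbhsl lt1).
  have N2 : \forall y \near x, (f1 x + f2 x) / 2 < f2 y := c2 x _ (lt_nbhsr lt2).
  by apply: filterS2 N1 N2 => y l1 l2; rewrite lt_eqF// (lt_trans l1).
have : \forall y \near x, f y != g y.
  move: fg; rewrite neq_lt => /orP[|] fg; first exact: sep.
  by apply: filterS (sep g f cg cf fg) => y; rewrite eq_sym.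
move=> /nbhs_ballP[r /= r0 xr].
pose a : V := \col_i (x i 0 - r / 2); pose b : V := \col_i (x i 0 + r / 2).
have ab i : a i 0 <= b i 0 by rewrite !mxE; lra.
have sub : [set y : V | forall i, a i 0 <= y i 0 <= b i 0] `<=` N.
  move=> y /= aby; apply: fgN => /= fgy.
  have : f y != g y.
    apply: xr; split=> // i j; rewrite ord1 /ball/=.
    by have := aby i; rewrite !mxE ltr_norml; lra.
  by rewrite fgy eqxx.
have : (leb [set y : V | forall i, (a i 0 <= y i 0 <= b i 0)%R] <= leb N)%E.
  by apply: le_measure => //; rewrite inE//; exact: measurable_box.
rewrite N0 lebesgue_cV_box// lee_fin leNgt => /negP; apply.
by apply: prodr_gt0 => i _; rewrite !mxE; lra.
Qed.

End ProductIntegrals.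

(** * Stein's identity by truncation, and the sign of its limit *)

Section SteinPositivity.
Variables (R : realType) (d : nat).
Notation V := 'cV[R]_d.
Notation leb := (lebesgue_cV R d).
Notation leb2 := (leb \x leb)%E.
Variables (p p0 : V -> R) (k : V -> V -> R).
Hypotheses (p_dens : is_density p) (p0_dens : is_density p0).
Hypotheses (p_score : has_score_on (supp p) p) (p0_score : has_score_on setT p0).
Hypotheses (p_cont : continuous p) (p0_cont : continuous p0).
Hypothesis pdelta_L2 :
  (\int[leb]_x (enorm (p x *: score_diff p0 p x) ^+ 2)%:E < +oo)%E.
Hypotheses (p0_lip : lipschitz_score p0) (kb : kernel_bounded4 k).
Hypothesis k_ispd : integrally_strictly_posdef (supp p) k.
Hypothesis p_norm1 : leb.-integrable setT (fun x : V => (norm1 x * p x)%:E).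

Let s i (x : V) : R := score p0 x i 0.
Let sp i (x : V) : R := score p x i 0.
Let h i (x : V) : R := p x * (s i x - sp i x).

Let p_ge0 x : 0 <= p x. Proof. by have [] := p_dens. Qed.
Let mp : measurable_fun setT p. Proof. by have [] := p_dens. Qed.
Let ms i : measurable_fun setT (s i). Proof. exact: measurable_score. Qed.

Let ip : leb.-integrable setT (EFin \o p).
Proof.
apply/integrableP; split; first exact: measurable_EFin.
have [_ _ p1] := p_dens.
by under eq_integral do rewrite gee0_abs ?lee_fin//; rewrite p1 ltry.
Qed.

Let is_derive_ln_p i x : 0 < p x ->
  is_derive x (evec R i) (fun y => ln (p y)) (sp i x).
Proof.
move=> px; have [_ /(_ i) dp] := p_score px.
by apply: DeriveDef => //; rewrite /sp /score mxE.
Qed.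

Let is_derive_ln_p0 i x : is_derive x (evec R i) (fun y => ln (p0 y)) (s i x).
Proof.
have [_ /(_ i) dp] := @p0_score x I.
by apply: DeriveDef => //; rewrite /s /score mxE.
Qed.

Let p0_gt0 x : 0 < p0 x. Proof. by have [] := @p0_score x I. Qed.

(** The score of [p] is meaningful on the support only. Multiplied by [p], the difference quotients
    of [ln p] converge everywhere: off the support every approximant is 0, as is [h i]. *)
Let mh i : measurable_fun setT (h i).
Proof.
apply: (@measurable_fun_cvg _ _ R setT (fun n (x : V) =>
  p x * (s i x - n.+1%:R * (ln (p (x + n.+1%:R^-1 *: evec R i)) - ln (p x))))).
  have mlp : measurable_fun setT (fun x : V => ln (p x)).
    exact: (measurableT_comp (@measurable_ln R) mp).
  move=> m; apply: measurable_funM; first exact: mp.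
  apply: measurable_funB; first exact: ms.
  apply: measurable_funM => //; apply: measurable_funB => //.
  by apply: (measurableT_comp mlp); exact: measurable_shift_cV.
move=> x _; have [px|px] := ltP 0 (p x); last first.
  have px0 : p x = 0 by apply/eqP; rewrite eq_le px p_ge0.
  by rewrite /h px0 mul0r; under eq_fun do rewrite mul0r; exact: cvg_cst.
apply: cvgM; first exact: cvg_cst.
apply: cvgB; first exact: cvg_cst.
have dl := is_derive_ln_p i px.
have := @cvg_diff_quotient R V R (fun y => ln (p y)) x (evec R i) _.
rewrite derive_val; apply; exact: ex_derive.
Qed.

Let h_off i x : p x = 0 -> h i x = 0.
Proof. by move=> px; rewrite /h px mul0r. Qed.

Let ih2 i : leb.-integrable setT (fun x => (h i x ^+ 2)%:E).
Proof.
have mh2 j : measurable_fun setT (fun x => h j x ^+ 2).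
  exact: (measurable_funX 2 (mh j)).
apply/integrableP; split; first exact: (measurable_EFin (mh2 i)).
under eq_integral do rewrite gee0_abs ?lee_fin ?sqr_ge0//.
apply: le_lt_trans pdelta_L2.
have E x : enorm (p x *: score_diff p0 p x) ^+ 2 = \sum_j h j x ^+ 2.
  rewrite sqr_sqrtr; last by apply: sumr_ge0 => j _; exact: sqr_ge0.
  by apply: eq_bigr => j _; rewrite /h /s /sp !mxE.
under [leRHS]eq_integral do rewrite E.
apply: ge0_le_integral => //.
- by move=> x _; rewrite lee_fin sqr_ge0.
- exact: (measurable_EFin (mh2 i)).
- by apply: measurable_EFin; apply: measurable_sum => j; exact: mh2.
- move=> x _; rewrite lee_fin (bigD1 i)//= lerDl sumr_ge0// => j _.
  exact: sqr_ge0.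
Qed.

Section Truncated.
Variables (i : 'I_d) (e : R).
Hypothesis e0 : 0 < e.

(** [al], [be] and [ga] truncate [h i], [p] times the score of [p0], and [p]. They are tied by
    ['D_(evec R i) ga = be - al], both sides being [a] times [p] times the score of [p]. *)
Let a x := dsofttr e (p x).
Let al x := a x * h i x.
Let be x := a x * p x * s i x.
Let ga x := softtr e (p x).

Let a01 x : 0 <= a x <= 1. Proof. exact: dsofttr_bounds. Qed.
Let ga0p x : 0 <= ga x <= p x.
Proof. exact: (softtr_bounds e0 (p_ge0 x)). Qed.

Let ma : measurable_fun setT a.
Proof. exact: (measurableT_comp (measurable_dsofttr e0) mp). Qed.

Let mga : measurable_fun setT ga.
Proof. exact: (measurableT_comp (measurable_softtr e0) mp). Qed.

(** Where [a] does not vanish, [p] exceeds [e], so 1 is at most [e^-1 * p x], and [|h| <= 1 + h^2]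
    gives an integrable majorant. *)
Lemma truncated_al_integrable : leb.-integrable setT (EFin \o al).
Proof.
have i1 := integrableD measurableT (integrableZl measurableT e^-1 ip) (ih2 i).
apply: le_integrable i1 => //.
  exact: (measurable_EFin (measurable_funM ma (mh i))).
move=> x _; rewrite /= lee_fin normrM.
have /andP[a0 a1] := a01 x; rewrite (ger0_norm a0).
have q0 : 0 <= e^-1 * p x + h i x ^+ 2.
  by rewrite addr_ge0 ?sqr_ge0// mulr_ge0// ?invr_ge0 ?(ltW e0)//; exact: p_ge0.
rewrite (ger0_norm q0).
have [pe|pe] := ltP e (p x); last first.
  by rewrite {1}/a dsofttr0// mul0r.
have pe1 : 1 <= e^-1 * p x by rewrite mulrC ler_pdivlMr// mul1r ltW.
rewrite -[h i x ^+ 2]real_normK ?num_real//.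
have n0 := normr_ge0 (h i x).
have : a x * `|h i x| <= 1 * `|h i x| by rewrite ler_wpM2r.
by nra.
Qed.

Lemma truncated_be_bound x : `|be x| <= `|s i x| * p x.
Proof.
have /andP[a0 a1] := a01 x.
rewrite /be !normrM (ger0_norm a0) (ger0_norm (p_ge0 x)) mulrC.
by rewrite ler_wpM2l// ler_piMl// p_ge0.
Qed.

Lemma integrable_score : leb.-integrable setT (fun x => (s i x * p x)%:E).
Proof.
have [L L1 HL] := score_growth p0_lip.
have := integrableZl measurableT L (integrableD measurableT ip p_norm1).
apply: le_integrable => //.
  exact: (measurable_EFin (measurable_funM (ms i) mp)).
move=> x _; rewrite /= lee_fin normrM (ger0_norm (p_ge0 x)).
apply: le_trans (ler_norm _).
rewrite -{2}[p x]mul1r -mulrDl mulrA ler_wpM2r ?p_ge0//.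
exact: (HL i).2.
Qed.

Lemma truncated_be_integrable : leb.-integrable setT (EFin \o be).
Proof.
apply: le_integrable integrable_score => //.
  apply: measurable_EFin; apply: measurable_funM; last exact: ms.
  exact: (measurable_funM ma mp).
move=> x _; rewrite /= lee_fin [leRHS]normrM (ger0_norm (p_ge0 x)).
exact: truncated_be_bound.
Qed.

Lemma truncated_ga_integrable : leb.-integrable setT (EFin \o ga).
Proof.
apply: le_integrable ip => //; first exact: (measurable_EFin mga).
move=> x _; rewrite /= lee_fin.
by have /andP[g0 g1] := ga0p x; rewrite !ger0_norm.
Qed.

Let bounded_integrable (f g : V -> R) B : leb.-integrable setT (EFin \o f) ->
  measurable_fun setT g -> (forall x, `|g x| <= B) ->
  leb.-integrable setT (fun x => (f x * g x)%:E).
Proof.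
move=> intf mg gB.
have := integrableZl measurableT B intf; apply: le_integrable => //.
  apply/measurable_EFinP; apply: measurable_funM => //.
  exact: (integrable_measurable intf).
move=> x _; rewrite /= lee_fin [leRHS]normrM normrM mulrC ler_wpM2r//.
exact: le_trans (gB x) (ler_norm B).
Qed.

Let integrable_sub2 (f1 f2 f3 : V -> R) : leb.-integrable setT (EFin \o f1) ->
  leb.-integrable setT (EFin \o f2) -> leb.-integrable setT (EFin \o f3) ->
  leb.-integrable setT (fun x => (f1 x - f2 x - f3 x)%:E).
Proof.
by move=> i1 i2 i3; exact: (integrableB measurableT (integrableB measurableT i1 i2) i3).
Qed.

(** Up to sign the integrand is the derivative of [f * ga], by the relation between [al], [be] and
    [ga]. The truncation makes this product derivable everywhere, also where [p] vanishes. *)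
Lemma truncated_stein (f f' : V -> R) (B : R) :
  (forall x, is_derive x (evec R i) f (f' x)) -> measurable_fun setT f ->
  (forall x, `|f x| <= B) -> (forall x, `|f' x| <= B) ->
  (\int[leb]_x (al x * f x - be x * f x - ga x * f' x)%:E = 0)%E.
Proof.
move=> df mf fB f'B.
have f'E : f' = 'D_(evec R i) f by apply/funext => x; rewrite derive_val.
have mf' : measurable_fun setT f'.
  by rewrite f'E; apply: measurable_derive_cV => // x; case: (df x).
pose W : V -> R := f * (softtr e \o p).
have pE x : 0 < p x -> p x = expR (ln (p x)) by move=> px; rewrite lnK.
have dg := is_derive_softtr_exp e0 p_cont p_ge0 pE (is_derive_ln_p i).
have dW x : is_derive x (evec R i) W (- (al x * f x - be x * f x - ga x * f' x)).
  apply: (is_derive_eq (is_deriveM (df x) (dg x))).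
  by rewrite /GRing.scale/= /al /be /ga /h -/(a x); ring.
have DW x : 'D_(evec R i) W x = - (al x * f x - be x * f x - ga x * f' x).
  by rewrite derive_val.
have i1 := bounded_integrable truncated_al_integrable mf fB.
have i2 := bounded_integrable truncated_be_integrable mf fB.
have i3 := bounded_integrable truncated_ga_integrable mf' f'B.
have i4 := integrableB measurableT (integrableB measurableT i1 i2) i3.
have mW : measurable_fun setT W by exact: (measurable_funM mf mga).
have intD : leb.-integrable setT (EFin \o 'D_(evec R i) W).
  by apply: eq_integrable (integrableN i4) => // x _; rewrite /= DW.
have intW : leb.-integrable setT (EFin \o W).
  apply: eq_integrable (bounded_integrable truncated_ga_integrable mf fB) => // x _.
  by rewrite /= mulrC.
have dW' x : derivable W x (evec R i) by case: (dW x).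
have := integral_derive_eq0 mW dW' intD intW.
under eq_integral do rewrite DW EFinN.
rewrite integralN.
  by move=> /eqP; rewrite oppe_eq0 => /eqP.
apply: fin_num_adde_defr; apply: integrable_fin_num => //.
exact: integrable_funepos.
Qed.

Let K00 := kernel_pderiv k [::].
Let K01 := kernel_pderiv k [:: inr i].
Let K10 := kernel_pderiv k [:: inl i].
Let K11 := kernel_pderiv k [:: inl i; inr i].

Definition truncated_kernel (z : V * V) : R := al z.1 * al z.2 * K00 z.
(** This is [stein_ui] times [p z.1 * p z.2], with each product of [p] and a score replaced by [be]
    and each remaining [p] by [ga]. *)
Definition truncated_u (z : V * V) : R :=
  be z.1 * be z.2 * K00 z + be z.1 * ga z.2 * K01 z +
  ga z.1 * be z.2 * K10 z + ga z.1 * ga z.2 * K11 z.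

Let mK c : (size c <= 3)%N -> measurable_fun setT (kernel_pderiv k c).
Proof. exact: measurable_kernel_pderiv. Qed.

Lemma truncated_kernel_integrable :
  leb2.-integrable setT (EFin \o truncated_kernel).
Proof.
have [B _ HB] := kernel_pderiv_bound kb.
apply: (integrable_prod2_bounded truncated_al_integrable truncated_al_integrable
  (@mK [::] isT)).
exact: (HB [::] isT).
Qed.

Lemma truncated_u_integrable : leb2.-integrable setT (EFin \o truncated_u).
Proof.
have [B _ HB] := kernel_pderiv_bound kb.
have ia := truncated_be_integrable; have ig := truncated_ga_integrable.
have j1 := integrable_prod2_bounded ia ia (@mK [::] isT) (HB [::] isT).
have j2 := integrable_prod2_bounded ia ig (@mK [:: inr i] isT) (HB [:: inr i] isT).
have j3 := integrable_prod2_bounded ig ia (@mK [:: inl i] isT) (HB [:: inl i] isT).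
have j4 := integrable_prod2_bounded ig ig (@mK [:: inl i; inr i] isT)
  (HB [:: inl i; inr i] isT).
have := integrableD measurableT (integrableD measurableT
  (integrableD measurableT j1 j2) j3) j4.
exact.
Qed.

(* Stein's identity is applied first in the second and then in the first
   argument of the kernel. *)
Lemma truncated_stein_kernel :
  (\int[leb2]_z (truncated_kernel z)%:E = \int[leb2]_z (truncated_u z)%:E)%E.
Proof.
have [B _ HB] := kernel_pderiv_bound kb.
have iA := truncated_al_integrable; have iB := truncated_be_integrable.
have iG := truncated_ga_integrable.
have jj (phi psi : V -> R) c (sc : (size c <= 3)%N) : leb.-integrable setT (EFin \o phi) ->
    leb.-integrable setT (EFin \o psi) ->
    leb2.-integrable setT (fun z : V * V => (phi z.1 * psi z.2 * kernel_pderiv k c z)%:E).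
  move=> H1 H2; apply: (integrable_prod2_bounded H1 H2 (mK sc)).
  by apply: HB; exact: leq_trans sc _.
(* [D1] trades [al z.2] for [be z.2] and [ga z.2]; [D2] and [D3] then trade [al z.1] in the two
   terms so produced. Their sum is the whole difference between [truncated_kernel] and
   [truncated_u], and each is a multiple of Stein's identity for a section of [K00] or [K01]. *)
pose D1 z : R := al z.1 * (al z.2 * K00 z - be z.2 * K00 z - ga z.2 * K01 z).
pose D2 z : R := be z.2 * (al z.1 * K00 z - be z.1 * K00 z - ga z.1 * K10 z).
pose D3 z : R := ga z.2 * (al z.1 * K01 z - be z.1 * K01 z - ga z.1 * K11 z).
have iD1 : leb2.-integrable setT (EFin \o D1).
  have := integrableB measurableT (integrableB measurableT
    (jj _ _ [::] isT iA iA) (jj _ _ [::] isT iA iB)) (jj _ _ [:: inr i] isT iA iG).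
  apply: eq_integrable => // z _ /=; congr EFin.
  by rewrite /D1 /K00 /K01; ring.
have iD2 : leb2.-integrable setT (EFin \o D2).
  have := integrableB measurableT (integrableB measurableT
    (jj _ _ [::] isT iA iB) (jj _ _ [::] isT iB iB)) (jj _ _ [:: inl i] isT iG iB).
  apply: eq_integrable => // z _ /=; congr EFin.
  by rewrite /D2 /K00 /K10; ring.
have iD3 : leb2.-integrable setT (EFin \o D3).
  have := integrableB measurableT (integrableB measurableT
    (jj _ _ [:: inr i] isT iA iG) (jj _ _ [:: inr i] isT iB iG))
    (jj _ _ [:: inl i; inr i] isT iG iG).
  apply: eq_integrable => // z _ /=; congr EFin.
  by rewrite /D3 /K01 /K11; ring.
have H1 : (\int[leb2]_z (D1 z)%:E = 0)%E.
  apply: integral2_eq0_l => // x; rewrite /D1/=.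
  under eq_integral do rewrite EFinM.
  have mf := measurable_fun_pair2 x (@mK [::] isT).
  have mg := measurable_fun_pair2 x (@mK [:: inr i] isT).
  have bf t := HB [::] isT ((x, t)).
  have bg t := HB [:: inr i] isT ((x, t)).
  have df t := kernel_pderiv_r kb i x t (isT : (size [::] <= 3)%N).
  rewrite integralZl//; last first.
    apply: integrable_sub2.
    - exact: (bounded_integrable iA mf bf).
    - exact: (bounded_integrable iB mf bf).
    - exact: (bounded_integrable iG mg bg).
  by rewrite (truncated_stein df mf bf bg) mule0.
have H2 : (\int[leb2]_z (D2 z)%:E = 0)%E.
  apply: integral2_eq0_r => // y; rewrite /D2/=.
  under eq_integral do rewrite EFinM.
  have mf := measurable_fun_pair1 y (@mK [::] isT).
  have mg := measurable_fun_pair1 y (@mK [:: inl i] isT).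
  have bf t := HB [::] isT ((t, y)).
  have bg t := HB [:: inl i] isT ((t, y)).
  have df t := kernel_pderiv_l kb i t y (isT : (size [::] <= 3)%N).
  rewrite integralZl//; last first.
    apply: integrable_sub2.
    - exact: (bounded_integrable iA mf bf).
    - exact: (bounded_integrable iB mf bf).
    - exact: (bounded_integrable iG mg bg).
  by rewrite (truncated_stein df mf bf bg) mule0.
have H3 : (\int[leb2]_z (D3 z)%:E = 0)%E.
  apply: integral2_eq0_r => // y; rewrite /D3/=.
  under eq_integral do rewrite EFinM.
  have mf := measurable_fun_pair1 y (@mK [:: inr i] isT).
  have mg := measurable_fun_pair1 y (@mK [:: inl i; inr i] isT).
  have bf t := HB [:: inr i] isT ((t, y)).
  have bg t := HB [:: inl i; inr i] isT ((t, y)).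
  have df t := kernel_pderiv_l kb i t y (isT : (size [:: inr i] <= 3)%N).
  rewrite integralZl//; last first.
    apply: integrable_sub2.
    - exact: (bounded_integrable iA mf bf).
    - exact: (bounded_integrable iB mf bf).
    - exact: (bounded_integrable iG mg bg).
  by rewrite (truncated_stein df mf bf bg) mule0.
have E z : truncated_kernel z = truncated_u z + (D1 z + D2 z + D3 z).
  by rewrite /truncated_kernel /truncated_u /D1 /D2 /D3; ring.
clearbody D1 D2 D3.
under eq_integral do rewrite E EFinD.
have iD := integrableD measurableT (integrableD measurableT iD1 iD2) iD3.
rewrite integralD//; last exact: truncated_u_integrable.
have iD12 := integrableD measurableT iD1 iD2.
have -> : (\int[leb2]_z (D1 z + D2 z + D3 z)%:E = 0)%E.
  under eq_integral do rewrite EFinD.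
  rewrite integralD; [|exact: measurableT|exact: iD12|exact: iD3].
  rewrite H3 adde0; under eq_integral do rewrite EFinD.
  by rewrite integralD; [rewrite H1 H2 adde0|exact: measurableT|exact: iD1|exact: iD2].
by rewrite adde0.
Qed.

End Truncated.

Let en n : R := n.+1%:R^-1.
Let en_gt0 n : 0 < en n. Proof. by rewrite invr_gt0. Qed.

Let m (x : V) : R := (1 + norm1 x) * p x.

Let im : leb.-integrable setT (EFin \o m).
Proof.
have := integrableD measurableT ip p_norm1; apply: eq_integrable => // x _.
by rewrite /m /= mulrDl mul1r.
Qed.

Lemma stein_ui_integrable i :
  leb2.-integrable setT (fun z : V * V => (stein_ui p0 k i z * (p z.1 * p z.2))%:E).
Proof.
have [C C0 HC] := stein_ui_growth kb p0_lip.
have := integrableZl measurableT C (integrable_prod2 im im).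
have m1 : measurable_fun setT (fun z : V * V => p z.1).
  exact: (measurableT_comp mp measurable_fst).
have m2 : measurable_fun setT (fun z : V * V => p z.2).
  exact: (measurableT_comp mp measurable_snd).
apply: le_integrable => //.
  apply: measurable_EFin; apply: measurable_funM.
    exact: measurable_stein_ui.
  exact: (measurable_funM m1 m2).
move=> z _; rewrite /= lee_fin; apply: le_trans (ler_norm _).
rewrite normrM (ger0_norm (mulr_ge0 (p_ge0 z.1) (p_ge0 z.2))).
rewrite (_ : _ * (m _ * m _) =
   C * ((1 + norm1 z.1) * (1 + norm1 z.2)) * (p z.1 * p z.2)); last first.
  by rewrite /m; ring.
by rewrite ler_wpM2r ?mulr_ge0 ?p_ge0//; exact: (HC i).1.
Qed.

(** Dominated convergence: [|be|] and [|ga|] stay below [L * m x] whatever the truncation level, and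
    [m] is integrable since [p] has a first moment. The four terms give the factor 4 in the
    majorant. *)
Lemma cvg_truncated_u i :
  (\int[leb2]_z (truncated_u i (en n) z)%:E)%E @[n --> \oo] -->
  (\int[leb2]_z (stein_ui p0 k i z * (p z.1 * p z.2))%:E)%E.
Proof.
have [L L1 HL] := score_growth p0_lip.
have [B B0 HB] := kernel_pderiv_bound kb.
have cbe x : dsofttr (en n) (p x) * p x * s i x @[n --> \oo] --> p x * s i x.
  have -> : p x * s i x = ((0 < p x)%R%:R : R) * p x * s i x.
    have [px|px] := ltP 0 (p x); first by rewrite mul1r.
    have -> : p x = 0 by apply/eqP; rewrite eq_le px p_ge0.
    by rewrite mulr0 mul0r.
  apply: cvgM; last exact: cvg_cst.
  by apply: cvgM; [exact: cvg_dsofttr|exact: cvg_cst].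
have cga x : softtr (en n) (p x) @[n --> \oo] --> p x.
  by apply: cvg_softtr; exact: p_ge0.
have bbe n x : `|dsofttr (en n) (p x) * p x * s i x| <= L * m x.
  apply: le_trans (truncated_be_bound i (en_gt0 n) x) _.
  by rewrite /m mulrA ler_wpM2r ?p_ge0//; exact: (HL i).2.
have bga n x : `|softtr (en n) (p x)| <= L * m x.
  have /andP[g0 g1] := softtr_bounds (en_gt0 n) (p_ge0 x).
  rewrite ger0_norm//; apply: (le_trans g1).
  by rewrite /m mulrA ler_peMl ?p_ge0//; have := norm1_ge0 x => nx; nra.
pose f_ n z := (truncated_u i (en n) z)%:E.
pose g z := ((4 * L ^+ 2 * B) * (m z.1 * m z.2))%:E.
have [|||||_ _] // := @dominated_convergence _ _ _ leb2 setT measurableT f_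
  (fun z : V * V => (stein_ui p0 k i z * (p z.1 * p z.2))%:E) g.
- by move=> n; have /integrableP[] := truncated_u_integrable i (en_gt0 n).
- by have /integrableP[] := stein_ui_integrable i.
- apply: aeW => z _; apply: cvg_EFin; first exact: nearW.
  rewrite (_ : stein_ui p0 k i z * (p z.1 * p z.2) =
    (p z.1 * s i z.1) * (p z.2 * s i z.2) * kernel_pderiv k [::] z +
    (p z.1 * s i z.1) * p z.2 * kernel_pderiv k [:: inr i] z +
    p z.1 * (p z.2 * s i z.2) * kernel_pderiv k [:: inl i] z +
    p z.1 * p z.2 * kernel_pderiv k [:: inl i; inr i] z); last first.
    rewrite /stein_ui /s; move: (score p0 z.1 i 0) (score p0 z.2 i 0) (p z.1) (p z.2).
    move: (kernel_pderiv k [::] z) (kernel_pderiv k [:: inr i] z).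
    move: (kernel_pderiv k [:: inl i] z) (kernel_pderiv k [:: inl i; inr i] z).
    by move=> *; ring.
  rewrite /comp /f_ /truncated_u /=.
  apply: cvgD; last by apply: cvgM; [apply: cvgM; exact: cga|exact: cvg_cst].
  apply: cvgD; last first.
    by apply: cvgM; [apply: cvgM; [exact: cga|exact: cbe]|exact: cvg_cst].
  apply: cvgD; last first.
    by apply: cvgM; [apply: cvgM; [exact: cbe|exact: cga]|exact: cvg_cst].
  by apply: cvgM; [apply: cvgM; exact: cbe|exact: cvg_cst].
- exact: (integrableZl measurableT _ (integrable_prod2 im im)).
- apply: aeW => z n _; rewrite /f_ /g /= lee_fin.
  have L0 : 0 <= L by rewrite (le_trans ler01).
  have tb (u v ka : R) : `|u| <= L * m z.1 -> `|v| <= L * m z.2 -> `|ka| <= B ->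
      `|u * v * ka| <= L ^+ 2 * B * (m z.1 * m z.2).
    move=> Hu Hv Hk; rewrite !normrM.
    rewrite (_ : L ^+ 2 * B * _ = L * m z.1 * (L * m z.2) * B); last by ring.
    by apply: ler_pM => //; apply: ler_pM.
  have T1 := tb _ _ _ (bbe n z.1) (bbe n z.2) (HB [::] isT z).
  have T2 := tb _ _ _ (bbe n z.1) (bga n z.2) (HB [:: inr i] isT z).
  have T3 := tb _ _ _ (bga n z.1) (bbe n z.2) (HB [:: inl i] isT z).
  have T4 := tb _ _ _ (bga n z.1) (bga n z.2) (HB [:: inl i; inr i] isT z).
  rewrite -[_ * s i z.1 * _ * _]subr0 in T1.
  have sum4 (A1 A2 A3 A4 M : R) : `|A1 - 0| <= M -> `|A2| <= M -> `|A3| <= M ->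
      `|A4| <= M -> `|A1 + A2 + A3 + A4| <= 4 * M.
    rewrite subr0 => h1 h2 h3 h4.
    have := @dist_sum4_le _ A1 A2 A3 A4 0 0 0 0 M.
    by rewrite !addr0 !subr0; apply.
  by apply: le_trans (sum4 _ _ _ _ _ T1 T2 T3 T4) _; rewrite !mulrA.
Qed.

Let Q i (z : V * V) : R := h i z.1 * kernel_pderiv k [::] z * h i z.2.

Let mQ i : measurable_fun setT (Q i).
Proof.
apply: measurable_funM; last exact: (measurableT_comp (mh i) measurable_snd).
apply: measurable_funM; first exact: (measurableT_comp (mh i) measurable_fst).
exact: measurable_kernel_pderiv.
Qed.

Let Q_pos i : (0 < \int[leb]_x (h i x ^+ 2)%:E)%E ->
  (0 < \int[leb2]_z (Q i z)%:E)%E.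
Proof.
have E1 : (\int[leb]_x (h i x ^+ 2)%:E = \int[leb]_(x in supp p) (h i x ^+ 2)%:E)%E.
  rewrite [RHS]integral_mkcond; apply: eq_integral => x _; rewrite patchE.
  case: ifPn => //; rewrite notin_setE /supp/= => /negP; rewrite -leNgt => px.
  have px0 : p x = 0 by apply/eqP; rewrite eq_le px p_ge0.
  by rewrite h_off// expr0n.
have E2 : (\int[leb2]_z (Q i z)%:E =
    \int[leb2]_(z in supp p `*` supp p) (h i z.1 * k z.1 z.2 * h i z.2)%:E)%E.
  rewrite [RHS]integral_mkcond; apply: eq_integral => z _; rewrite patchE.
  case: ifPn => //; rewrite notin_setE /supp/= => /not_andP[] /negP;
    rewrite -leNgt => px.
    have px0 : p z.1 = 0 by apply/eqP; rewrite eq_le px p_ge0.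
    by rewrite /Q (h_off i px0) !mul0r.
  have px0 : p z.2 = 0 by apply/eqP; rewrite eq_le px p_ge0.
  by rewrite /Q (h_off i px0) mulr0.
rewrite E1 E2 => h0; apply: k_ispd; first exact: (measurable_funTS (mh i)).
rewrite h0 -E1/=.
have /integrableP[_] := ih2 i.
by under eq_integral do rewrite gee0_abs ?lee_fin ?sqr_ge0//.
Qed.

(** [Q i] need not be absolutely integrable, so its positive and negative parts [Qp], [Qm] are
    separated. The weights [c n] lie in [[0, 1]] and increase with [n], and the truncated identity
    bounds the integral of [c n * Qp] by that of [truncated_u] plus the integral of [Qm]. In the
    limit [IQp] is at most the wanted integral plus [IQm], and positive definiteness says that
    [IQm < IQp]. *)
Lemma stein_ui_pos i : (0 < \int[leb]_x (h i x ^+ 2)%:E)%E ->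
  (0 < \int[leb2]_z (stein_ui p0 k i z * (p z.1 * p z.2))%:E)%E.
Proof.
move=> /Q_pos Q0.
pose Qp z : R := Num.max (Q i z) 0; pose Qm z : R := Num.max (- Q i z) 0.
have Qp0 z : 0 <= Qp z by rewrite /Qp le_max lexx orbT.
have Qm0 z : 0 <= Qm z by rewrite /Qm le_max lexx orbT.
have QE z : Q i z = Qp z - Qm z.
  by rewrite /Qp /Qm; case: leP => q1; case: leP => q2; lra.
have mQp : measurable_fun setT Qp.
  by apply: measurable_maxr; [exact: mQ|exact: measurable_cst].
have mQm : measurable_fun setT Qm.
  apply: measurable_maxr; last exact: measurable_cst.
  by apply: measurableT_comp => //; exact: mQ.
set IQ := (\int[leb2]_z (Q i z)%:E)%E in Q0.
pose IQp := (\int[leb2]_z (Qp z)%:E)%E; pose IQm := (\int[leb2]_z (Qm z)%:E)%E.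
have IQE : IQ = (IQp - IQm)%E.
  rewrite /IQ integralE; congr (_ - _)%E; apply: eq_integral => z _.
    by rewrite funeposE /Qp EFin_max.
  by rewrite funenegE /Qm EFin_max.
have IQm0 : (0 <= IQm)%E by apply: integral_ge0 => z _; rewrite lee_fin.
(* Subtracting [+oo] always gives [-oo] here, so a positive [IQ] excludes an infinite [IQm]. *)
have IQmoo : (IQm < +oo)%E.
  by rewrite ltey; apply/eqP => H; move: Q0; rewrite IQE H addeNy.
have IQmf : IQm \is a fin_num by rewrite ge0_fin_numE.
have lt12 : (IQm < IQp)%E by rewrite -sube_gt0// -IQE.
pose c n (z : V * V) : R := dsofttr (en n) (p z.1) * dsofttr (en n) (p z.2).
have c01 n z : 0 <= c n z <= 1.
  have /andP[a0 a1] := dsofttr_bounds (p z.1) (en_gt0 n).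
  have /andP[b0 b1] := dsofttr_bounds (p z.2) (en_gt0 n).
  by rewrite /c mulr_ge0//= mulr_ile1.
have mc n : measurable_fun setT (c n).
  have md : measurable_fun setT (fun x : V => dsofttr (en n) (p x)).
    exact: (measurableT_comp (measurable_dsofttr (en_gt0 n)) mp).
  apply: measurable_funM; first exact: (measurableT_comp md measurable_fst).
  exact: (measurableT_comp md measurable_snd).
have mcQp n : measurable_fun setT (fun z => (c n z * Qp z)%:E).
  exact: (measurable_EFin (measurable_funM (mc n) mQp)).
have mcQm n : measurable_fun setT (fun z => (c n z * Qm z)%:E).
  exact: (measurable_EFin (measurable_funM (mc n) mQm)).
have iQm : leb2.-integrable setT (EFin \o Qm).
  apply/integrableP; split; first exact: (measurable_EFin mQm).
  by under eq_integral do rewrite /= ger0_norm//.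
have icQm n : leb2.-integrable setT (fun z => (c n z * Qm z)%:E).
  apply: le_integrable iQm => // z _; rewrite /= lee_fin.
  have /andP[c0 c1] := c01 n z.
  by rewrite (ger0_norm (mulr_ge0 c0 (Qm0 z))) (ger0_norm (Qm0 z)) ler_piMl.
have step n : (\int[leb2]_z (c n z * Qp z)%:E <=
    \int[leb2]_z (truncated_u i (en n) z)%:E + IQm)%E.
  rewrite -(truncated_stein_kernel i (en_gt0 n)).
  have E z : (c n z * Qp z)%:E = ((truncated_kernel i (en n) z)%:E + (c n z * Qm z)%:E)%E.
    rewrite -EFinD; congr EFin.
    have -> : truncated_kernel i (en n) z = c n z * Q i z.
      by rewrite /truncated_kernel /c /Q; ring.
    by rewrite QE; ring.
  under eq_integral do rewrite E.
  rewrite integralD//; last exact: (truncated_kernel_integrable i (en_gt0 n)).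
  rewrite leeD2l//; apply: ge0_le_integral => //.
  - by move=> z _; rewrite lee_fin mulr_ge0//; have /andP[] := c01 n z.
  - exact: (measurable_EFin mQm).
  - move=> z _; rewrite lee_fin; have /andP[c0 c1] := c01 n z.
    by rewrite ler_piMl.
have cvgQp : (\int[leb2]_z (c n z * Qp z)%:E)%E @[n --> \oo] --> IQp.
  have := @cvg_monotone_convergence _ _ _ leb2 setT measurableT
    (fun n z => (c n z * Qp z)%:E) mcQp _ _.
  have -> : (\int[leb2]_z (limn (fun n => (c n z * Qp z)%:E)) = IQp)%E.
    apply: eq_integral => z _; apply/cvg_lim => //.
    apply: cvg_EFin; first exact: nearW.
    rewrite /comp/=.
    (* The weights tend to the indicator of the support in each argument, and [Qp] vanishes wherever
       this indicator does. *)
    have QpE : Qp z = (((0 < p z.1)%R%:R * (0 < p z.2)%R%:R) : R) * Qp z.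
      have [p1|p1] := ltP 0 (p z.1); last first.
        have px0 : p z.1 = 0 by apply/eqP; rewrite eq_le p1 p_ge0.
        by rewrite /Qp /Q (h_off i px0) !mul0r maxxx.
      have [p2|p2] := ltP 0 (p z.2); last first.
        have px0 : p z.2 = 0 by apply/eqP; rewrite eq_le p2 p_ge0.
        by rewrite /Qp /Q (h_off i px0) mulr0 maxxx mulr0.
      by rewrite !mul1r.
    rewrite [X in _ --> X]QpE.
    apply: cvgM; last exact: cvg_cst.
    by apply: cvgM; exact: cvg_dsofttr.
  apply.
    by move=> n z _; rewrite lee_fin mulr_ge0//; have /andP[] := c01 n z.
  move=> z _ n1 n2 n12; rewrite lee_fin ler_wpM2r//.
  have e12 : en n2 <= en n1 by rewrite lef_pV2 ?posrE// ler_nat.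
  apply: ler_pM; try exact: dsofttr_le.
    by have /andP[] := dsofttr_bounds (p z.1) (en_gt0 n1).
  by have /andP[] := dsofttr_bounds (p z.2) (en_gt0 n1).
have Sfin : (\int[leb2]_z (stein_ui p0 k i z * (p z.1 * p z.2))%:E)%E \is a fin_num.
  apply: integrable_fin_num => //; exact: stein_ui_integrable.
have cvgS : (\int[leb2]_z (truncated_u i (en n) z)%:E + IQm)%E @[n --> \oo] -->
   (\int[leb2]_z (stein_ui p0 k i z * (p z.1 * p z.2))%:E + IQm)%E.
  apply: cvgeD; [exact: fin_num_adde_defl|exact: cvg_truncated_u|exact: cvg_cst].
have : (IQp <= \int[leb2]_z (stein_ui p0 k i z * (p z.1 * p z.2))%:E + IQm)%E.
  rewrite -(cvg_lim (@ereal_hausdorff R) cvgQp) -(cvg_lim (@ereal_hausdorff R) cvgS).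
  apply: lee_lim; [apply/cvg_ex; eexists; exact: cvgQp|
    apply/cvg_ex; eexists; exact: cvgS|exact: nearW].
move=> /(lt_le_trans lt12).
rewrite -(fineK Sfin) -(fineK IQmf) -EFinD !lte_fin; lra.
Qed.

Let h_ae0 i : (\int[leb]_x (h i x ^+ 2)%:E = 0)%E -> {ae leb, forall x, h i x = 0}.
Proof.
move=> h0.
have : ae_eq leb setT (fun x => (h i x ^+ 2)%:E) (cst 0%E).
  apply/ae_eq_integral_abs => //.
    exact: (measurable_EFin (measurable_funX 2 (mh i))).
  by rewrite -[RHS]h0; apply: eq_integral => x _; rewrite gee0_abs ?lee_fin ?sqr_ge0.
apply: filterS => x /(_ I)/= [] /eqP; rewrite sqrf_eq0 => /eqP; exact.
Qed.

(** If [h i] vanishes almost everywhere, so does the truncated quadratic form; the integral of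
    [truncated_u] is then 0 at every level, and so is its limit. *)
Lemma stein_ui_eq0 i : (\int[leb]_x (h i x ^+ 2)%:E = 0)%E ->
  (\int[leb2]_z (stein_ui p0 k i z * (p z.1 * p z.2))%:E = 0)%E.
Proof.
move=> h0.
have H n : (\int[leb2]_z (truncated_u i (en n) z)%:E = 0)%E.
  rewrite -(truncated_stein_kernel i (en_gt0 n)).
  apply: integral2_ae_eq0; first exact: (truncated_kernel_integrable i (en_gt0 n)).
  apply: filterS (h_ae0 h0) => x hx.
  by apply: integral0_eq => y _; rewrite /truncated_kernel/= -/(h i x) hx mulr0 !mul0r.
have := @cvg_truncated_u i.
under eq_fun do rewrite H.
by move=> /(cvg_lim (@ereal_hausdorff R)) <-; rewrite lim_cst.
Qed.

Hypothesis p_neq_p0 : p <> p0.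

(** A truncation of [rho = p / p0] is used because [rho] itself is not known to be derivable where
    it vanishes. The truncation has derivative [- dsofttr e (rho y) * (h i y / p0 y)], zero almost
    everywhere, so it is invariant under each axis shift, first almost everywhere and then
    everywhere by continuity. The argument runs on the whole space, so the support of [p] may be
    disconnected. *)
Lemma exists_score_diff : exists i, (0 < \int[leb]_x (h i x ^+ 2)%:E)%E.
Proof.
apply: contrapT => /forallNP H; apply: p_neq_p0.
have h0 i : {ae leb, forall x, h i x = 0}.
  apply: h_ae0; apply/eqP; rewrite eq_le; apply/andP; split.
    by rewrite leNgt; apply/negP; exact: H.
  by apply: integral_ge0 => x _; rewrite lee_fin sqr_ge0.
pose rho x := p x / p0 x.
have rho0 x : 0 <= rho x by rewrite divr_ge0 ?p_ge0// ltW.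
have crho : continuous rho.
  move=> x; have FF : Filter (nbhs x) := @nbhs_filter V x.
  have c1 : (fun y : V => p y) @ x --> p x := @p_cont x.
  have c2 : (fun y : V => p0 y) @ x --> p0 x := @p0_cont x.
  have c3 : (fun y : V => (p0 y)^-1) @ x --> (p0 x)^-1.
    by apply: cvgV; [exact: lt0r_neq0|exact: c2].
  have c4 := cvgM c1 c3.
  exact: c4.
have rhop x : 0 < rho x -> 0 < p x by rewrite /rho pmulr_lgt0// invr_gt0.
have rhoE x : 0 < rho x -> rho x = expR (ln (p x) - ln (p0 x)).
  by move=> /rhop px; rewrite expRD expRN !lnK ?posrE// p0_gt0.
have drho i x : 0 < rho x ->
    is_derive x (evec R i) (fun y => ln (p y) - ln (p0 y)) (sp i x - s i x).
  move=> /rhop px; have d1 := is_derive_ln_p i px; have d2 := is_derive_ln_p0 i x.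
  exact: is_deriveB.
have cW e : 0 < e -> continuous (softtr e \o rho).
  move=> e0 x; apply: continuous_comp; first exact: crho.
  by apply: derivable1_continuous => t; case: (is_derive_softtr t e0).
have shift_ge0 e i t x : 0 < e -> 0 <= t ->
    softtr e (rho (x + t *: evec R i)) = softtr e (rho x).
  move=> e0 t0.
  pose W : V -> R := softtr e \o rho.
  have dW := is_derive_softtr_exp e0 crho rho0 rhoE (drho i).
  have dW' y : derivable W y (evec R i) by case: (dW y).
  have mW : measurable_fun setT W by apply: continuous_measurable_mx; exact: cW.
  have DW y : 'D_(evec R i) W y = - dsofttr e (rho y) * (h i y / p0 y).
    by rewrite derive_val /h /rho; ring.
  have D0 : (\int[leb]_y `|('D_(evec R i) W y)%:E| = 0)%E.
    rewrite -[RHS](integral0 leb setT); apply: ae_eq_integral => //.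
      apply: measurableT_comp => //; apply: measurable_EFin.
      exact: measurable_derive_cV.
    by apply: filterS (h0 i) => y hy _; rewrite DW hy mul0r mulr0 abse0.
  have intD : leb.-integrable setT (EFin \o 'D_(evec R i) W).
    apply/integrableP; split; first by apply: measurable_EFin; exact: measurable_derive_cV.
    by rewrite D0.
  have := derive_ae0_shift mW dW' intD t0 D0.
  have cWt : continuous (fun y : V => W (y + t *: evec R i)).
    move=> y; have FF : Filter (nbhs y) := @nbhs_filter V y.
    apply: (@continuous_comp _ _ _ (fun y : V => y + t *: evec R i) W).
      exact: (cvgD cvg_id (cvg_cst _)).
    exact: cW.
  move=> /(ae_eq_continuous cWt (cW e e0)); exact.
have shift e i t x : 0 < e -> softtr e (rho (x + t *: evec R i)) = softtr e (rho x).
  move=> e0; have [t0|/ltW t0] := leP 0 t; first exact: shift_ge0.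
  have := @shift_ge0 e i (- t) (x + t *: evec R i) e0.
  by rewrite oppr_ge0 => /(_ t0) <-; rewrite -addrA -scalerDl subrr scale0r addr0.
have Wcst e x : 0 < e -> softtr e (rho x) = softtr e (rho 0).
  move=> e0; apply/eqP; rewrite -subr_eq0 -normr_le0.
  pose W : V -> R := softtr e \o rho.
  have := @coord_lipschitz R d W 0 x (fun=> 0) _.
  rewrite big1; last by move=> i _; rewrite mul0r.
  apply=> i z _.
  have dWz : is_derive z (evec R i) W 0.
    apply/is_derive_lineP.
    rewrite (_ : (fun t => _) = cst (W z)); first exact: is_derive_cst.
    by apply/funext => t; exact: (shift e i t z e0).
  by split; [case: dWz|rewrite derive_val normr0].
have rle x y : rho x <= rho y.
  rewrite leNgt; apply/negP => lt.
  (* At a level strictly between two values of [rho], the truncation is positive at the larger value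
     and 0 at the smaller. *)
  pose e := (rho x + rho y) / 2.
  have e0 : 0 < e by have := rho0 y; rewrite /e; lra.
  have ex : e < rho x by rewrite /e; lra.
  have ey : rho y <= e by rewrite /e; lra.
  have := Wcst e x e0; rewrite -(Wcst e y e0) /softtr ex ltNge ey/=.
  apply/eqP; rewrite gt_eqF// divr_gt0 ?exprn_gt0 ?subr_gt0//.
  exact: lt_trans ex.
have rcst x : p x = rho 0 * p0 x.
  have -> : rho 0 = rho x by apply/eqP; rewrite eq_le !rle.
  by rewrite /rho divfK// gt_eqF.
have [_ _ p1] := p_dens; have [_ mp0 p01] := p0_dens.
have r1 : rho 0 = 1.
  move: p1; under eq_integral do rewrite rcst EFinM.
  rewrite ge0_integralZl_EFin//; last 2 first.
    by move=> x _; rewrite lee_fin ltW.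
    exact: measurable_EFin.
  by rewrite p01 mule1 => -[].
by apply/funext => x; rewrite rcst r1 mul1r.
Qed.

(** Every coordinate contributes a positive amount or 0, according to whether its [h] vanishes
    almost everywhere, and by [exists_score_diff] some coordinate contributes a positive one. *)
Theorem stein_u_positive :
  leb2.-integrable setT (fun z : V * V => (stein_u p0 k z.1 z.2 * (p z.1 * p z.2))%:E) /\
  (0 < \int[leb2]_z (stein_u p0 k z.1 z.2 * (p z.1 * p z.2))%:E)%E.
Proof.
have E (z : V * V) : (stein_u p0 k z.1 z.2 * (p z.1 * p z.2))%:E =
   (\sum_i (stein_ui p0 k i z * (p z.1 * p z.2))%:E)%E.
  by case: z => x y; rewrite sumEFin stein_uE mulr_suml.
have iS := @stein_ui_integrable.
split.
  apply: eq_integrable (integrable_sum measurableT (index_enum _) (fun i _ => iS i)) => //.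
  by move=> z _; rewrite E.
under eq_integral do rewrite E.
rewrite integral_sum//.
have [i hi] := exists_score_diff.
rewrite (bigD1 i)//=; apply: (lt_le_trans (stein_ui_pos hi)).
rewrite leeDl//; apply: sume_ge0 => j _.
have : (0 <= \int[leb]_x (h j x ^+ 2)%:E)%E.
  by apply: integral_ge0 => x _; rewrite lee_fin sqr_ge0.
rewrite le_eqVlt => /orP[/eqP/esym hj|hj]; last exact/ltW/stein_ui_pos.
by rewrite stein_ui_eq0.
Qed.

End SteinPositivity.

(** * Laws, densities and independence *)

Section Law.
Context d1 d2 (T1 : measurableType d1) (T2 : measurableType d2) (R : realType).
Variables (P : {measure set T1 -> \bar R}) (mu : {measure set T2 -> \bar R}).
Variables (X : T1 -> T2) (mX : measurable_fun setT X).
Hypothesis law : forall B, measurable B -> P (X @^-1` B) = mu B.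

Lemma ge0_integral_law (f : T2 -> \bar R) : measurable_fun setT f ->
  (forall x, 0 <= f x)%E -> (\int[P]_w f (X w) = \int[mu]_x f x)%E.
Proof.
move=> mf f0.
pose X' : {mfun T1 >-> T2} := HB.pack X (isMeasurableFun.Build _ _ _ _ _ mX).
transitivity (\int[pushforward P X']_x f x)%E.
  by rewrite ge0_integral_pushforward.
by apply: eq_measure_integral => A mA _; exact: law.
Qed.

Lemma integral_law (f : T2 -> \bar R) : measurable_fun setT f ->
  (\int[P]_w f (X w) = \int[mu]_x f x)%E.
Proof.
move=> mf; rewrite integralE [RHS]integralE.
rewrite -(ge0_integral_law (measurable_funepos mf))//.
rewrite -(ge0_integral_law (measurable_funeneg mf))//.
by congr (_ - _)%E; apply: eq_integral => w _; rewrite ?funeposE ?funenegE.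
Qed.

End Law.

Section Density.
Context d (T : measurableType d) (R : realType).
Variables (mu : probability T R) (nu : {sigma_finite_measure set T -> \bar R}).
Variables (phi : T -> R) (mphi : measurable_fun setT phi).
Hypothesis phi0 : forall x, 0 <= phi x.
Hypothesis density : forall B, measurable B ->
  (mu B = \int[nu]_(x in B) (phi x)%:E)%E.

(** [phi] and the Radon-Nikodym derivative of [mu] have the same integral over every measurable set,
    hence agree [nu]-almost everywhere. *)
Lemma ge0_integral_density (f : T -> \bar R) : measurable_fun setT f ->
  (forall x, 0 <= f x)%E ->
  (\int[mu]_x f x = \int[nu]_x (f x * (phi x)%:E))%E.
Proof.
move=> mf f0.
have mphiE : measurable_fun setT (EFin \o phi) by exact/measurable_EFinP.
have dom : mu `<< nu.
  apply/null_content_dominatesP => A mA nuA0.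
  rewrite density//; apply/eqP; rewrite eq_le; apply/andP; split; last first.
    by apply: integral_ge0 => x _; rewrite lee_fin.
  rewrite null_set_integral//; exact: measurable_funTS.
rewrite -(Radon_Nikodym_SigmaFinite.change_of_variables dom f0 measurableT mf).
have mRN := measurable_int _ (Radon_Nikodym_SigmaFinite.f_integrable dom).
apply: ae_eq_integral => //; [exact: emeasurable_funM|exact: emeasurable_funM|].
apply: ae_eqe_mul2l; apply: integral_ae_eq => //.
  exact: Radon_Nikodym_SigmaFinite.f_integrable.
move=> E _ mE; transitivity (mu E); last exact: density.
by apply/esym; exact: Radon_Nikodym_SigmaFinite.f_integral.
Qed.

End Density.

Section DensityPair.
Context d (T : measurableType d) (R : realType).
Variables (mu : probability T R) (nu : {sigma_finite_measure set T -> \bar R}).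
Variables (phi : T -> R) (mphi : measurable_fun setT phi).
Hypothesis phi0 : forall x, 0 <= phi x.
Hypothesis density : forall B, measurable B ->
  (mu B = \int[nu]_(x in B) (phi x)%:E)%E.

Lemma ge0_integral_density2 (f : T * T -> \bar R) : measurable_fun setT f ->
  (forall x, 0 <= f x)%E ->
  (\int[(mu \x mu)%E]_z f z =
   \int[(nu \x nu)%E]_z (f z * (phi z.1 * phi z.2)%:E))%E.
Proof.
move=> mf f0.
have mg : measurable_fun setT
    (fun z : T * T => f z * (phi z.1 * phi z.2)%:E)%E.
  apply: emeasurable_funM => //; apply/measurable_EFinP.
  by apply: measurable_funM; apply: measurableT_comp.
rewrite (fubini_tonelli1 _ mf)//.
rewrite [RHS](fubini_tonelli1 _ mg); last first.
  by move=> z; rewrite mule_ge0// lee_fin mulr_ge0.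
have mfx x : measurable_fun setT (fun y => f (x, y)) by exact: measurableT_comp.
rewrite (ge0_integral_density mphi phi0 density); last 2 first.
- exact: measurable_fun_fubini_tonelli_F.
- by move=> x; apply: integral_ge0.
apply: eq_integral => x _.
rewrite /fubini_F (ge0_integral_density mphi phi0 density)//.
rewrite muleC -ge0_integralZl//.
- by apply: eq_integral => y _/=; rewrite EFinM muleCA.
- by apply: emeasurable_funM => //; exact/measurable_EFinP.
- by move=> y _; rewrite mule_ge0// lee_fin.
- by rewrite lee_fin.
Qed.

Lemma integral_density2 (f : T * T -> R) : measurable_fun setT f ->
  (\int[(mu \x mu)%E]_z (f z)%:E =
   \int[(nu \x nu)%E]_z (f z * (phi z.1 * phi z.2))%:E)%E.
Proof.
move=> mf.
have mf' : measurable_fun setT (EFin \o f) by exact/measurable_EFinP.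
rewrite integralE [RHS]integralE.
rewrite (ge0_integral_density2 (measurable_funepos mf'))//.
rewrite (ge0_integral_density2 (measurable_funeneg mf'))//.
congr (_ - _)%E; apply: eq_integral => z _.
  rewrite [RHS](_ : _ = ((fun z => (f z)%:E)^\+ z * (phi z.1 * phi z.2)%:E)%E)//.
  by rewrite !funeposE maxe_pMl ?lee_fin ?mulr_ge0// mul0e.
by rewrite !funenegE maxe_pMl ?lee_fin ?mulr_ge0// mul0e mulNe.
Qed.

End DensityPair.

Section Independence.
Context d (T : measurableType d) d1 (T1 : measurableType d1).
Context d2 (T2 : measurableType d2) (R : realType).
Variables (P : probability T R) (mu1 : probability T1 R) (mu2 : probability T2 R).
Variables (X : T -> T1) (Y : T -> T2) (E : set T).
Hypothesis mX : measurable_fun setT X.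
Hypothesis mY : measurable_fun setT Y.
Hypothesis mE : measurable E.
Hypothesis indep : forall A B, measurable A -> measurable B ->
  P (X @^-1` A `&` Y @^-1` B `&` E) = (mu1 A * mu2 B * P E)%E.

(** Uniqueness of measures from rectangles, for the restriction of [P] to [E]. The event [E] leaves
    room for further coordinates: the full space gives the law of a pair, an event about another
    pair gives the independence of two pairs. *)
Lemma product_law_event (C : set (T1 * T2)) : measurable C ->
  P ((fun w => (X w, Y w)) @^-1` C `&` E) = ((mu1 \x mu2)%E C * P E)%E.
Proof.
move=> mC.
have mXY : measurable_fun setT (fun w => (X w, Y w)) by exact: measurable_fun_pair.
have pE0 : 0 <= fine (P E) by rewrite fine_ge0.
have PE : P E = (fine (P E))%:E by rewrite fineK// fin_num_measure.
pose XY : {mfun T >-> (T1 * T2)%type} :=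
  HB.pack (fun w => (X w, Y w)) (isMeasurableFun.Build _ _ _ _ _ mXY).
pose mr : {measure set T -> \bar R} := mrestr P mE.
pose m1 : {measure set (T1 * T2) -> \bar R} :=
  measure_function_pushforward__canonical__measure_function_Measure mr mXY.
pose m2 : {measure set (T1 * T2) -> \bar R} :=
  mscale (NngNum pE0) (mu1 \x mu2)%E.
pose G := [set A `*` B | A in (@measurable _ T1) & B in (@measurable _ T2)].
suff : m1 C = m2 C by rewrite /m1 /m2/= /pushforward /mrestr /mscale/= -PE muleC.
apply: (measure_unique G (fun=> setT)) => //.
- exact: measurable_prod_measurableType.
- move=> _ _ [A1 mA1 [B1 mB1 <-]] [A2 mA2 [B2 mB2 <-]].
  rewrite -setXI; exists (A1 `&` A2); first exact: measurableI.
  by exists (B1 `&` B2) => //; exact: measurableI.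
- by move=> _; exists setT => //; exists setT => //; rewrite setXTT.
- by rewrite bigcup_const//; exists 0%N.
- move=> _ [A mA [B mB <-]].
  rewrite /m1 /m2/= /pushforward /mrestr /mscale/= product_measure1E//.
  by rewrite -PE muleC; exact: indep.
- by move=> _; rewrite /m1/= /pushforward /mrestr/= preimage_setT setTI PE ltry.
Qed.

End Independence.

(** * Second moment of a degenerate U-statistic *)

Lemma mutually_independent_nat (R : realType) d (T : measurableType d)
    (P : probability T R) d' (T' : measurableType d') (X : int -> T -> T') :
  mutually_independent P X -> mutually_independent P (fun n : nat => X n%:Z).
Proof.
move=> H s B us mB; rewrite -(big_map Posz xpredT (fun z => P (X z @^-1` B `|z|%N))).
rewrite -(H _ (fun z => B `|z|%N))//; last by rewrite map_inj_uniq// => ? ? [].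
congr (P _); apply/seteqP; split => w /= Hw.
  by move=> _ /mapP[i si ->]; exact: Hw.
by move=> i si; have := Hw i%:Z; rewrite absz_nat; apply; exact: map_f.
Qed.

Lemma integral_sum_le (R : realType) d (T : measurableType d)
    (P : {measure set T -> \bar R}) (J : eqType) (s : seq J) (f : J -> T -> R)
    (b : J -> R) :
  (forall i, i \in s -> P.-integrable setT (EFin \o f i) /\
     (\int[P]_w (f i w)%:E <= (b i)%:E)%E) ->
  P.-integrable setT (fun w => (\sum_(i <- s) f i w)%:E) /\
  (\int[P]_w (\sum_(i <- s) f i w)%:E <= (\sum_(i <- s) b i)%:E)%E.
Proof.
elim: s => [|j s IH] H.
  have E : (fun w => (\sum_(i <- [::]) f i w)%:E) = cst 0%E.
    by apply/funext => w; rewrite big_nil.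
  by rewrite E big_nil integral0; split=> //; exact: integrable0.
have [ij lj] := H j (mem_head _ _).
have [|iS lS] := IH.
  by move=> i si; apply: H; rewrite inE si orbT.
have E : (fun w => (\sum_(i <- j :: s) f i w)%:E) =
    (fun w => (f j w)%:E + (\sum_(i <- s) f i w)%:E)%E.
  by apply/funext => w; rewrite big_cons EFinD.
rewrite E; split; first exact: integrableD.
by rewrite integralD// big_cons EFinD leeD.
Qed.

Section UStatistic.
Context (R : realType) d (T : measurableType d) (P : probability T R).
Context d' (T' : measurableType d') (mu : probability T' R).
Variables (J : eqType) (X : J -> T -> T') (r : rel J).
Hypothesis mX : forall j, measurable_fun setT (X j).
Hypothesis law : forall j B, measurable B -> P (X j @^-1` B) = mu B.
Hypothesis indep : mutually_independent P X.
Hypothesis irr_r : irreflexive r.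

Lemma indep2 i j A B : i != j -> measurable A -> measurable B ->
  P (X i @^-1` A `&` X j @^-1` B) = (mu A * mu B)%E.
Proof.
move=> ij mA mB.
have := @indep [:: i; j] (fun x => if x == i then A else B).
rewrite /= inE ij => /(_ isT) H.
transitivity (P [set w | forall x, x \in [:: i; j] ->
    (if x == i then A else B) (X x w)]).
  congr (P _); apply/seteqP; split => w /=.
    move=> [wA wB] x; rewrite !inE => /orP[] /eqP ->; first by rewrite eqxx.
    by rewrite eq_sym (negbTE ij).
  move=> H'; split.
    by have := H' i; rewrite !inE eqxx; exact.
  by have := H' j; rewrite !inE eqxx orbT eq_sym (negbTE ij); exact.
rewrite H; last by move=> x; case: ifP.
by rewrite !big_cons big_nil mule1 eqxx eq_sym (negbTE ij) !law.
Qed.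

Lemma indep4 i j k l A B C D : uniq [:: i; j; k; l] ->
  measurable A -> measurable B -> measurable C -> measurable D ->
  P (X i @^-1` A `&` X j @^-1` B `&` (X k @^-1` C `&` X l @^-1` D)) =
  (mu A * mu B * (mu C * mu D))%E.
Proof.
move=> us mA mB mC mD.
pose F x := if x == i then A else if x == j then B else if x == k then C else D.
have := @indep [:: i; j; k; l] F us.
move: us; rewrite /= !inE !negb_or => /and4P[/and3P[ij ik il] /andP[jk jl] kl _].
have [Fi Fj Fk Fl] : [/\ F i = A, F j = B, F k = C & F l = D].
  rewrite /F eqxx (eq_sym j i) (negbTE ij) eqxx (eq_sym k i) (negbTE ik).
  rewrite (eq_sym k j) (negbTE jk) eqxx (eq_sym l i) (negbTE il).
  by rewrite (eq_sym l j) (negbTE jl) (eq_sym l k) (negbTE kl).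
move=> H.
transitivity (P [set w | forall x, x \in [:: i; j; k; l] -> F x (X x w)]).
  congr (P _); apply/seteqP; split => w /=.
    move=> [[wA wB] [wC wD]] x; rewrite !inE.
    by move=> /or4P[] /eqP ->; rewrite ?Fi ?Fj ?Fk ?Fl.
  move=> H'; rewrite -Fi -Fj -Fk -Fl.
  by do 2 split; apply: H'; rewrite !inE eqxx ?orbT.
rewrite H; last by move=> x; rewrite /F; do 3 (case: ifP => // _).
by rewrite !big_cons big_nil mule1 Fi Fj Fk Fl !law// muleA.
Qed.

Let mu2 : probability _ R := (mu \x mu)%E.

Let mX2 i j : measurable_fun setT (fun w => (X i w, X j w)).
Proof. exact: measurable_fun_pair. Qed.

Let preimage_meas i A : measurable A -> measurable (X i @^-1` A).
Proof. by move=> mA; rewrite -[X in measurable X]setTI; exact: mX. Qed.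

Lemma pair_law i j C : i != j -> measurable C ->
  P ((fun w => (X i w, X j w)) @^-1` C) = (mu \x mu)%E C.
Proof.
move=> ij mC.
have := @product_law_event _ _ _ _ _ _ _ P mu mu (X i) (X j) setT (mX i) (mX j)
  measurableT _ C mC.
rewrite setIT probability_setT mule1; apply => A B mA mB.
by rewrite setIT mule1; exact: indep2.
Qed.

(** [product_law_event] is used twice on a rectangle [C1] times [C2]: for the pair [k], [l] with the
    event that the pair [i], [j] is in [C1], then for [i], [j] with [k], [l] in a rectangle. What
    remains is the independence of four variables. *)
Lemma pair_pair_law i j k l C : uniq [:: i; j; k; l] -> measurable C ->
  P ((fun w => ((X i w, X j w), (X k w, X l w))) @^-1` C) =
  (mu2 \x mu2)%E C.
Proof.
move=> us mC.
have [ij kl] : i != j /\ k != l.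
  by move: us; rewrite /= !inE !negb_or => /and4P[/andP[]].
have := @product_law_event _ _ _ _ _ _ _ P mu2 mu2
  (fun w => (X i w, X j w)) (fun w => (X k w, X l w)) setT (mX2 i j) (mX2 k l)
  measurableT _ C mC.
rewrite setIT probability_setT mule1; apply => C1 C2 mC1 mC2.
rewrite setIT mule1.
have mP1 : measurable ((fun w => (X i w, X j w)) @^-1` C1).
  by rewrite -[X in measurable X]setTI; exact: mX2.
rewrite setIC.
rewrite (product_law_event (mX k) (mX l) mP1 (mu1 := mu) (mu2 := mu))//.
  by rewrite (pair_law ij mC1) muleC.
move=> A B mA mB.
rewrite setIC.
rewrite (product_law_event (mX i) (mX j)
  (measurableI _ _ (preimage_meas k mA) (preimage_meas l mB)) (mu1 := mu) (mu2 := mu))//.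
  by rewrite (pair_law ij mC1) (indep2 kl)// muleC.
by move=> A' B' mA' mB'; rewrite (indep4 us)// (indep2 kl).
Qed.

Variable v : T' * T' -> R.
Hypothesis mv : measurable_fun setT v.
Hypothesis iv : (mu \x mu)%E.-integrable setT (EFin \o v).
Hypothesis v0 : (\int[(mu \x mu)%E]_z (v z)%:E = 0)%E.
Variable s2 : R.
Hypothesis s2_ge0 : 0 <= s2.
Hypothesis v2 : (\int[(mu \x mu)%E]_z (v z ^+ 2)%:E <= s2%:E)%E.

Let V i j w : R := if r i j then v (X i w, X j w) else 0.

Let mV i j : measurable_fun setT (V i j).
Proof.
rewrite /V; case: (r i j); last exact: measurable_cst.
exact: measurableT_comp mv (mX2 i j).
Qed.

Let r_neq i j : r i j -> i != j.
Proof. by apply: contraTneq => ->; rewrite irr_r. Qed.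

Let V2 i j : P.-integrable setT (fun w => (V i j w ^+ 2)%:E) /\
  (\int[P]_w (V i j w ^+ 2)%:E <= s2%:E)%E.
Proof.
have mV2 : measurable_fun setT (fun w => (V i j w ^+ 2)%:E).
  by apply: measurable_EFin; exact: measurable_funX (mV i j).
have le : (\int[P]_w (V i j w ^+ 2)%:E <= s2%:E)%E.
  rewrite /V; case rij : (r i j); last first.
    rewrite (eq_integral (fun=> 0%E)) ?integral0 ?lee_fin//.
    by move=> w _; rewrite expr0n.
  rewrite (ge0_integral_law (mX2 i j) (fun C mC => pair_law (r_neq rij) mC)
    (f := fun z => (v z ^+ 2)%:E))//.
    by apply/measurable_EFinP; exact: measurable_funX.
  by move=> z; rewrite lee_fin sqr_ge0.
split=> //; apply/integrableP; split=> //.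
under eq_integral do rewrite gee0_abs ?lee_fin ?sqr_ge0//.
exact: le_lt_trans le (ltry _).
Qed.

Let iVV i j k l : P.-integrable setT (fun w => (V i j w * V k l w)%:E).
Proof.
have mVV : measurable_fun setT (fun w => (V i j w * V k l w)%:E).
  by apply: measurable_EFin; exact: measurable_funM (mV i j) (mV k l).
apply: le_integrable (integrableD measurableT (V2 i j).1 (V2 k l).1) => //.
move=> w _; rewrite /= lee_fin [leRHS]ger0_norm ?addr_ge0 ?sqr_ge0//.
rewrite ler_norml; apply/andP; split; nra.
Qed.

Let VV_le i j k l : (\int[P]_w (V i j w * V k l w)%:E <= s2%:E)%E.
Proof.
have [i1 l1] := V2 i j; have [i2 l2] := V2 k l.
have H : (\int[P]_w (V i j w * V k l w)%:E <=
    \int[P]_w (2^-1%:E * ((V i j w ^+ 2)%:E + (V k l w ^+ 2)%:E)))%E.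
  apply: (le_integral measurableT (iVV i j k l)).
    by apply: integrableZl => //; exact: integrableD.
  move=> w _; rewrite -EFinD -EFinM lee_fin.
  by have := sqr_ge0 (V i j w - V k l w); nra.
apply: le_trans H _.
rewrite integralZl//; last exact: integrableD.
rewrite integralD//.
apply: (@le_trans _ _ (2^-1%:E * (s2%:E + s2%:E))%E).
  by apply: lee_wpmul2l; [rewrite lee_fin|exact: leeD].
by rewrite -EFinD -EFinM lee_fin; lra.
Qed.

Let VV_eq0 i j k l : [&& i != k, i != l, j != k & j != l] ->
  (\int[P]_w (V i j w * V k l w)%:E <= 0)%E.
Proof.
move=> /and4P[ik il jk jl]; rewrite /V.
case rij : (r i j); last first.
  by under eq_integral do rewrite mul0r; rewrite integral0.
case rkl : (r k l); last first.
  by under eq_integral do rewrite mulr0; rewrite integral0.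
have us : uniq [:: i; j; k; l].
  by rewrite /= !inE !negb_or (r_neq rij) (r_neq rkl) ik il jk jl.
have mg : measurable_fun setT (fun z : (T' * T') * (T' * T') => (v z.1 * v z.2)%:E).
  by apply/measurable_EFinP; apply: measurable_funM; exact: measurableT_comp.
have mX4 : measurable_fun setT (fun w => ((X i w, X j w), (X k w, X l w))).
  exact: measurable_fun_pair.
rewrite (integral_law (mu := (mu2 \x mu2)%E) mX4 (fun C mC => pair_pair_law us mC) mg).
rewrite -integral12_prod_meas1; last exact: integrable_prod2.
rewrite /fubini_F/=.
under eq_integral.
  move=> z _; under eq_integral do rewrite EFinM.
  rewrite integralZl// v0 mule0; over.
by rewrite integral0.
Qed.

Lemma ustat_second_moment (s : seq J) : uniq s ->
  (\int[P]_w ((\sum_(i <- s) \sum_(j <- s | r i j) v (X i w, X j w)) ^+ 2)%:E <=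
   (4 * (size s)%:R ^+ 3 * s2)%:E)%E.
Proof.
move=> us.
pose m := size s.
have cnt i : (\sum_(k <- s) (i == k) <= 1)%N.
  rewrite (eq_bigr (fun k => if k == i then 1%N else 0%N)); last first.
    by move=> k _; rewrite eq_sym; case: (k == i).
  by rewrite -big_mkcond sum1_count count_uniq_mem// leq_b1.
(* The number of coincidences between the two pairs is at least 1 as soon as they meet, and it sums
   more easily than the indicator of meeting: each of its four terms fixes one index. *)
pose c (i j k l : J) : nat := ((i == k) + (j == k) + ((i == l) + (j == l)))%N.
have H4 i j k l : (\int[P]_w (V i j w * V k l w)%:E <= (s2 * (c i j k l)%:R)%:E)%E.
  have [dis|ndis] := boolP [&& i != k, i != l, j != k & j != l].
    by apply: le_trans (VV_eq0 dis) _; rewrite lee_fin mulr_ge0.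
  apply: le_trans (VV_le i j k l) _; rewrite lee_fin -[leLHS]mulr1 ler_wpM2l//.
  rewrite ler1n /c; move: ndis.
  by case: (i == k); case: (i == l); case: (j == k); case: (j == l).
have S1 i j k := integral_sum_le (s := s) (fun l _ => conj (iVV i j k l) (H4 i j k l)).
have S2 i j := integral_sum_le (s := s) (fun k _ => S1 i j k).
have S3 i := integral_sum_le (s := s) (fun j _ => S2 i j).
have [_ S4] := integral_sum_le (s := s) (fun i _ => S3 i).
have E w : (\sum_(i <- s) \sum_(j <- s | r i j) v (X i w, X j w)) ^+ 2 =
    \sum_(i <- s) \sum_(j <- s) \sum_(k <- s) \sum_(l <- s) V i j w * V k l w.
  have -> : \sum_(i <- s) \sum_(j <- s | r i j) v (X i w, X j w) =
      \sum_(i <- s) \sum_(j <- s) V i j w.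
    by apply: eq_bigr => i _; rewrite big_mkcond.
  rewrite expr2 mulr_suml; apply: eq_bigr => i _.
  rewrite mulr_suml; apply: eq_bigr => j _.
  rewrite mulr_sumr; apply: eq_bigr => k _.
  by rewrite mulr_sumr.
under eq_integral do rewrite E.
apply: le_trans S4 _; rewrite lee_fin.
have -> : \sum_(i <- s) \sum_(j <- s) \sum_(k <- s) \sum_(l <- s) s2 * (c i j k l)%:R =
    (\sum_(i <- s) \sum_(j <- s) \sum_(k <- s) \sum_(l <- s) c i j k l)%:R * s2 :> R.
  rewrite natr_sum mulr_suml; apply: eq_bigr => i _.
  rewrite natr_sum mulr_suml; apply: eq_bigr => j _.
  rewrite natr_sum mulr_suml; apply: eq_bigr => k _.
  by rewrite natr_sum mulr_suml; apply: eq_bigr => l _; rewrite mulrC.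
rewrite ler_wpM2r// -natrX -natrM ler_nat.
have K2 i j : (\sum_(k <- s) \sum_(l <- s) c i j k l <= 4 * m)%N.
  have -> : (\sum_(k <- s) \sum_(l <- s) c i j k l =
      (\sum_(k <- s) (i == k) + \sum_(k <- s) (j == k)) * m +
      (\sum_(k <- s) (i == k) + \sum_(k <- s) (j == k)) * m)%N.
    transitivity (\sum_(k <- s) (((i == k) + (j == k)) * m +
        (\sum_(l <- s) (i == l) + \sum_(l <- s) (j == l))))%N.
      apply: eq_bigr => k _; rewrite /c !big_split/=; congr addn.
      by rewrite !big_const_seq !count_predT !iter_addn_0 mulnDl.
    rewrite big_split/= -big_distrl/= big_split/=; congr addn.
    by rewrite big_const_seq count_predT iter_addn_0.
  by have := cnt i; have := cnt j; move: (\sum_(k <- s) _)%N (\sum_(k <- s) _)%N => a b; nia.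
apply: (@leq_trans (\sum_(i <- s) \sum_(j <- s) 4 * m)%N).
  by apply: leq_sum => i _; apply: leq_sum => j _; exact: K2.
by rewrite !big_const_seq !count_predT !iter_addn_0 /m; nia.
Qed.

End UStatistic.

(** * Stationarity and perturbation bounds *)

Section PathMeasurability.
Variables (I : Type) (d : measure_display) (T : measurableType d).

Lemma measurable_path_coord (i : I) :
  measurable_fun setT (fun y : paths I T => (y : I -> T) i).
Proof.
move=> _ B mB; rewrite setTI; apply: sub_sigma_algebra.
by exists i, B.
Qed.

Lemma measurable_fun_paths d' (S : measurableType d') (f : S -> paths I T) :
  (forall i, measurable_fun setT (fun x => (f x : I -> T) i)) ->
  measurable_fun setT f.
Proof.
move=> mf.
apply: (@measurability _ _ S (paths I T) setT f (@path_cylinders I d T)) => //.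
move=> _ [_ [i [B mB ->]] <-].
exact: mf.
Qed.

End PathMeasurability.

Section Stationarity.
Variables (R : realType) (d : nat) (dO : measure_display) (Omega : measurableType dO).
Variables (P : probability Omega R) (Y : int -> Omega -> 'cV[R]_d).
Hypothesis Y_meas : forall t, measurable_fun setT (Y t).

Lemma measurable_info t : measurable_fun setT (info Y t).
Proof. by apply: measurable_fun_paths => s; exact: Y_meas. Qed.

Hypothesis Y_stationary : strictly_stationary P Y.

Lemma stationary_ge0_integral (F : paths int 'cV[R]_d -> \bar R) :
  measurable_fun setT F -> (forall y, 0 <= F y)%E ->
  (\int[P]_w F (fun t => Y (t + 1) w) = \int[P]_w F (fun t => Y t w))%E.
Proof.
move=> mF F0.
have m0 : measurable_fun setT (fun w => (fun t => Y t w) : paths int 'cV[R]_d).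
  exact: measurable_fun_paths.
have m1 : measurable_fun setT (fun w => (fun t => Y (t + 1) w) : paths int 'cV[R]_d).
  by apply: measurable_fun_paths => i; exact: Y_meas.
pose mu : {measure set (paths int 'cV[R]_d) -> \bar R} :=
  measure_function_pushforward__canonical__measure_function_Measure P m0.
rewrite (ge0_integral_law (mu := mu) m1 (fun B mB => Y_stationary mB) mF F0).
by rewrite (ge0_integral_law (mu := mu) m0 (fun B mB => erefl) mF F0).
Qed.

(** [Y t] and the information before it form a measurable function [Phi] of the whole path; shifting
    the path by one replaces [t] by [t + 1]. *)
Lemma stationary_info_integral (F : 'cV[R]_d * infoset R d -> \bar R) (t : nat) :
  measurable_fun setT F -> (forall z, 0 <= F z)%E ->
  (\int[P]_w F (Y t%:Z w, info Y (t%:Z - 1) w) =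
   \int[P]_w F (Y 0 w, info Y (0 - 1) w))%E.
Proof.
move=> mF F0; elim: t => // t <-.
pose Phi (y : paths int 'cV[R]_d) : 'cV[R]_d * infoset R d :=
  ((y : int -> 'cV[R]_d) t%:Z, fun s : nat => (y : int -> 'cV[R]_d) (t%:Z - 1 - s%:Z)).
have mPhi : measurable_fun setT Phi.
  apply: measurable_fun_pair; first exact: measurable_path_coord.
  by apply: measurable_fun_paths => s; exact: measurable_path_coord.
have mG : measurable_fun setT (F \o Phi) by exact: measurableT_comp.
have := stationary_ge0_integral mG (fun y => F0 (Phi y)).
rewrite /Phi/= => <-; apply: eq_integral => w _; congr (F (Y _ w, _)).
  by rewrite -addn1 PoszD.
apply/funext => s; rewrite /info; congr (Y _ w).
by rewrite -addn1 PoszD; lia.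
Qed.

End Stationarity.

Section Perturbation.
Variable R : realType.

Lemma sum_lt_pairs_le (s : seq nat) (a b : nat -> R) :
  (forall i, 0 <= a i) -> (forall i, 0 <= b i) ->
  \sum_(i <- s) \sum_(j <- s | (i < j)%N) a i * b j <=
  (\sum_(i <- s) a i) * (\sum_(i <- s) b i).
Proof.
move=> a0 b0; rewrite mulr_suml; apply: ler_sum => i _.
rewrite mulr_sumr [leRHS](bigID (fun j => (i < j)%N))/= lerDl.
by apply: sumr_ge0 => j _; exact: mulr_ge0.
Qed.

(** [a i] dominates the growth weight of index [i] before and after the perturbation, so each
    difference is at most [C * a i * a j * (De i + De j)] and the double sums factor into [A * B].
    Both [A] and [B] are of the order of the sample size, [B] with an extra factor [tau], and the
    prefactor cancels the two sizes. *)
Lemma ustat_perturbation d (u : 'cV[R]_d -> 'cV[R]_d -> R) (C : R)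
    (s : seq nat) (h e : nat -> 'cV[R]_d) (tau b : R) :
  0 <= C ->
  (forall x y x' y', `|u x y - u x' y'| <= C *
     ((1 + norm1 x + norm1 x') * (1 + norm1 y + norm1 y') *
      (norm1 (x - x') + norm1 (y - y')))) ->
  (2 <= size s)%N -> 0 < tau -> tau <= 1 -> 0 <= b ->
  \sum_(i <- s) (1 + 2 * norm1 (e i)) ^+ 2 <= b * (size s)%:R ->
  \sum_(i <- s) norm1 (h i - e i) ^+ 2 <= tau ^+ 2 * (size s)%:R ->
  `|2 / ((size s)%:R * ((size s)%:R - 1)) *
    \sum_(i <- s) \sum_(j <- s | (i < j)%N) u (h i) (h j) -
    2 / ((size s)%:R * ((size s)%:R - 1)) *
    \sum_(i <- s) \sum_(j <- s | (i < j)%N) u (e i) (e j)| <=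
  8 * C * (2 * b + 2) * (2 * b + 3) * tau.
Proof.
move=> C0 Hu m2 tau0 tau1 b0 Hb HD.
set m : R := (size s)%:R.
have m2' : 2 <= m by rewrite /m ler_nat.
pose De i := norm1 (h i - e i).
pose a i := 1 + 2 * norm1 (e i) + De i.
have De0 i : 0 <= De i by exact: norm1_ge0.
have e0 i : 0 <= norm1 (e i) by exact: norm1_ge0.
have a1 i : 1 <= a i by rewrite /a; have := De0 i; have := e0 i; lra.
have a0 i : 0 <= a i by apply: le_trans (a1 i).
have hle i : 1 + norm1 (h i) + norm1 (e i) <= a i.
  by have := norm1D (h i - e i) (e i); rewrite subrK /a /De; lra.
have uij i j : `|u (h i) (h j) - u (e i) (e j)| <=
    C * (a i * De i * a j + a i * (a j * De j)).
  apply: le_trans (Hu _ _ _ _) _; apply: ler_wpM2l => //.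
  rewrite (_ : a i * De i * a j + _ = a i * a j * (De i + De j)); last by ring.
  rewrite -/(De i) -/(De j); apply: ler_wpM2r; first exact: addr_ge0.
  by apply: ler_pM => //; rewrite !addr_ge0 ?norm1_ge0.
set A := \sum_(i <- s) a i; set B := \sum_(i <- s) a i * De i.
have A0 : 0 <= A by exact: sumr_ge0.
have B0 : 0 <= B by apply: sumr_ge0 => i _; exact: mulr_ge0.
have H1 : `|\sum_(i <- s) \sum_(j <- s | (i < j)%N) u (h i) (h j) -
    \sum_(i <- s) \sum_(j <- s | (i < j)%N) u (e i) (e j)| <= 2 * C * (A * B).
  rewrite -sumrB.
  apply: (@le_trans _ _ (\sum_(i <- s) \sum_(j <- s | (i < j)%N)
     C * (a i * De i * a j + a i * (a j * De j)))).
    apply: le_trans (ler_norm_sum _ _ _) _; apply: ler_sum => i _.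
    rewrite -sumrB; apply: le_trans (ler_norm_sum _ _ _) _.
    by apply: ler_sum => j _; exact: uij.
  under eq_bigr do rewrite -mulr_sumr big_split.
  rewrite -mulr_sumr big_split/=.
  rewrite (_ : 2 * C * (A * B) = C * (B * A + A * B)); last by ring.
  apply: ler_wpM2l => //; apply: lerD.
    by apply: sum_lt_pairs_le => // i; exact: mulr_ge0.
  by apply: sum_lt_pairs_le => // i; exact: mulr_ge0.
have sq i : a i ^+ 2 <= 2 * (1 + 2 * norm1 (e i)) ^+ 2 + 2 * De i ^+ 2.
  by rewrite /a; have := sqr_ge0 (1 + 2 * norm1 (e i) - De i); nra.
have SQ : \sum_(i <- s) a i ^+ 2 <= (2 * b + 2 * tau ^+ 2) * m.
  apply: (@le_trans _ _ (\sum_(i <- s)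
      (2 * (1 + 2 * norm1 (e i)) ^+ 2 + 2 * De i ^+ 2))).
    by apply: ler_sum => i _; exact: sq.
  rewrite big_split/= -!mulr_sumr; rewrite -/m in Hb HD.
  rewrite /De; nra.
have tau2 : tau ^+ 2 <= 1 by rewrite expr_le1// ltW.
have m0 : 0 < m by lra.
have SQ2 : \sum_(i <- s) a i ^+ 2 <= (2 * b + 2) * m.
  by apply: le_trans SQ _; apply: ler_wpM2r; [exact: ltW|lra].
have HA : A <= (2 * b + 2) * m.
  apply: le_trans _ SQ2; apply: ler_sum => i _.
  by have := a1 i; nra.
have HB : B <= (2 * b + 3) * tau * m.
  (* A weighted inequality of means: the sum of [De i ^+ 2] is of order [tau ^+ 2], so both terms on
     the right are of order [tau]. *)
  have aD i : a i * De i <= tau * a i ^+ 2 + De i ^+ 2 / tau.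
    have : 0 <= (tau * a i - De i) ^+ 2 / tau by rewrite divr_ge0 ?sqr_ge0// ltW.
    rewrite (_ : (tau * a i - De i) ^+ 2 / tau =
      tau * a i ^+ 2 - 2 * (a i * De i) + De i ^+ 2 / tau); last by field; rewrite gt_eqF.
    by have := mulr_ge0 (a0 i) (De0 i); lra.
  apply: (@le_trans _ _ (\sum_(i <- s) (tau * a i ^+ 2 + De i ^+ 2 / tau))).
    by apply: ler_sum => i _; exact: aD.
  rewrite big_split/= -mulr_sumr -mulr_suml.
  have : (\sum_(i <- s) De i ^+ 2) / tau <= tau * m.
    by rewrite ler_pdivrMr// mulrAC -expr2.
  by move: SQ2; nra.
rewrite -mulrBr normrM ger0_norm; last by rewrite divr_ge0// mulr_ge0//; lra.
have m1 : 0 < m - 1 by lra.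
apply: (@le_trans _ _ (2 / (m * (m - 1)) * (2 * C * (A * B)))).
  by apply: ler_wpM2l => //; rewrite divr_ge0// mulr_ge0//; lra.
have AB : A * B <= (2 * b + 2) * m * ((2 * b + 3) * tau * m) by exact: ler_pM.
rewrite mulrAC ler_pdivrMr; last exact: mulr_gt0.
have mm : m * m <= 2 * (m * (m - 1)) by nra.
set K := (2 * b + 2) * (2 * b + 3) * tau.
have K0 : 0 <= C * K by rewrite !mulr_ge0//; lra.
apply: (@le_trans _ _ (4 * C * K * (m * m))).
  rewrite (_ : 4 * C * K * (m * m) =
    4 * C * ((2 * b + 2) * m * ((2 * b + 3) * tau * m))); last by rewrite /K; ring.
  rewrite (_ : 2 * (2 * C * (A * B)) = 4 * C * (A * B)); last by ring.
  by apply: ler_wpM2l => //; rewrite mulr_ge0.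
rewrite (_ : 8 * C * _ * _ * _ * _ = 4 * C * K * (2 * (m * (m - 1)))); last first.
  by rewrite /K; ring.
by apply: ler_wpM2l => //; rewrite -mulrA mulr_ge0.
Qed.

End Perturbation.

Section Increments.
Variable R : realType.

Lemma norm1_increment_le d q (f : 'cV[R]_q -> 'cV[R]_d) (x y : 'cV[R]_q)
    (L : 'I_q -> R) :
  (forall i (z : 'cV[R]_q), (forall j, `|z j 0 - x j 0| <= `|y j 0 - x j 0|) ->
     derivable f z (evec R i) /\ enorm ('D_(evec R i) f z) <= L i) ->
  norm1 (f y - f x) <= d%:R * \sum_i L i * `|y i 0 - x i 0|.
Proof.
move=> H.
have Hr r : `|f y r 0 - f x r 0| <= \sum_i L i * `|y i 0 - x i 0|.
  apply: (coord_lipschitz (f := fun z => f z r 0)) => i z /(H i)[df le].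
  split; first by move/derivable_mxP: df; exact.
  apply: le_trans le; rewrite (_ : 'D_(evec R i) _ z = 'D_(evec R i) f z r 0).
    exact: enorm_entry.
  by rewrite (derive_mx df) mxE.
rewrite /norm1; apply: (@le_trans _ _ (\sum_(r < d) \sum_i L i * `|y i 0 - x i 0|)).
  by apply: ler_sum => r _; rewrite !mxE.
by rewrite sumr_const card_ord mulr_natl.
Qed.

Lemma sqr_sum_le q (L : 'I_q -> R) : (\sum_i L i) ^+ 2 <= q%:R * \sum_i L i ^+ 2.
Proof.
rewrite expr2 mulr_suml.
apply: (@le_trans _ _ (\sum_i \sum_j (L i ^+ 2 + L j ^+ 2) / 2)).
  apply: ler_sum => i _; rewrite mulr_sumr; apply: ler_sum => j _.
  by have := sqr_ge0 (L i - L j); nra.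
under eq_bigr do rewrite -mulr_suml big_split/= sumr_const card_ord.
by rewrite -mulr_suml big_split/= sumrMnl sumr_const card_ord -mulr_natl; lra.
Qed.

(** The error splits into [gh y - g y], the effect of truncating the past, and [g y - g x], the
    effect of estimating the parameter, which the mean value bound controls by the suprema of the
    derivatives times [B / sqrt N]. Infinite suprema make the right-hand side infinite. *)
Lemma sqr_residual_le d q (gh g : 'cV[R]_q -> 'cV[R]_d) (Theta : set 'cV[R]_q)
    (x y : 'cV[R]_q) (B N : R) :
  0 <= B -> 0 < N ->
  (forall z : 'cV[R]_q, (forall j, `|z j 0 - x j 0| <= `|y j 0 - x j 0|) -> Theta z) ->
  (forall i z, Theta z -> derivable g z (evec R i)) ->
  (forall i, `|y i 0 - x i 0| <= B / Num.sqrt N) ->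
  ((norm1 (gh y - g x) ^+ 2)%:E <=
   (2 * d%:R ^+ 2 * (1 + q%:R * B ^+ 2) + 1)%:E *
   (sup_enorm Theta (fun z => (gh z - g z)%R) ^+ 2 +
    N^-1%:E * \sum_i sup_enorm Theta ('D_(evec R i) g) ^+ 2))%E.
Proof.
move=> B0 N0 HTheta dg Hy.
(* The summand 1 keeps [ka] positive when [d = 0], so that [ka] times [+oo] is [+oo]. *)
set ka := 2 * _ * _ + 1.
have ka0 : 0 < ka by rewrite /ka ltr_wpDl// mulr_ge0 ?mulr_ge0 ?sqr_ge0// addr_ge0// mulr_ge0 ?sqr_ge0.
set rho := sup_enorm _ _; pose D i := sup_enorm Theta ('D_(evec R i) g).
have Ty : Theta y by exact: HTheta.
have sup_le (f : 'cV[R]_q -> 'cV[R]_d) z : Theta z -> ((enorm (f z))%:E <= sup_enorm Theta f)%E.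
  by move=> Tz; apply: ereal_sup_ubound; exists z.
have sup_ge0 (f : 'cV[R]_q -> 'cV[R]_d) : (0 <= sup_enorm Theta f)%E.
  by apply: le_trans (sup_le f y Ty); rewrite lee_fin sqrtr_ge0.
have rho0 : (0 <= rho)%E by exact: sup_ge0.
have D0 i : (0 <= D i)%E by exact: sup_ge0.
have sD0 : (0 <= \sum_i D i ^+ 2)%E by apply: sume_ge0 => i _; exact: expe_ge0.
have [rhoy|rhofin] := eqVneq rho +oo%E.
  rewrite rhoy (_ : (+oo ^+ 2)%E = +oo%E)// addye ?gt0_muley ?lee_fin//; first exact: leey.
  by rewrite -ltNye; apply: lt_le_trans (ltNyr 0) _; rewrite mule_ge0// lee_fin invr_ge0 ltW.
have [sDy|sDfin] := eqVneq (\sum_i D i ^+ 2)%E +oo%E.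
  rewrite sDy gt0_muley ?lte_fin ?invr_gt0// addey ?gt0_muley ?leey//.
  by rewrite -ltNye; apply: lt_le_trans (ltNyr 0) _; exact: expe_ge0.
have rhofin' : rho \is a fin_num by rewrite ge0_fin_numE// lt_neqAle rhofin leey.
have Dfin i : D i \is a fin_num.
  rewrite ge0_fin_numE// lt_neqAle leey andbT; apply: contra_neq sDfin => Di.
  apply/eqP; rewrite esum_eqy; last first.
    by move=> j _; rewrite -ltNye; apply: lt_le_trans (ltNyr 0) _; exact: expe_ge0.
  by apply/existsP; exists i; rewrite Di.
pose L i := fine (D i); pose r := fine rho.
have LE i : D i = (L i)%:E by rewrite fineK.
have L0 i : 0 <= L i by exact: fine_ge0.
have rE : rho = r%:E by rewrite fineK.
have r0 : 0 <= r by exact: fine_ge0.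
have -> : (\sum_i D i ^+ 2 = (\sum_i L i ^+ 2)%:E)%E.
  by rewrite -sumEFin; apply: eq_bigr => i _; rewrite LE -EFin_expe.
have -> : (rho ^+ 2 + N^-1%:E * (\sum_i L i ^+ 2)%:E =
    (r ^+ 2 + N^-1 * \sum_i L i ^+ 2)%:E)%E.
  by rewrite rE EFinD EFin_expe EFinM.
rewrite -EFinM lee_fin.
have n1 : norm1 (gh y - g y) <= d%:R * r.
  apply: le_trans (norm1_le_enorm _) _; apply: ler_wpM2l => //.
  by rewrite -lee_fin -rE; exact: (sup_le (fun z => gh z - g z) y Ty).
have sN : 0 < Num.sqrt N by rewrite sqrtr_gt0.
have n2 : norm1 (g y - g x) <= d%:R * ((\sum_i L i) * (B / Num.sqrt N)).
  apply: le_trans (norm1_increment_le (L := L) _) _.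
    move=> i z Hz; split; first exact: dg (HTheta _ Hz).
    by rewrite -lee_fin -LE; exact: (sup_le ('D_(evec R i) g) z (HTheta _ Hz)).
  apply: ler_wpM2l => //; rewrite mulr_suml; apply: ler_sum => i _.
  exact: ler_wpM2l.
have n3 : norm1 (gh y - g x) <= d%:R * (r + (\sum_i L i) * (B / Num.sqrt N)).
  have := norm1D (gh y - g y) (g y - g x).
  by rewrite addrA subrK; lra.
have SL : 0 <= \sum_i L i by exact: sumr_ge0.
have t0 : 0 <= (\sum_i L i) * (B / Num.sqrt N) by rewrite mulr_ge0// divr_ge0// ltW.
have n4 : norm1 (gh y - g x) ^+ 2 <=
    d%:R ^+ 2 * (r + (\sum_i L i) * (B / Num.sqrt N)) ^+ 2.
  rewrite -exprMn ler_sqr ?nnegrE ?norm1_ge0//.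
  by rewrite mulr_ge0// addr_ge0.
apply: le_trans n4 _.
have n5 : ((\sum_i L i) * (B / Num.sqrt N)) ^+ 2 <= q%:R * B ^+ 2 * (N^-1 * \sum_i L i ^+ 2).
  rewrite !exprMn exprVn sqr_sqrtr; last exact: ltW.
  rewrite (_ : q%:R * B ^+ 2 * (N^-1 * \sum_i L i ^+ 2) =
    q%:R * (\sum_i L i ^+ 2) * (B ^+ 2 * N^-1)); last by ring.
  apply: ler_wpM2r; last exact: sqr_sum_le.
  by rewrite mulr_ge0 ?sqr_ge0// invr_ge0 ltW.
set t := _ * (B / _) in n5 t0 *.
set W := N^-1 * _ in n5 *.
have W0 : 0 <= W.
  apply: mulr_ge0; first by rewrite invr_ge0 ltW.
  by apply: sumr_ge0 => i _; exact: sqr_ge0.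
have n6 : (r + t) ^+ 2 <= 2 * ((1 + q%:R * B ^+ 2) * (r ^+ 2 + W)).
  have qB : 0 <= q%:R * B ^+ 2 by rewrite mulr_ge0 ?sqr_ge0.
  have := sqr_ge0 (r - t); have := mulr_ge0 qB (sqr_ge0 r).
  by have := sqr_ge0 r; nra.
apply: (@le_trans _ _ (d%:R ^+ 2 * (2 * ((1 + q%:R * B ^+ 2) * (r ^+ 2 + W))))).
  by apply: ler_wpM2l => //; exact: sqr_ge0.
rewrite [leRHS](_ : _ = d%:R ^+ 2 * (2 * ((1 + q%:R * B ^+ 2) * (r ^+ 2 + W))) +
  (r ^+ 2 + W)); last by rewrite /ka; ring.
by rewrite lerDl addr_ge0// sqr_ge0.
Qed.

End Increments.

(** * Mean square of the residuals *)

Lemma measurable_expe d (T : measurableType d) (R : realType) (f : T -> \bar R) n :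
  measurable_fun setT f -> measurable_fun setT (fun w => f w ^+ n)%E.
Proof.
move=> mf; elim: n => [|n IH]; first exact: measurable_cst.
rewrite (_ : (fun w => _) = (fun w => f w * f w ^+ n)%E).
  exact: emeasurable_funM.
by apply/funext => w; rewrite expeS.
Qed.

Lemma measurable_fun_sum_seq d (T : measurableType d) (R : realType) (J : eqType)
    (s : seq J) (f : J -> T -> R) :
  (forall i, i \in s -> measurable_fun setT (f i)) ->
  measurable_fun setT (fun w => \sum_(i <- s) f i w).
Proof.
elim: s => [|j s IH] H.
  by under eq_fun do rewrite big_nil; exact: measurable_cst.
under eq_fun do rewrite big_cons.
apply: measurable_funD; first exact: (H j (mem_head _ _)).
by apply: IH => i si; apply: H; rewrite inE si orbT.
Qed.

Lemma powR_ge_near (R : realType) (a A : R) : 0 < a ->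
  \forall n \near \oo, A <= n%:R `^ a.
Proof.
move=> a0; near=> n.
have A0 : 0 <= `|A| by [].
apply: le_trans (ler_norm A) _.
rewrite (_ : `|A| = (`|A| `^ a^-1) `^ a); last first.
  by rewrite -powRrM mulVf ?gt_eqF// powRr1.
apply: ge0_ler_powR; [exact: ltW|by rewrite nnegrE powR_ge0|by rewrite nnegrE|].
by near: n; exact: nbhs_infty_ger.
Unshelve. all: by end_near. Qed.

Lemma n0_infty (R : realType) (K0 eps A : R) : 0 < K0 -> eps < 1 ->
  \forall n \near \oo, A <= (n0 K0 eps n)%:R.
Proof.
move=> K0_gt0 e1; near=> n.
have X0 : 0 <= K0 * n%:R `^ (1 - eps) by rewrite mulr_ge0 ?powR_ge0 ?ltW.
have /andP[_] := truncn_itv X0; rewrite -natr1 -/(n0 K0 eps n) => X1.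
have : (A + 1) / K0 <= n%:R `^ (1 - eps).
  by near: n; apply: powR_ge_near; rewrite subr_gt0.
by rewrite ler_pdivrMr// mulrC => X2; lra.
Unshelve. all: by end_near. Qed.

Lemma n0_le (R : realType) (K0 eps : R) : 0 < K0 -> 0 < eps ->
  \forall n \near \oo, (n0 K0 eps n <= n)%N.
Proof.
move=> K0_gt0 e0; near=> n.
have n0 : 0 < n%:R :> R by rewrite ltr0n; near: n; exact: nbhs_infty_ge.
have X0 : 0 <= K0 * n%:R `^ (1 - eps) by rewrite mulr_ge0 ?powR_ge0 ?ltW.
have /andP[X1 _] := truncn_itv X0.
rewrite -(ler_nat R); apply: le_trans X1 _.
have KE : K0 <= n%:R `^ eps by near: n; exact: powR_ge_near.
have E : n%:R = n%:R `^ eps * n%:R `^ (1 - eps) :> R.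
  rewrite -powRD; last by apply/implyP => _; rewrite gt_eqF.
  by rewrite (addrC eps) subrK powRr1// ltW.
by rewrite [leRHS]E ler_wpM2r ?powR_ge0.
Unshelve. all: by end_near. Qed.

Section MeanResidual.
Context (R : realType) d (T : measurableType d) (P : probability T R) (q : nat).
Variables (rho : nat -> T -> \bar R) (D : nat -> 'I_q -> T -> \bar R).
Hypothesis mrho : forall t, measurable_fun setT (rho t).
Hypothesis mD : forall t i, measurable_fun setT (D t i).
Hypothesis rho0 : forall t w, (0 <= rho t w)%E.

Definition sq_residual (N : R) t w : \bar R :=
  (rho t w ^+ 2 + N^-1%:E * \sum_i D t i w ^+ 2)%E.

Lemma measurable_sq_residual N t : measurable_fun setT (sq_residual N t).
Proof.
apply: emeasurable_funD; first exact: measurable_expe.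
apply: emeasurable_funM => //; apply: emeasurable_sum => i.
exact: measurable_expe.
Qed.

Lemma sq_residual_ge0 N t w : 0 < N -> (0 <= sq_residual N t w)%E.
Proof.
move=> N0; apply: adde_ge0; first exact: sqre_ge0.
apply: mule_ge0; first by rewrite lee_fin invr_ge0 ltW.
by apply: sume_ge0 => i _; exact: sqre_ge0.
Qed.

(** The summability assumption bears on fourth powers while the perturbation bound asks for squares;
    a small constant [tau] pays for the exchange. *)
Lemma sqre_le_young (tau : R) (x : \bar R) : 0 < tau -> (0 <= x)%E ->
  (x ^+ 2 <= tau%:E + tau^-1%:E * x ^+ 4)%E.
Proof.
move=> tau0; case: x => [x| |//] x0.
  rewrite -!EFin_expe -EFinM -EFinD lee_fin.
  have : 0 <= (tau - x ^+ 2) ^+ 2 / tau by rewrite divr_ge0 ?sqr_ge0// ltW.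
  rewrite (_ : _ / tau = tau - 2 * x ^+ 2 + tau^-1 * x ^+ 4); last first.
    by field; rewrite gt_eqF.
  by have := sqr_ge0 x; lra.
by rewrite (_ : (+oo ^+ 4)%E = +oo%E)// gt0_muley ?lte_fin ?invr_gt0// addey// leey.
Qed.

(** Relative to the window size the three terms are [tau], [K / tau] over the window size, and
    [E / N]: the last two vanish as the window and the sample grow, and then [tau] may be taken
    small. *)
Lemma integral_sq_residual_le (s : seq nat) (tau N K E : R) : 0 < tau -> 0 < N ->
  (\sum_(t <- s) \int[P]_w rho t w ^+ 4 <= K%:E)%E ->
  (forall t, \sum_i \int[P]_w D t i w ^+ 2 <= E%:E)%E ->
  (\int[P]_w \sum_(t <- s) sq_residual N t w <=
   ((size s)%:R * tau + tau^-1 * K + N^-1 * (size s)%:R * E)%:E)%E.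
Proof.
move=> tau0 N0 HK HE.
have N0' : (0 <= N^-1%:E)%E by rewrite lee_fin invr_ge0 ltW.
have t0' : (0 <= tau^-1%:E)%E by rewrite lee_fin invr_ge0 ltW.
rewrite ge0_integral_sum//; last 2 first.
- by move=> t; exact: measurable_sq_residual.
- by move=> t w _; exact: sq_residual_ge0.
apply: (@le_trans _ _ (\sum_(t <- s) (tau%:E + tau^-1%:E * (\int[P]_w rho t w ^+ 4) +
    (N^-1 * E)%:E))%E).
  apply: lee_sum => t _.
  have mr : measurable_fun setT (fun w => rho t w ^+ 2)%E by exact: measurable_expe.
  have ms : measurable_fun setT (fun w => N^-1%:E * \sum_i D t i w ^+ 2)%E.
    apply: emeasurable_funM => //; apply: emeasurable_sum => i.
    exact: measurable_expe.
  have s0 w : (0 <= N^-1%:E * \sum_i D t i w ^+ 2)%E.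
    by apply: mule_ge0 => //; apply: sume_ge0 => i _; exact: sqre_ge0.
  rewrite /sq_residual (ge0_integralD P measurableT (fun w _ => sqre_ge0 _) mr
    (fun w _ => s0 w) ms).
  apply: leeD.
    rewrite -ge0_integralZl//; last 2 first.
    - exact: measurable_expe.
    - by move=> w _; exact: expe_ge0.
    have -> : (tau%:E = \int[P]_w (cst tau%:E w))%E.
      rewrite -[LHS]mule1 -(probability_setT P).
      by apply/esym; exact: integral_cst.
    rewrite -ge0_integralD//; last 3 first.
    - by move=> w _; rewrite lee_fin ltW.
    - by move=> w _; rewrite mule_ge0// expe_ge0.
    - by apply: emeasurable_funM => //; exact: measurable_expe.
    apply: ge0_le_integral => //.
    - by move=> w _; exact: sqre_ge0.
    - apply: emeasurable_funD => //; apply: emeasurable_funM => //.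
      exact: measurable_expe.
    - by move=> w _; exact: sqre_le_young.
  rewrite ge0_integralZl//; last 2 first.
  - by apply: emeasurable_sum => i; exact: measurable_expe.
  - by move=> w _; apply: sume_ge0 => i _; exact: sqre_ge0.
  rewrite EFinM; apply: lee_wpmul2l => //.
  rewrite ge0_integral_sum//.
  - by move=> i; exact: measurable_expe.
  - by move=> i w _; exact: sqre_ge0.
have sumc (x : R) : (\sum_(t <- s) x%:E = ((size s)%:R * x)%:E)%E.
  by rewrite sumEFin big_const_seq count_predT iter_addr_0 mulr_natl.
rewrite !big_split/= !sumc -ge0_sume_distrr; last first.
  by move=> t _; apply: integral_ge0 => w _; exact: (expe_ge0 4 (rho0 t w)).
rewrite !EFinD; apply: leeD; first apply: leeD => //.
  by rewrite EFinM; exact: lee_wpmul2l.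
by rewrite lee_fin mulrCA mulrA.
Qed.

End MeanResidual.

Lemma cvg_probability1 (R : realType) d (T : measurableType d)
    (P : probability T R) (A : nat -> set T) :
  (forall e : R, 0 < e -> \forall n \near \oo,
     measurable (A n) /\ ((1 - e)%:E <= P (A n))%E) ->
  (fun n => P (A n)) @ \oo --> 1%E.
Proof.
move=> H; apply/fine_cvgP; split.
  by apply: filterS (H 1 ltr01) => n [mA _]; exact: fin_num_measure.
apply/cvgrPdist_le => e e0; apply: filterS (H e e0) => n [mA].
have fA := fin_num_measure P _ mA; have := probability_le1 P mA.
by rewrite /= -[P (A n)]fineK// !lee_fin ler_norml => *; apply/andP; split; lra.
Qed.

Lemma sum_lt_pairs_const (R : realType) (s : seq nat) (x : R) : uniq s ->
  2 * (\sum_(i <- s) \sum_(j <- s | (i < j)%N) x) =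
  (size s)%:R * ((size s)%:R - 1) * x.
Proof.
move=> us.
have E1 : \sum_(i <- s) \sum_(j <- s | (i < j)%N) x =
    \sum_(i <- s) \sum_(j <- s | (j < i)%N) x.
  rewrite (exchange_big_dep predT)//=; apply: eq_bigr => i _.
have E2 : \sum_(i <- s) \sum_(j <- s | j == i) x = (size s)%:R * x.
  rewrite (eq_big_seq (fun=> x)).
    by rewrite big_const_seq count_predT iter_addr_0 mulr_natl.
  move=> i si; rewrite big_const_seq iter_addr_0.
  by rewrite count_uniq_mem// si.
have E3 : \sum_(i <- s) \sum_(j <- s) x = (size s)%:R * (size s)%:R * x.
  by rewrite !big_const_seq !count_predT !iter_addr_0 -mulrnA -[LHS]mulr_natl natrM.
have : \sum_(i <- s) \sum_(j <- s) x = \sum_(i <- s) \sum_(j <- s | (i < j)%N) x +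
    \sum_(i <- s) \sum_(j <- s | (j < i)%N) x + \sum_(i <- s) \sum_(j <- s | j == i) x.
  rewrite -!big_split/=; apply: eq_bigr => i _.
  rewrite (bigID (fun j => (i < j)%N))/= -addrA; congr (_ + _).
  rewrite (bigID (fun j => (j < i)%N))/=; congr (_ + _); apply: eq_bigl => j.
    by rewrite -leqNgt andb_idl// => /ltnW.
  by rewrite -!leqNgt -eqn_leq.
by rewrite E3 E2 -E1; lra.
Qed.

(** * Divergence of the perturbed U-statistic *)

Lemma integral_markov d (T : measurableType d) (R : realType)
    (P : {measure set T -> \bar R}) (X : T -> \bar R) (a b : R) :
  measurable_fun setT X -> (forall w, 0 <= X w)%E -> 0 < a ->
  (\int[P]_w X w <= (a * b)%:E)%E -> (P [set w | (a%:E <= X w)%E] <= b%:E)%E.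
Proof.
move=> mX X0 a0 HX.
have := le_integral_abse P measurableT mX a0; rewrite setTI.
under eq_set do rewrite gee0_abs//.
under eq_integral do rewrite gee0_abs//.
move=> /le_trans/(_ HX); rewrite EFinM; rewrite lee_pmul2l// ?lte_fin//.
Qed.

Lemma measurable_lt_set d (T : measurableType d) (R : realType) (f g : T -> R) :
  measurable_fun setT f -> measurable_fun setT g -> measurable [set w | f w < g w].
Proof.
move=> mf mg; rewrite -[X in measurable X]setTI.
exact: (measurable_fun_ltr mf mg measurableT (Y := [set true])).
Qed.

Lemma measurable_le_set d (T : measurableType d) (R : realType) (f g : T -> R) :
  measurable_fun setT f -> measurable_fun setT g -> measurable [set w | f w <= g w].
Proof.
move=> mf mg; rewrite -[X in measurable X]setTI.
exact: (measurable_fun_ler mf mg measurableT (Y := [set true])).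
Qed.

Section Divergence.
Context (R : realType) (d : nat) dO (Omega : measurableType dO).
Variables (P : probability Omega R).
Notation V := 'cV[R]_d.
Variables (mu : probability V R) (e : nat -> Omega -> V) (h : nat -> nat -> Omega -> V).
Variables (u : V -> V -> R) (C S s2 E2 : R) (m : nat -> nat).
Hypothesis me : forall t, measurable_fun setT (e t).
Hypothesis law : forall t B, measurable B -> P (e t @^-1` B) = mu B.
Hypothesis indep : mutually_independent P e.
Hypothesis mh : forall n t, (0 < t <= n)%N -> measurable_fun setT (h n t).
Hypothesis m_u : measurable_fun setT (fun z : V * V => u z.1 z.2).
Hypothesis C0 : 0 <= C.
Hypothesis u_lip : forall x y x' y', `|u x y - u x' y'| <= C *
  ((1 + norm1 x + norm1 x') * (1 + norm1 y + norm1 y') *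
   (norm1 (x - x') + norm1 (y - y'))).
Hypothesis i_u : (mu \x mu)%E.-integrable setT (fun z : V * V => (u z.1 z.2)%:E).
Hypothesis u_mean : (\int[(mu \x mu)%E]_z (u z.1 z.2)%:E = S%:E)%E.
Hypothesis S0 : 0 < S.
Hypothesis s20 : 0 <= s2.
Hypothesis u_var : (\int[(mu \x mu)%E]_z ((u z.1 z.2 - S) ^+ 2)%:E <= s2%:E)%E.
Hypothesis E20 : 0 <= E2.
Hypothesis mom2 : (\int[mu]_x ((1 + 2 * norm1 x) ^+ 2)%:E <= E2%:E)%E.
Hypothesis m_infty : forall A : R, \forall n \near \oo, A <= (m n)%:R.
Hypothesis m_le : \forall n \near \oo, (m n <= n)%N.

Let win n := index_iota (n - m n + 1) n.+1.
Let pref n : R := 2 / ((m n)%:R * ((m n)%:R - 1)).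

(** The form in which residuals enter: off an event of probability at most [a], their squared errors
    over the window are bounded by a variable whose mean is negligible against [m n]. The constant
    [ka] may depend on [a], as the bound in [O_p(1)] does. *)
Hypothesis perturbation : forall a : R, 0 < a -> exists ka : R,
  exists B1 : nat -> set Omega, exists X : nat -> Omega -> \bar R,
  0 < ka /\
  [/\ forall n, measurable (B1 n),
      \forall n \near \oo, (P (B1 n) <= a%:E)%E,
      forall n, measurable_fun setT (X n) /\ (forall w, 0 <= X n w)%E,
      forall de : R, 0 < de ->
        \forall n \near \oo, (\int[P]_w X n w <= (de * (m n)%:R)%:E)%E &
      \forall n \near \oo, forall w, ~ B1 n w ->
        ((\sum_(t <- win n) norm1 (h n t w - e t w) ^+ 2)%:E <=
         ka%:E * X n w)%E].

Let stat (x : nat -> V) n : R :=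
  pref n * \sum_(i <- win n) \sum_(j <- win n | (i < j)%N) u (x i) (x j).

Let m_u2 (f g : Omega -> V) : measurable_fun setT f -> measurable_fun setT g ->
  measurable_fun setT (fun w => u (f w) (g w)).
Proof.
move=> mf mg.
exact: (measurableT_comp m_u (measurable_fun_pair mf mg)).
Qed.

Let size_win n : (m n <= n)%N -> size (win n) = m n.
Proof. by move=> mn; rewrite size_iota addn1 subSS subKn. Qed.

Let win_mem n t : t \in win n -> (0 < t <= n)%N.
Proof.
by rewrite mem_index_iota addn1 ltnS => /andP[/(leq_ltn_trans (leq0n _)) -> ->].
Qed.

Let measurable_stat n : measurable_fun setT (fun w => stat (fun t => h n t w) n).
Proof.
apply: measurable_funM => //; apply: measurable_fun_sum_seq => i si.
under eq_fun do rewrite big_mkcond; apply: measurable_fun_sum_seq => j sj.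
case: (i < j)%N; last exact: measurable_cst.
by apply: m_u2; apply: mh; exact: win_mem.
Qed.

(** Chebyshev's inequality for the U-statistic of the true innovations, after subtracting [S] from
    each of its terms. *)
Let center_event a : 0 < a -> \forall n \near \oo,
  (P [set w | (S / 4 <= `|stat (e^~ w) n - S|)%R] <= a%:E)%E.
Proof.
move=> a0; near=> n.
have mn : (m n <= n)%N by near: n.
have m2 : 2 <= (m n)%:R :> R by near: n; exact: m_infty.
(* The second moment of the centred statistic is at most [16 m s2 / (m - 1)^2 <= 64 s2 / m], as
   [m - 1 >= m / 2]. It has to be below [a (S / 4)^2], and [64 * 16 = 1024]. *)
have mL : 1024 * s2 / (S ^+ 2 * a) <= (m n)%:R by near: n; exact: m_infty.
have szE := size_win mn.
pose v (z : V * V) := u z.1 z.2 - S.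
have mv : measurable_fun setT v by apply: measurable_funB.
have iS : (mu \x mu)%E.-integrable setT (fun z : V * V => S%:E).
  exact: (finite_measure_integrable_cst (mu \x mu : probability _ R)%E S).
have iv : (mu \x mu)%E.-integrable setT (EFin \o v) by exact: (integrableB measurableT i_u iS).
have v0 : (\int[(mu \x mu)%E]_z (v z)%:E = 0)%E.
  under eq_integral do rewrite EFinB.
  rewrite integralB// u_mean.
  rewrite (integral_cst (mu \x mu : probability _ R)%E measurableT S%:E).
  have E1 : ((mu \x mu)%E setT = 1)%E.
    exact: (probability_setT (mu \x mu : probability _ R)%E).
  by rewrite [X in (_ - _ * X)%E]E1 mule1 subee.
have us : uniq (win n) by exact: iota_uniq.
have irr : irreflexive ltn by move=> i; rewrite /= ltnn.
have := ustat_second_moment me law indep irr mv iv v0 s20 u_var us.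
set Z := fun w => \sum_(i <- win n) \sum_(j <- win n | (i < j)%N) v (e i w, e j w).
move=> HZ.
have p0 : 0 < (m n)%:R * ((m n)%:R - 1) :> R by rewrite mulr_gt0//; lra.
have ZE w : stat (e^~ w) n - S = pref n * Z w.
  rewrite /Z /v/=; under eq_bigr do rewrite sumrB.
  rewrite sumrB mulrBr; congr (_ - _).
  have := sum_lt_pairs_const S us; rewrite szE => H.
  rewrite /pref mulrAC H mulrC mulKf// gt_eqF//.
have mZ : measurable_fun setT Z.
  apply: measurable_fun_sum_seq => i _.
  under eq_fun do rewrite big_mkcond; apply: measurable_fun_sum_seq => j _.
  case: (i < j)%N; last exact: measurable_cst.
  exact: (measurable_funB (m_u2 (me i) (me j)) (measurable_cst S)).
have -> : [set w | (S / 4 <= `|stat (e^~ w) n - S|)%R] =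
    [set w | (((S / 4) ^+ 2)%:E <= ((pref n * Z w) ^+ 2)%:E)%E].
  have sqE w : ((S / 4) ^+ 2 <= (pref n * Z w) ^+ 2) = (S / 4 <= `|stat (e^~ w) n - S|).
    rewrite ZE -[(pref n * Z w) ^+ 2](real_normK (num_real _)).
    by rewrite ler_sqr// nnegrE divr_ge0// ltW.
  by apply/seteqP; split => w /=; rewrite lee_fin sqE.
apply: integral_markov.
- apply: measurable_EFin; apply: measurable_funX; exact: measurable_funM.
- by move=> w; rewrite lee_fin sqr_ge0.
- by rewrite exprn_gt0// divr_gt0.
under eq_integral do rewrite exprMn EFinM.
rewrite ge0_integralZl//; last 3 first.
- by apply: measurable_EFin; exact: measurable_funX.
- by move=> w _; rewrite lee_fin sqr_ge0.
- by rewrite lee_fin sqr_ge0.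
apply: (@le_trans _ _ ((pref n ^+ 2)%:E * (4 * (size (win n))%:R ^+ 3 * s2)%:E)%E).
  by apply: lee_wpmul2l => //; rewrite lee_fin sqr_ge0.
rewrite -EFinM lee_fin szE /pref.
move: m2 mL p0; set M : R := (m n)%:R => m2 mL p0.
rewrite exprMn exprVn mulrAC ler_pdivrMr; last by rewrite exprn_gt0.
have S2a : 0 < S ^+ 2 * a by rewrite mulr_gt0// exprn_gt0.
move: mL; rewrite ler_pdivrMr// => mL.
have M3 : 0 <= M ^+ 3 by rewrite exprn_ge0; lra.
have k1 : 2 ^+ 2 * (4 * M ^+ 3 * s2) <= M ^+ 4 * (S ^+ 2 * a) / 64.
  have := ler_wpM2l M3 mL; rewrite (_ : M ^+ 3 * (M * _) = M ^+ 4 * (S ^+ 2 * a)); last by ring.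
  by rewrite (_ : M ^+ 3 * (1024 * s2) = 1024 * (M ^+ 3 * s2)); [lra|ring].
apply: le_trans k1 _.
have k2 : M ^+ 2 / 4 <= (M - 1) ^+ 2 by nra.
have Sa : 0 <= (S ^+ 2 * a) * M ^+ 2 by rewrite mulr_ge0 ?sqr_ge0// ltW.
have := ler_wpM2l Sa k2.
rewrite (_ : (S / 4) ^+ 2 * a * (M * (M - 1)) ^+ 2 =
  (S ^+ 2 * a * M ^+ 2 * (M - 1) ^+ 2) / 16); last by field.
rewrite (_ : S ^+ 2 * a * M ^+ 2 * (M ^+ 2 / 4) = M ^+ 4 * (S ^+ 2 * a) / 4); last by field.
lra.
Unshelve. all: by end_near. Qed.

Let moment_event a b : 0 < b -> E2 <= a * b -> \forall n \near \oo,
  (P [set w | ((b * (m n)%:R)%:E <=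
     (\sum_(t <- win n) (1 + 2 * norm1 (e t w)) ^+ 2)%:E)%E] <= a%:E)%E.
Proof.
move=> b0 Eab; near=> n.
have mn : (m n <= n)%N by near: n.
have m1 : 1 <= (m n)%:R :> R by near: n; exact: m_infty.
have msq t : measurable_fun setT (fun w => ((1 + 2 * norm1 (e t w)) ^+ 2)%:E).
  apply: measurable_EFin; apply: measurable_funX; apply: measurable_funD => //.
  by apply: measurable_funM => //; exact: (measurableT_comp (@measurable_norm1 R d)).
apply: integral_markov.
- under eq_fun do rewrite -sumEFin; exact: emeasurable_sum.
- by move=> w; rewrite lee_fin sumr_ge0// => t _; exact: sqr_ge0.
- by rewrite mulr_gt0//; lra.
under eq_integral do rewrite -sumEFin.
rewrite ge0_integral_sum//; last by move=> t w _; rewrite lee_fin sqr_ge0.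
apply: (@le_trans _ _ (\sum_(t <- win n) E2%:E)%E).
  apply: lee_sum => t _; apply: le_trans mom2.
  rewrite (ge0_integral_law (me t) (@law t)
    (f := fun x => ((1 + 2 * norm1 x) ^+ 2)%:E))//.
    apply: measurable_EFin; apply: measurable_funX; apply: measurable_funD => //.
    by apply: measurable_funM => //; exact: measurable_norm1.
  by move=> x; rewrite lee_fin sqr_ge0.
rewrite sumEFin big_const_seq count_predT iter_addr_0 (size_win mn) lee_fin -[leLHS]mulr_natr.
by rewrite mulrAC ler_wpM2r// mulrC.
Unshelve. all: by end_near. Qed.

(** Four exceptional events of probability at most [a / 4] are removed: a failure of the
    perturbation bound, a poorly centred true statistic, large innovations, a large [X n]. Elsewhere
    the statistic loses at most [S / 4] twice, so it is at least [S / 2], and the factor [m n]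
    carries it beyond [c]. *)
Lemma ustat_divergence (c : R) :
  (fun n => P [set w | c < (m n)%:R * stat (fun t => h n t w) n]) @ \oo --> 1%E.
Proof.
have mG n : measurable [set w | c < (m n)%:R * stat (fun t => h n t w) n].
  apply: (measurable_lt_set (measurable_cst c)).
  by apply: measurable_funM => //; exact: measurable_stat.
apply: cvg_probability1 => a a0.
have a4 : 0 < a / 4 by rewrite divr_gt0.
have [ka [B1 [X [ka0 [mB1 PB1 mX HX H1]]]]] := perturbation a4.
(* Markov's inequality at level [a / 4] asks for [E2 <= a / 4 * b]; adding 1 to [E2] makes [b]
   positive. *)
pose b := 4 * (E2 + 1) / a.
have b0 : 0 < b by rewrite divr_gt0// mulr_gt0// ltr_wpDl.
have Eb : E2 <= a / 4 * b by rewrite /b (_ : _ * _ = E2 + 1) ?lerDl//; field; rewrite gt_eqF.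
pose K := 8 * C * (2 * b + 2) * (2 * b + 3).
have K0 : 0 <= K by rewrite /K !mulr_ge0//; lra.
pose tau := Num.min 1 (S / 4 / (K + 1)).
have K1 : 0 < K + 1 by rewrite ltr_wpDl.
have tau0 : 0 < tau by rewrite /tau lt_min ltr01/= divr_gt0// divr_gt0.
have tau1 : tau <= 1 by rewrite /tau ge_min lexx.
have Ktau : K * tau <= S / 4.
  have : tau * (K + 1) <= S / 4 by rewrite -ler_pdivlMr// /tau ge_min lexx orbT.
  by lra.
pose de := tau ^+ 2 / ka.
have de0 : 0 < de by rewrite divr_gt0// exprn_gt0.
pose B2 n := [set w | S / 4 <= `|stat (e^~ w) n - S|].
pose B3 n := [set w | ((b * (m n)%:R)%:E <=
     (\sum_(t <- win n) (1 + 2 * norm1 (e t w)) ^+ 2)%:E)%E].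
pose B4 n := [set w | ((de * (m n)%:R)%:E <= X n w)%E].
near=> n; split; first exact: mG.
have mn : (m n <= n)%N by near: n.
have m2 : 2 <= (m n)%:R :> R by near: n; exact: m_infty.
(* Then [m S / 2] is at least [|c| + S / 2], which exceeds [c]. *)
have mc : 2 * `|c| / S + 1 <= (m n)%:R by near: n; exact: m_infty.
have szE := size_win mn.
set G := [set w | _].
have PB2 : (P (B2 n) <= (a / 4)%:E)%E by near: n; exact: (center_event a4).
have PB3 : (P (B3 n) <= (a / 4)%:E)%E by near: n; exact: (moment_event b0 Eb).
have PB4 : (P (B4 n) <= (a / 4)%:E)%E.
  apply: integral_markov; [exact: (mX n).1|exact: (mX n).2|by rewrite mulr_gt0//; lra|].
  rewrite mulrAC; near: n; apply: HX; exact: mulr_gt0.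
have PB1n : (P (B1 n) <= (a / 4)%:E)%E by near: n; exact: PB1.
have mB2 : measurable (B2 n).
  apply: (measurable_le_set (measurable_cst (S / 4))).
  apply: measurableT_comp => //; apply: measurable_funB => //.
  apply: measurable_funM => //; apply: measurable_fun_sum_seq => i _.
  under eq_fun do rewrite big_mkcond; apply: measurable_fun_sum_seq => j _.
  by case: (i < j)%N; [exact: m_u2|exact: measurable_cst].
have mB3 : measurable (B3 n).
  rewrite -[X in measurable X]setTI.
  apply: measurable_lee => //; apply: measurable_EFin.
  apply: measurable_fun_sum_seq => t _; apply: measurable_funX.
  apply: measurable_funD => //.
  by apply: measurable_funM => //; exact: (measurableT_comp (@measurable_norm1 R d)).
have mB4 : measurable (B4 n).
  rewrite -[X in measurable X]setTI.
  by apply: measurable_lee => //; exact: (mX n).1.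
have cover w : G w \/ B1 n w \/ B2 n w \/ B3 n w \/ B4 n w.
  have [B1w|nB1] := pselect (B1 n w); first by right; left.
  have [B2w|nB2] := pselect (B2 n w); first by right; right; left.
  have [B3w|nB3] := pselect (B3 n w); first by do 3 right; left.
  have [B4w|nB4] := pselect (B4 n w); first by do 4 right.
  left; move: nB2 nB3 nB4; rewrite /B2 /B3 /B4/=.
  move=> /negP; rewrite -ltNge => h2 /negP; rewrite -ltNge lte_fin => h3.
  move=> /negP; rewrite -ltNge => h4.
  have HD : \sum_(t <- win n) norm1 (h n t w - e t w) ^+ 2 <= tau ^+ 2 * (m n)%:R.
    rewrite -lee_fin; apply: (@le_trans _ _ (ka%:E * X n w)%E).
      (* The bound holds for all [w] outside [B1 n] from the same [n] on, so [w] is generalised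
         before [near]. *)
      by move: w nB1 {h2 h3 h4}; near: n.
    apply: (@le_trans _ _ (ka%:E * (de * (m n)%:R)%:E)%E).
      by apply: lee_wpmul2l; [rewrite lee_fin ltW|exact: ltW].
    by rewrite -EFinM lee_fin mulrA /de mulrCA divff ?mulr1// gt_eqF.
  have sz2 : (2 <= size (win n))%N by rewrite szE -(ler_nat R).
  have := @ustat_perturbation R d u C (win n) (fun t => h n t w) (e^~ w) tau b
    C0 u_lip sz2 tau0 tau1 (ltW b0).
  rewrite szE => /(_ (ltW h3) HD) Hp.
  have Hs : `|stat (fun t => h n t w) n - stat (e^~ w) n| <= S / 4.
    by apply: le_trans Ktau; exact: Hp.
  have hs : S / 2 <= stat (fun t => h n t w) n.
    by move: Hs h2; rewrite ler_norml ltr_norml => /andP[? ?] /andP[? ?]; lra.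
  rewrite /G/=; apply: (@lt_le_trans _ _ ((m n)%:R * (S / 2))).
    have := ler_norm c; move: mc; rewrite -lerBrDr ler_pdivrMr//.
    by have := S0; lra.
  by apply: ler_wpM2l.
have : (1 <= P G + (P (B1 n) + (P (B2 n) + (P (B3 n) + P (B4 n)))))%E.
  rewrite -(probability_setT P).
  have m34 := measurableU _ _ mB3 mB4; have m24 := measurableU _ _ mB2 m34.
  have m14 := measurableU _ _ (mB1 n) m24.
  apply: (@le_trans _ _ (P (G `|` (B1 n `|` (B2 n `|` (B3 n `|` B4 n)))))).
    apply: le_measure; rewrite ?inE//; first exact: (measurableU _ _ (mG n) m14).
    by move=> w _; exact: cover.
  apply: le_trans (measureU2 P (mG n) m14) _; apply: leeD => //.
  apply: le_trans (measureU2 P (mB1 n) m24) _; apply: leeD => //.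
  apply: le_trans (measureU2 P mB2 m34) _; apply: leeD => //.
  exact: measureU2.
move=> H.
have fG : P G \is a fin_num by exact: fin_num_measure (mG n).
have : (1 <= P G + ((a / 4)%:E + ((a / 4)%:E + ((a / 4)%:E + (a / 4)%:E))))%E.
  by apply: le_trans H _; apply: leeD => //; do 3 (apply: leeD => //).
by rewrite -(fineK fG) -!EFinD !lee_fin; lra.
Unshelve. all: by end_near. Qed.

End Divergence.

(** * The residuals of the model *)

Lemma posdef_unitmx (R : realType) d (A : 'M[R]_d) : posdef A -> A \in unitmx.
Proof.
move=> [As Apos]; rewrite -row_free_unit -kermx_eq0; apply/negPn/negP.
move=> /rowV0Pn[v /sub_kermxP vA v0].
have v0' : v^T != 0 by rewrite -trmx0 (inj_eq trmx_inj).
have := Apos _ v0'; rewrite /dotp.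
rewrite (_ : A *m v^T = (v *m A)^T); last by rewrite trmx_mul As.
by rewrite vA trmx0 mulmx0 mxE ltxx.
Qed.

Lemma measurable_enorm (R : realType) d : measurable_fun setT (@enorm R d).
Proof.
apply: measurableT_comp; first by apply: continuous_measurable_fun; exact: sqrt_continuous.
apply: measurable_sum => i; apply: measurable_funX; exact: measurable_mx_entry.
Qed.

Lemma sum_nat_pairs (R : realType) (a b : nat) (F : nat -> nat -> R) :
  \sum_(a <= i < b) \sum_(i.+1 <= j < b) F i j =
  \sum_(i <- index_iota a b) \sum_(j <- index_iota a b | (i < j)%N) F i j.
Proof.
apply: eq_big_nat => i /andP[ai _].
by rewrite (big_nat_widenl i.+1 a)//; exact: leq_trans ai (leqnSn i).
Qed.

Lemma integral_moment2 (R : realType) d (T : measurableType d) (P : probability T R)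
    d' (X : T -> 'cV[R]_d') (mu : probability 'cV[R]_d' R) :
  measurable_fun setT X ->
  (forall B, measurable B -> P (X @^-1` B) = mu B) ->
  (\int[P]_w (enorm (X w) ^+ 4)%:E < +oo)%E ->
  (\int[mu]_x ((1 + 2 * norm1 x) ^+ 2)%:E < +oo)%E.
Proof.
move=> mX law X4.
have mN : measurable_fun setT (fun x : 'cV[R]_d' => ((1 + 2 * norm1 x) ^+ 2)%:E).
  apply: measurable_EFin; apply: measurable_funX; apply: measurable_funD => //.
  by apply: measurable_funM => //; exact: measurable_norm1.
rewrite -(ge0_integral_law mX law mN); last by move=> x; rewrite lee_fin sqr_ge0.
have mX4 : measurable_fun setT (fun w => (enorm (X w) ^+ 4)%:E).
  apply: measurable_EFin; apply: measurable_funX.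
  exact: measurableT_comp (@measurable_enorm R d') mX.
(* From [(1 + 2 a)^2 <= 2 + 8 a^2], [a <= d' e] and [e^2 <= 1 + e^4], where [a] and [e] are the two
   norms. *)
pose K : R := 2 + 8 * d'%:R ^+ 2.
have K0 : 0 <= K by rewrite addr_ge0// mulr_ge0 ?sqr_ge0.
apply: (@le_lt_trans _ _ (\int[P]_w (K%:E * (1%:E + (enorm (X w) ^+ 4)%:E)))%E).
  apply: ge0_le_integral => //.
  - by move=> w _; rewrite lee_fin sqr_ge0.
  - exact: measurableT_comp mN mX.
  - by apply: emeasurable_funM => //; exact: emeasurable_funD.
  move=> w _; rewrite -EFinD -EFinM lee_fin.
  have := norm1_le_enorm (X w); have := norm1_ge0 (X w).
  set a := norm1 _; set e := enorm _; set D : R := d'%:R => a0 ae.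
  have e0 : 0 <= e by exact: sqrtr_ge0.
  have a2 : a ^+ 2 <= D ^+ 2 * e ^+ 2 by rewrite -exprMn ler_sqr ?nnegrE// mulr_ge0.
  have e2 : e ^+ 2 <= 1 + e ^+ 4 by have := sqr_ge0 (e ^+ 2 - 1); have := sqr_ge0 e; nra.
  have D2 : D ^+ 2 * e ^+ 2 <= D ^+ 2 * (1 + e ^+ 4).
    by apply: ler_wpM2l => //; exact: sqr_ge0.
  have e4 : 0 <= e ^+ 4 by exact: exprn_ge0.
  by rewrite /K; have := sqr_ge0 (1 - 2 * a); nra.
rewrite ge0_integralZl//; last 2 first.
- exact: emeasurable_funD.
- by move=> w _; rewrite adde_ge0// lee_fin exprn_ge0// sqrtr_ge0.
apply: lte_mul_pinfty => //.
rewrite ge0_integralD//; last by move=> w _; rewrite lee_fin exprn_ge0// sqrtr_ge0.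
apply: lte_add_pinfty => //.
have E1 : (\int[P]_w 1%:E = 1%:E * P setT)%E := integral_cst P measurableT 1%:E.
by rewrite E1 mul1e; exact: le_lt_trans (probability_le1 P measurableT) (ltry 1).
Qed.

Section ResidualPerturbation.
Context (R : realType) (d q : nat) (dO : measure_display) (Omega : measurableType dO).
Variables (P : probability Omega R) (Y eta : int -> Omega -> 'cV[R]_d).
Variables (M : infoset R d -> 'cV[R]_q -> 'cV[R]_d).
Variables (C Chalf : infoset R d -> 'cV[R]_q -> 'M[R]_d).
Variables (Theta : set 'cV[R]_q) (theta0 : 'cV[R]_q) (y0 : int -> 'cV[R]_d).
Variables (est : forall n, n.-tuple 'cV[R]_d -> 'cV[R]_q) (m : nat -> nat).
Hypothesis Y_meas : forall t, measurable_fun setT (Y t).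
Hypothesis Y_eq : forall t w, Y t w = M (info Y (t - 1) w) theta0
            + Chalf (info Y (t - 1) w) theta0 *m eta t w.
Hypothesis C_sqrt : forall I theta, Theta theta ->
     is_sqrtmx (C I theta) (Chalf I theta).
Hypothesis theta0_int : Theta° theta0.
Hypothesis g_deriv : forall t w theta i, Theta theta ->
     derivable (g_t M Chalf Y t w) theta (evec R i).
Hypothesis supg1_meas : forall i, measurable_fun setT
     (fun z : 'cV[R]_d * infoset R d =>
        sup_enorm Theta ('D_(evec R i) (gfun M Chalf z.1 z.2))).
Hypothesis supR_meas : forall t : nat, (0 < t)%N ->
     measurable_fun setT (fun w => sup_enorm Theta (Rhat_t M Chalf Y y0 t w)).
Hypothesis est_meas : forall n, measurable_fun setT (@est n).
Hypothesis Y_stationary : strictly_stationary P Y.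
Hypothesis g1_mom2 : forall t i,
     (\int[P]_w (sup_enorm Theta ('D_(evec R i) (g_t M Chalf Y t w))) ^+ 2 < +oo)%E.
Hypothesis est_rate : Op1 P (fun n w =>
     enorm (Num.sqrt n%:R *: (thetahat Y est n w - theta0))).
Hypothesis R_sum : (\sum_(1 <= t <oo)
     \int[P]_w (sup_enorm Theta (Rhat_t M Chalf Y y0 t w)) ^+ 4 < +oo)%E.
Hypothesis m_infty : forall A : R, \forall n \near \oo, A <= (m n)%:R.
Hypothesis m_le : \forall n \near \oo, (m n <= n)%N.

Lemma g_t_theta0 t w : g_t M Chalf Y t w theta0 = eta t w.
Proof.
have T0 : Theta theta0 by exact: nbhs_singleton theta0_int.
have [pC _] := C_sqrt (info Y (t - 1) w) T0.
by rewrite /g_t /gfun Y_eq addrAC subrr add0r mulKmx// posdef_unitmx.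
Qed.

Lemma measurable_thetahat n : measurable_fun setT (thetahat Y est n).
Proof.
have mt : measurable_fun setT (fun w => [tuple Y (t.+1)%:Z w | t < n]).
  apply/measurable_fun_tnthP => i.
  apply: (eq_measurable_fun (Y (i.+1)%:Z)) => // w _.
  by rewrite /= tnth_mktuple.
exact: (measurableT_comp (@est_meas n) mt).
Qed.

Lemma theta0_box : exists2 r : R, 0 < r &
  forall z : 'cV[R]_q, (forall j, `|z j 0 - theta0 j 0| < r) -> Theta z.
Proof.
have /nbhs_ballP[r /= r0 Hr] : nbhs theta0 Theta by exact: theta0_int.
exists r => // z Hz; apply: Hr; split=> // i j.
by rewrite ord1 /ball/= distrC.
Qed.

(** [t.-1.+1] is [t] for positive [t] and 1 for [t = 0]: measurability is given at positive times
    only, and the windows contain no other. *)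
Let rho (t : nat) w := sup_enorm Theta (Rhat_t M Chalf Y y0 t.-1.+1%:Z w).
Let D (t : nat) i w := sup_enorm Theta ('D_(evec R i) (g_t M Chalf Y t%:Z w)).

Let sup_ge0 (f : 'cV[R]_q -> 'cV[R]_d) : (0 <= sup_enorm Theta f)%E.
Proof.
have T0 : Theta theta0 by exact: nbhs_singleton theta0_int.
apply: (@le_trans _ _ (enorm (f theta0))%:E); first by rewrite lee_fin sqrtr_ge0.
by apply: ereal_sup_ubound; exists theta0.
Qed.

Let mrho t : measurable_fun setT (rho t).
Proof. exact: supR_meas. Qed.

Let mD t i : measurable_fun setT (D t i).
Proof.
exact: (measurableT_comp (supg1_meas i)
  (measurable_fun_pair (Y_meas t%:Z) (measurable_info Y_meas (t%:Z - 1)))).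
Qed.

Let D_stationary t i : (\int[P]_w D t i w ^+ 2 = \int[P]_w D 0 i w ^+ 2)%E.
Proof.
have mF := measurable_expe 2 (supg1_meas i).
by have := stationary_info_integral Y_meas Y_stationary t mF (fun z => sqre_ge0 _).
Qed.

Let win n := index_iota (n - m n + 1) n.+1.

Let size_win n : (m n <= n)%N -> size (win n) = m n.
Proof. by move=> mn; rewrite size_iota addn1 subSS subKn. Qed.

Let win_mem n t : t \in win n -> (0 < t <= n)%N.
Proof.
by rewrite mem_index_iota addn1 ltnS => /andP[/(leq_ltn_trans (leq0n _)) -> ->].
Qed.

(** [B1 n] is the event that [sqrt n] times the estimation error exceeds the bound that [est_rate]
    provides at level [a]. Off it, [sqr_residual_le] applies at each time of the window with one
    constant [ka], and [X n] collects the right-hand sides. *)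
Lemma residual_perturbation (a : R) : 0 < a -> exists ka : R,
  exists B1 : nat -> set Omega, exists X : nat -> Omega -> \bar R,
  0 < ka /\
  [/\ forall n, measurable (B1 n),
      \forall n \near \oo, (P (B1 n) <= a%:E)%E,
      forall n, measurable_fun setT (X n) /\ (forall w, 0 <= X n w)%E,
      forall de : R, 0 < de ->
        \forall n \near \oo, (\int[P]_w X n w <= (de * (m n)%:R)%:E)%E &
      \forall n \near \oo, forall w, ~ B1 n w ->
        ((\sum_(t <- win n)
            norm1 (etahat M Chalf Y y0 est n t w - eta t%:Z w) ^+ 2)%:E <=
         ka%:E * X n w)%E].
Proof.
move=> a0; have [B0 HB0] := est_rate a0.
pose B := `|B0|.
pose B1 n := [set w | B0 < enorm (Num.sqrt n%:R *: (thetahat Y est n w - theta0))].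
pose ka := 2 * d%:R ^+ 2 * (1 + q%:R * B ^+ 2) + 1 : R.
have qB : 0 <= q%:R * B ^+ 2 by rewrite mulr_ge0 ?sqr_ge0.
have ka0 : 0 < ka by rewrite /ka ltr_wpDl// !mulr_ge0 ?sqr_ge0// addr_ge0.
(* Equal to the sample size except at [n = 0], where positivity is still required. *)
pose N n : R := n.-1.+1%:R.
have N0 n : 0 < N n by rewrite ltr0n.
pose X n w := (\sum_(t <- win n) sq_residual rho D (N n) t w)%E.
have rho0 t w : (0 <= rho t w)%E by exact: sup_ge0.
have sq0 n t w : (0 <= sq_residual rho D (N n) t w)%E by exact: sq_residual_ge0.
exists ka, B1, X; split => //; split.
- move=> n; apply: (measurable_lt_set (measurable_cst B0)).
  apply: (measurableT_comp (@measurable_enorm R q)).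
  have mt := measurable_thetahat n.
  apply/measurable_mxP => i j.
  rewrite (_ : (fun w => _) = fun w => Num.sqrt n%:R * (thetahat Y est n w i j - theta0 i j)).
    apply: measurable_funM => //; apply: measurable_funB => //.
    exact: (measurable_mxP _).1.
  by apply/funext => w; rewrite !mxE.
- exact: HB0.
- move=> n; split; last by move=> w; apply: sume_ge0 => t _.
  by apply: emeasurable_sum => t; exact: measurable_sq_residual.
- move=> de de0.
  pose Kb := (\sum_(1 <= t <oo)
     \int[P]_w (sup_enorm Theta (Rhat_t M Chalf Y y0 t w)) ^+ 4)%E.
  pose Eb := (\sum_i \int[P]_w D 0 i w ^+ 2)%E.
  have Kb0 : (0 <= Kb)%E.
    by apply: nneseries_ge0 => t _ _; apply: integral_ge0 => w _; exact: expe_ge0.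
  have Eb0 : (0 <= Eb)%E.
    by apply: sume_ge0 => i _; apply: integral_ge0 => w _; exact: sqre_ge0.
  have KbE : Kb = (fine Kb)%:E by rewrite fineK// ge0_fin_numE.
  have EbE : Eb = (fine Eb)%:E.
    rewrite fineK// ge0_fin_numE// /Eb; apply: lte_sum_pinfty => i _; exact: g1_mom2.
  near=> n.
  have mn : (m n <= n)%N by near: n.
  have HK : (\sum_(t <- win n) \int[P]_w rho t w ^+ 4 <= (fine Kb)%:E)%E.
    rewrite -KbE; apply: (@le_trans _ _ (\sum_(1 <= t < n.+1)
        \int[P]_w (sup_enorm Theta (Rhat_t M Chalf Y y0 t%:Z w)) ^+ 4)%E); last first.
      by apply: nneseries_lim_ge => t _ _; apply: integral_ge0 => w _; exact: expe_ge0.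
    rewrite /win [leRHS](@big_cat_nat _ _ _ (n - m n + 1))//=; [|by rewrite addn1|by rewrite addn1 ltnS leq_subr].
    rewrite [X in (_ <= _ + X)%E](_ : _ = \sum_(t <- win n) \int[P]_w rho t w ^+ 4)%E.
      by apply: leeDr; apply: sume_ge0 => t _; apply: integral_ge0 => w _;
        exact: (expe_ge0 4 (sup_ge0 _)).
    apply: eq_big_nat => t /andP[t1 _]; apply: eq_integral => w _.
    by rewrite /rho prednK// (leq_trans _ t1)// addn1.
  have HE t : (\sum_i \int[P]_w D t i w ^+ 2 <= (fine Eb)%:E)%E.
    have -> : (\sum_i \int[P]_w D t i w ^+ 2)%E = Eb.
      exact: (eq_bigr _ (fun i _ => D_stationary t i)).
    by rewrite EbE.
  (* [tau = de / 3] makes the first of the three terms a third of the target; [h1] and [h2] do the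
     same for the truncation term and the estimation term. *)
  have de3 : 0 < de / 3 by rewrite divr_gt0.
  have Hle := integral_sq_residual_le mrho mD rho0 de3 (N0 n) HK HE.
  apply: le_trans Hle _.
  rewrite (size_win mn) lee_fin.
  have h1 : 9 * fine Kb / de ^+ 2 <= (m n)%:R by near: n; exact: m_infty.
  have h2 : 3 * fine Eb / de <= N n.
    apply: (@le_trans _ _ n%:R); first by near: n; exact: nbhs_infty_ger.
    by rewrite ler_nat leqSpred.
  have k1 : (de / 3)^-1 * fine Kb <= de / 3 * (m n)%:R.
    move: h1; rewrite ler_pdivrMr ?exprn_gt0// => h1.
    rewrite mulrC ler_pdivrMr//; move: h1; set mm : R := (m n)%:R; set K := fine Kb.
    by lra.
  have k2 : (N n)^-1 * (m n)%:R * fine Eb <= de / 3 * (m n)%:R.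
    rewrite mulrAC ler_wpM2r// mulrC ler_pdivrMr//.
    by move: h2; rewrite ler_pdivrMr// => h2; lra.
  apply: le_trans (lerD (lerD (lexx _) k1) k2) _; lra.
have [r r0 Hr] := theta0_box.
near=> n => w; rewrite /B1/= => /negP; rewrite -leNgt => nB1.
have n_gt0 : (0 < n)%N by near: n; exact: nbhs_infty_ge.
have NE : N n = n%:R by rewrite /N prednK.
have sn : 0 < Num.sqrt n%:R :> R by rewrite sqrtr_gt0 ltr0n.
have Hy i : `|thetahat Y est n w i 0 - theta0 i 0| <= B / Num.sqrt n%:R.
  rewrite ler_pdivlMr// mulrC -[X in X * _](gtr0_norm sn) -normrM.
  have := enorm_entry (Num.sqrt n%:R *: (thetahat Y est n w - theta0)) i.
  by rewrite !mxE => /le_trans; apply; apply: le_trans nB1 (ler_norm _).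
(* For large [n] the whole box around [theta0] used by the mean value bound lies in the
   neighbourhood given by [theta0_box], hence in [Theta]; no convexity of [Theta] is available. *)
have Br : B / Num.sqrt n%:R < r.
  rewrite ltr_pdivrMr// mulrC -ltr_pdivrMr//.
  have Br0 : 0 <= B / r by apply: divr_ge0; [exact: normr_ge0|exact: ltW].
  rewrite -[ltLHS](ger0_norm Br0) -sqrtr_sqr ltr_sqrt ?ltr0n//.
  by near: n; exact: nbhs_infty_gtr.
have HTheta (z : 'cV[R]_q) : (forall j, `|z j 0 - theta0 j 0| <=
    `|thetahat Y est n w j 0 - theta0 j 0|) -> Theta z.
  move=> Hz; apply: Hr => j; apply: le_lt_trans Br.
  exact: le_trans (Hz j) (Hy j).
have Ht t : t \in win n ->
    ((norm1 (etahat M Chalf Y y0 est n t w - eta t%:Z w) ^+ 2)%:E <=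
     ka%:E * sq_residual rho D (N n) t w)%E.
  move=> /win_mem/andP[t0 _].
  have := @sqr_residual_le R d q (ghat_t M Chalf Y y0 t%:Z w) (g_t M Chalf Y t%:Z w)
    Theta theta0 (thetahat Y est n w) B n%:R (normr_ge0 _).
  rewrite ltr0n g_t_theta0 => /(_ n_gt0 HTheta (fun i z => @g_deriv t%:Z w z i) Hy).
  by rewrite /sq_residual NE /rho prednK.
rewrite /X ge0_sume_distrr; last by move=> t _.
rewrite -sumEFin big_seq [leRHS]big_seq; exact: lee_sum.
Unshelve. all: by end_near. Qed.

End ResidualPerturbation.

(** A bound on the square by a product of functions of one argument each, so that its mean under
    independent arguments is finite as soon as each factor has a finite mean. *)
Lemma sqr_centered_le (R : realFieldType) (u S K a b : R) :
  0 <= K -> 0 <= a -> 0 <= b -> `|u| <= K * ((1 + a) * (1 + b)) ->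
  (u - S) ^+ 2 <= 2 * (K ^+ 2 + S ^+ 2) * ((1 + 2 * a) ^+ 2 * (1 + 2 * b) ^+ 2).
Proof.
move=> K0 a0 b0 hu.
set G := _ * (1 + 2 * b) ^+ 2.
have e1 : (1 + a) ^+ 2 <= (1 + 2 * a) ^+ 2 by rewrite ler_sqr ?nnegrE; lra.
have e2 : (1 + b) ^+ 2 <= (1 + 2 * b) ^+ 2 by rewrite ler_sqr ?nnegrE; lra.
have h1 : u ^+ 2 <= K ^+ 2 * G.
  apply: (@le_trans _ _ ((K * ((1 + a) * (1 + b))) ^+ 2)).
    rewrite -(real_normK (num_real u)) ler_sqr ?nnegrE//.
    by rewrite !mulr_ge0// addr_ge0.
  rewrite !exprMn; apply: ler_wpM2l; first exact: sqr_ge0.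
  by apply: ler_pM => //; exact: sqr_ge0.
have h2 : S ^+ 2 <= S ^+ 2 * G.
  rewrite ler_peMr ?sqr_ge0// /G -exprMn exprn_ege1//.
  by have := mulr_ge0 a0 b0; lra.
have -> : 2 * (K ^+ 2 + S ^+ 2) * G = 2 * (K ^+ 2 * G) + 2 * (S ^+ 2 * G) by ring.
by have := sqr_ge0 (u + S); lra.
Qed.

Theorem theorem3p2 (R : realType) (d q : nat)
  (dO : measure_display) (Omega : measurableType dO) (P : probability Omega R)
  (Y eta : int -> Omega -> 'cV[R]_d)
  (M : infoset R d -> 'cV[R]_q -> 'cV[R]_d)
  (C Chalf : infoset R d -> 'cV[R]_q -> 'M[R]_d)
  (Theta : set 'cV[R]_q) (theta0 : 'cV[R]_q)
  (p p0 : 'cV[R]_d -> R) (k : 'cV[R]_d -> 'cV[R]_d -> R)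
  (y0 : int -> 'cV[R]_d) (est : forall n, n.-tuple 'cV[R]_d -> 'cV[R]_q)
  (K0 eps : R)
  (Y_meas : forall t, measurable_fun setT (Y t))
  (eta_meas : forall t, measurable_fun setT (eta t))
  (Y_eq : forall t w, Y t w = M (info Y (t - 1) w) theta0
            + Chalf (info Y (t - 1) w) theta0 *m eta t w)
  (eta_indep : mutually_independent P eta)
  (eta_idist : identically_distributed P eta)
  (eta_mean : forall t i, (\int[P]_w (eta t w i 0)%:E = 0)%E)
  (eta_cov : forall t i j,
     (\int[P]_w (eta t w i 0 * eta t w j 0)%:E = (i == j)%:R%:E)%E)
  (M_meas : forall theta, Theta theta -> measurable_fun setT (M ^~ theta))
  (C_meas : forall theta, Theta theta -> measurable_fun setT (C ^~ theta))
  (C_posdef : forall I theta, Theta theta -> posdef (C I theta))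
  (C_sqrt : forall I theta, Theta theta ->
     is_sqrtmx (C I theta) (Chalf I theta))
  (cond_mean : forall t i, is_cond_exp P (sigma_info Y (t - 1))
     (fun w => Y t w i 0) (fun w => M (info Y (t - 1) w) theta0 i 0))
  (cond_cov : forall t i j, is_cond_exp P (sigma_info Y (t - 1))
     (fun w => (Y t w - M (info Y (t - 1) w) theta0) i 0
               * (Y t w - M (info Y (t - 1) w) theta0) j 0)
     (fun w => C (info Y (t - 1) w) theta0 i j))
  (Theta_compact : compact Theta) (theta0_int : Theta° theta0)
  (p_dens : is_density p) (p0_dens : is_density p0)
  (eta_dens : forall t (B : set 'cV[R]_d), measurable B ->
     (P (eta t @^-1` B) = \int[lebesgue_cV R d]_(x in B) (p x)%:E)%E)
  (p_score : has_score_on (supp p) p) (p0_score : has_score_on setT p0)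
  (k_ispd : integrally_strictly_posdef (supp p) k)
  (g_deriv : forall t w theta i, Theta theta ->
     derivable (g_t M Chalf Y t w) theta (evec R i))
  (g_deriv2 : forall t w theta i j, Theta theta ->
     derivable ('D_(evec R i) (g_t M Chalf Y t w)) theta (evec R j))
  (supg1_meas : forall i, measurable_fun setT
     (fun z : 'cV[R]_d * infoset R d =>
        sup_enorm Theta ('D_(evec R i) (gfun M Chalf z.1 z.2))))
  (supg2_meas : forall i j, measurable_fun setT
     (fun z : 'cV[R]_d * infoset R d =>
        sup_enorm Theta
          ('D_(evec R j) ('D_(evec R i) (gfun M Chalf z.1 z.2)))))
  (supR_meas : forall t : nat, (0 < t)%N ->
     measurable_fun setT (fun w => sup_enorm Theta (Rhat_t M Chalf Y y0 t w)))
  (est_meas : forall n, measurable_fun setT (est n))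
  (etah_meas : forall n t : nat, (0 < t <= n)%N ->
     measurable_fun setT (etahat M Chalf Y y0 est n t))
  (K0_gt0 : 0 < K0) (eps_bounds : 0 < eps < 1)
  (Y_stationary : strictly_stationary P Y) (Y_ergodic : ergodic P Y)
  (eta_mom4 : forall t, (\int[P]_w (enorm (eta t w) ^+ 4)%:E < +oo)%E)
  (g1_mom2 : forall t i,
     (\int[P]_w (sup_enorm Theta ('D_(evec R i) (g_t M Chalf Y t w))) ^+ 2 < +oo)%E)
  (g2_mom2 : forall t i j,
     (\int[P]_w (sup_enorm Theta
        ('D_(evec R j) ('D_(evec R i) (g_t M Chalf Y t w)))) ^+ 2 < +oo)%E)
  (est_rate : Op1 P (fun n w =>
     enorm (Num.sqrt n%:R *: (thetahat Y est n w - theta0))))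
  (R_sum : (\sum_(1 <= t <oo)
     \int[P]_w (sup_enorm Theta (Rhat_t M Chalf Y y0 t w)) ^+ 4 < +oo)%E)
  (p_cont : continuous p) (p0_cont : continuous p0)
  (pdelta_L2 : (\int[lebesgue_cV R d]_x
     (enorm (p x *: score_diff p0 p x) ^+ 2)%:E < +oo)%E)
  (p0_lip : lipschitz_score p0)
  (k_stein : stein_kernel p k) (k_bounded : kernel_bounded4 k)
  (H1 : p <> p0)
  (c : R) (c_gt0 : 0 < c) :
  (fun n => P [set w |
     c < (n0 K0 eps n)%:R * Shat M Chalf Y y0 est K0 eps p0 k n w])
    @ \oo --> 1%E.
Proof.
have [p_ge0 mp _] := p_dens.
pose X0 : {mfun Omega >-> 'cV[R]_d} :=
  HB.pack (eta 0) (isMeasurableFun.Build _ _ _ _ _ (eta_meas 0)).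
pose mu : probability 'cV[R]_d R := distribution P X0.
have law (t : nat) B : measurable B -> P (eta t%:Z @^-1` B) = mu B.
  by move=> mB; exact: eta_idist.
have dens B : measurable B -> (mu B = \int[lebesgue_cV R d]_(x in B) (p x)%:E)%E.
  by move=> mB; exact: eta_dens 0 B mB.
have mom2 := integral_moment2 (eta_meas 0) (law 0%N) (eta_mom4 0).
have mN2 : measurable_fun setT (fun x : 'cV[R]_d => (1 + 2 * norm1 x) ^+ 2).
  apply: measurable_funX; apply: measurable_funD => //.
  by apply: measurable_funM => //; exact: measurable_norm1.
have iN2 : mu.-integrable setT (fun x : 'cV[R]_d => ((1 + 2 * norm1 x) ^+ 2)%:E).
  apply/integrableP; split; first exact: measurable_EFin.
  by under eq_integral do rewrite gee0_abs ?lee_fin ?sqr_ge0//.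
(* The moment of the innovations, transferred to Lebesgue measure through their density; it
   dominates the truncated integrals. *)
have p_norm1 : (lebesgue_cV R d).-integrable setT
    (fun x : 'cV[R]_d => (norm1 x * p x)%:E).
  apply/integrableP; split.
    by apply: measurable_EFin; apply: measurable_funM => //; exact: measurable_norm1.
  under eq_integral do rewrite gee0_abs ?lee_fin ?mulr_ge0 ?norm1_ge0// EFinM.
  rewrite -(ge0_integral_density mp p_ge0 dens (f := fun x => (norm1 x)%:E)).
  - apply: le_lt_trans mom2; apply: ge0_le_integral => //.
    + by move=> x _; rewrite lee_fin norm1_ge0.
    + exact: measurable_EFin (@measurable_norm1 R d).
    + exact: measurable_EFin.
    + by move=> x _; rewrite lee_fin; have := norm1_ge0 x; nra.
  - exact: measurable_EFin (@measurable_norm1 R d).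
  - by move=> x; rewrite lee_fin norm1_ge0.
have [iu Spos] := stein_u_positive p_dens p0_dens p_score p0_score p_cont p0_cont
  pdelta_L2 p0_lip k_bounded k_ispd p_norm1 H1.
have mu_u := measurable_stein_u k_bounded p0_lip.
have [K Kge0 [u_growth u_lip]] := stein_u_growth k_bounded p0_lip.
pose u (z : 'cV[R]_d * 'cV[R]_d) := stein_u p0 k z.1 z.2.
have i_u : (mu \x mu)%E.-integrable setT (EFin \o u).
  apply/integrableP; split; first exact: measurable_EFin.
  rewrite (ge0_integral_density2 mp p_ge0 dens (f := fun z => `|(u z)%:E|)%E)//; last first.
    by apply: measurableT_comp => //; exact: measurable_EFin.
  have /integrableP[_] := iu; congr (_ < _)%E; apply: eq_integral => z _.
  by rewrite /= normrM EFinM (ger0_norm (mulr_ge0 (p_ge0 _) (p_ge0 _))).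
pose S := fine (\int[(mu \x mu)%E]_z (u z)%:E)%E.
have u_mean : (\int[(mu \x mu)%E]_z (u z)%:E = S%:E)%E.
  by rewrite /S fineK//; exact: integrable_fin_num.
have S0 : 0 < S.
  by rewrite -lte_fin -u_mean (integral_density2 mp p_ge0 dens mu_u).
have mv2 : measurable_fun setT (fun z => (u z - S) ^+ 2).
  by apply: measurable_funX; exact: measurable_funB.
have v2_fin : (\int[(mu \x mu)%E]_z ((u z - S) ^+ 2)%:E < +oo)%E.
  (* The majorant of [sqr_centered_le] is integrable for the product law because each factor has a
     finite mean. *)
  have i2 := integrable_prod2 iN2 iN2.
  have /integrableP[_] := integrableZl measurableT (2 * (K ^+ 2 + S ^+ 2)) i2.
  apply: le_lt_trans; apply: ge0_le_integral => //.
  - by move=> z _; rewrite lee_fin sqr_ge0.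
  - exact: measurable_EFin.
  - apply: measurableT_comp => //; apply: emeasurable_funM => //.
    exact: measurable_int i2.
  move=> z _; rewrite -EFinM/= lee_fin; apply: le_trans (ler_norm _).
  have := u_growth z.1 z.2; rewrite -/(u z).
  by apply: sqr_centered_le => //; exact: norm1_ge0.
have s2E (x : \bar R) : (0 <= x)%E -> (x < +oo)%E -> (x <= (fine x)%:E)%E.
  by move=> x0 x1; rewrite fineK// ge0_fin_numE.
have /andP[eps0 eps1] := eps_bounds.
have m_infty (A : R) : \forall n \near \oo, A <= (n0 K0 eps n)%:R.
  exact: n0_infty.
have m_le : \forall n \near \oo, (n0 K0 eps n <= n)%N by exact: n0_le.
have := @ustat_divergence R d dO Omega P mu (fun t : nat => eta t%:Z)
  (fun n t => etahat M Chalf Y y0 est n t) (stein_u p0 k) K S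
  (fine (\int[(mu \x mu)%E]_z ((u z - S) ^+ 2)%:E)%E)
  (fine (\int[mu]_x ((1 + 2 * norm1 x) ^+ 2)%:E)%E) (n0 K0 eps)
  (fun t => eta_meas t%:Z) law (mutually_independent_nat eta_indep)
  etah_meas mu_u Kge0 u_lip i_u u_mean S0 _ _ _ _ m_infty m_le
  (residual_perturbation Y_meas Y_eq C_sqrt theta0_int g_deriv supg1_meas supR_meas
     est_meas Y_stationary g1_mom2 est_rate R_sum m_infty m_le) c.
move=> diverges.
(* The inner sum of [Shat], which starts at [i.+1], is put in the form of a sum over the window
   filtered by [i < j]. *)
under eq_fun => n.
  rewrite (_ : [set w | _] = [set w | c < (n0 K0 eps n)%:R *
    (2 / ((n0 K0 eps n)%:R * ((n0 K0 eps n)%:R - 1)) *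
     \sum_(i <- index_iota (n - n0 K0 eps n + 1) n.+1)
       \sum_(j <- index_iota (n - n0 K0 eps n + 1) n.+1 | (i < j)%N)
         stein_u p0 k (etahat M Chalf Y y0 est n i w) (etahat M Chalf Y y0 est n j w))]).
    over.
  by apply/seteqP; split => w; rewrite /= /Shat sum_nat_pairs.
apply: diverges.
- by apply: fine_ge0; apply: integral_ge0 => z _; rewrite lee_fin sqr_ge0.
- by apply: s2E => //; apply: integral_ge0 => z _; rewrite lee_fin sqr_ge0.
- by apply: fine_ge0; apply: integral_ge0 => z _; rewrite lee_fin sqr_ge0.
- by apply: s2E => //; apply: integral_ge0 => z _; rewrite lee_fin sqr_ge0.
Qed.
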